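(* Let $u$ be a solution of the following problem: find $u=u(x,y,t)$ such that $$u_t-\Delta u=-F\left(\int_0^t u_x(0,y,s)\,ds\right),\qquad x>0,\ y\in\mathbb{R}^{n-1},\ t>0,$$ $$u(0,y,t)=0,\qquad y\in\mathbb{R}^{n-1},\ t>0,$$ $$u(x,y,0)=h(x,y),\qquad x>0,\ y\in\mathbb{R}^{n-1}.$$ Let $V(y,t)=u_x(0,y,t)$ be the heat flux on the surface $x=0$ and let $\mathcal{F}(V(y,t))=F\left(\int_0^t V(y,s)\,ds\right)$ for $y\in\mathbb{R}^{n-1}$, $t>0$. Then $u$ has the integral representation $$u(x,y,t)=u_0(x,y,t)-\int_0^t\frac{\operatorname{erf}\left(\frac{x}{2\sqrt{t-\tau}}\right)}{\left(2\sqrt{\pi(t-\tau)}\right)^{n-1}}\left[\int_{\mathbb{R}^{n-1}}\exp\left(-\frac{\|y-\eta\|^2}{4(t-\tau)}\right)\mathcal{F}(V(\eta,\tau))\,d\eta\right]d\tau,$$ where $$u_0(x,y,t)=\int_D G_1(x,y,t;\xi,\eta,0)\,h(\xi,\eta)\,d\xi\,d\eta,$$ and $V$ satisfies the Volterra integral equation, in the variable $t>0$ with parameter $y\in\mathbb{R}^{n-1}$, $$V(y,t)=V_0(y,t)-2\int_0^t\frac{1}{\left(2\sqrt{\pi(t-\tau)}\right)^{n}}\left[\int_{\mathbb{R}^{n-1}}\exp\left(-\frac{\|y-\eta\|^2}{4(t-\tau)}\right)\mathcal{F}(V(\eta,\tau))\,d\eta\right]d\tau,$$ where $$V_0(y,t)=\int_D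 G_{1,x}(0,y,t;\xi,\eta,0)\,h(\xi,\eta)\,d\xi\,d\eta.$$
   Context: $D=\{(x,y)\in\mathbb{R}^n: x=x_1>0,\ y=(x_2,\dots,x_n)\in\mathbb{R}^{n-1}\}$, and $\Delta$ is the Laplacian in $\mathbb{R}^n$ (in the variables $(x,y)$). $F:\mathbb{R}\to\mathbb{R}$ and $h:D\to\mathbb{R}$ are the given data. The error function is $\operatorname{erf}(\zeta)=\frac{2}{\sqrt{\pi}}\int_0^{\zeta}e^{-X^2}\,dX$. $G_1$ is the Green's function of the $n$-dimensional heat equation in $D$ with homogeneous Dirichlet boundary condition: $$G_1(x,y,t;\xi,\eta,\tau)=\frac{\exp\left(-\frac{\|y-\eta\|^2}{4(t-\tau)}\right)}{\left(2\sqrt{\pi(t-\tau)}\right)^{n-1}}\,G(x,t,\xi,\tau),\qquad G(x,t,\xi,\tau)=\frac{e^{-\frac{(x-\xi)^2}{4(t-\tau)}}-e^{-\frac{(x+\xi)^2}{4(t-\tau)}}}{2\sqrt{\pi(t-\tau)}},\quad t>\tau,$$ and $G_{1,x}$ denotes the partial derivative of $G_1$ with respect to its first variable $x$.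
   Formalization: Adds the assumption that u and the source F(∫V) grow slower than every Gaussian, uniformly on bounded time intervals (down to t = 0); without it the claim fails (Tychonoff null solutions odd in x with F = 0, h = 0). *)

(* Defs.v *)
From HB Require Import structures.
From mathcomp Require Import all_boot all_order all_algebra.
From mathcomp Require Import all_classical all_reals all_analysis.

Set Implicit Arguments.
Unset Strict Implicit.
Unset Printing Implicit Defensive.

Import Order.TTheory GRing.Theory Num.Theory.
Import numFieldNormedType.Exports.

Local Open Scope classical_set_scope.
Local Open Scope ring_scope.

(* Points of the half-space D of R^n are written (x, y) with x : R, 0 < x, and
   y : 'rV[R]_m, where m = n.-1. *)

(* m-dimensional Lebesgue measure.  The library puts the product sigma-algebra
   on m.-tuple R and not on 'rV[R]_m, so integrals over R^m range over tuples
   and [vec] turns the integration variable into a row vector. *)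
Section lebesgue_tuple.
Context {R : realType}.

Definition tcons m (p : (measurableTypeR R * m.-tuple (measurableTypeR R))%type) :
  m.+1.-tuple (measurableTypeR R) := [tuple of p.1 :: p.2].

Fixpoint lebesgue_tuple m : set (m.-tuple (measurableTypeR R)) -> \bar R :=
  match m with
  | 0 => dirac [tuple]
  | m'.+1 => pushforward (lebesgue_measure \x @lebesgue_tuple m')%E (@tcons m')
  end.

Definition vec m (eta : m.-tuple (measurableTypeR R)) : 'rV[R]_m :=
  \row_i tnth eta i.

Lemma measurable_tcons m : measurable_fun setT (@tcons m).
Proof. by apply: measurable_cons. Qed.

Lemma lebesgue_tuple_bundle m :
  exists mu : {sigma_finite_measure set (m.-tuple (measurableTypeR R)) -> \bar R},
    @lebesgue_tuple m = mu.
Proof.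
elim: m => [|m [mu IH]]; first by exists (dirac [tuple]).
pose P : {measure set _ -> \bar R} := (lebesgue_measure \x mu)%E.
have mf : forall A, measurable A -> measurable (@tcons m @^-1` A).
  by move=> A mA; rewrite -[X in measurable X]setTI; exact: measurable_tcons.
have /sigma_finiteP[F [FT ndF Foo]] := sigma_finiteT (@lebesgue_measure R).
have /sigma_finiteP[G [GT ndG Goo]] := sigma_finiteT mu.
pose Q : set (m.+1.-tuple (measurableTypeR R)) -> \bar R := pushforward P (@tcons m).
have Q0 : Q set0 = 0%E by rewrite /Q /pushforward preimage_set0 measure0.
have Q_ge0 A : (0 <= Q A)%E by exact: (measure_ge0 P).
have Q_sadd : semi_sigma_additive Q.
  move=> H mH tH mUH; rewrite /Q /pushforward preimage_bigcup.
  apply: measure_semi_sigma_additive.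
  - by move=> k; exact: mf.
  - apply/trivIsetP => i j _ _ ij; rewrite -preimage_setI.
    by move/trivIsetP : tH => -> //; rewrite preimage_set0.
  - by rewrite -preimage_bigcup; exact: mf.
pose g (t : m.+1.-tuple (measurableTypeR R)) := (thead t, [tuple of behead t]).
have mg : measurable_fun setT g.
  apply: measurable_fun_pair; first exact: measurable_tnth.
  exact: measurable_behead.
have gK p : g (tcons p) = p.
  by case: p => a b; rewrite /g /tcons theadE; congr (_, _); exact/val_inj.
have sQ : sigma_finite setT Q.
  exists (fun k => g @^-1` (F k `*` G k)).
    rewrite -preimage_bigcup -[LHS](@preimage_setT _ _ g); congr (_ @^-1` _).
    rewrite -setXTT FT GT; apply/seteqP; split=> -[x y] /=.
      move=> [[i _ Fi] [k _ Gk]]; exists (maxn i k) => //; split.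
      - by move: x Fi; exact/subsetPset/ndF/leq_maxl.
      - by move: y Gk; exact/subsetPset/ndG/leq_maxr.
    by move=> [i _ [Fi Gi]]; split; exists i.
  move=> k; have [mFk Fk] := Foo k; have [mGk Gk] := Goo k; split.
    by rewrite -[X in measurable X]setTI; apply: mg => //; exact: measurableX.
  rewrite /Q /pushforward -comp_preimage (_ : _ \o _ = id); last first.
    by apply/funext => p /=; rewrite gK.
  by rewrite preimage_id [P _]product_measure1E// lte_mul_pinfty// ge0_fin_numE.
pose mQ := isMeasure.Build _ _ _ Q Q0 Q_ge0 Q_sadd.
pose MQ : {measure set _ -> \bar R} := HB.pack Q mQ.
pose sMQ := Measure_isSigmaFinite.Build _ _ _ MQ sQ.
pose SQ : {sigma_finite_measure set _ -> \bar R} := HB.pack (Measure.sort MQ) sMQ.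
by exists SQ; rewrite /= IH.
Qed.

Let lebesgue_tuple0 m : @lebesgue_tuple m set0 = 0%E.
Proof. by have [mu ->] := lebesgue_tuple_bundle m; rewrite measure0. Qed.

Let lebesgue_tuple_ge0 m A : (0 <= @lebesgue_tuple m A)%E.
Proof. by have [mu ->] := lebesgue_tuple_bundle m; exact: measure_ge0. Qed.

Let lebesgue_tuple_sigma_additive m : semi_sigma_additive (@lebesgue_tuple m).
Proof.
have [mu ->] := lebesgue_tuple_bundle m; exact: measure_semi_sigma_additive.
Qed.

HB.instance Definition _ m := isMeasure.Build _ _ _ (@lebesgue_tuple m)
  (lebesgue_tuple0 m) (@lebesgue_tuple_ge0 m)
  (@lebesgue_tuple_sigma_additive m).

Let sigma_finite_lebesgue_tuple m : sigma_finite setT (@lebesgue_tuple m).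
Proof. by have [mu ->] := lebesgue_tuple_bundle m; exact: sigma_finiteT. Qed.

HB.instance Definition _ m := Measure_isSigmaFinite.Build _ _ _
  (@lebesgue_tuple m) (sigma_finite_lebesgue_tuple m).

End lebesgue_tuple.

Section half_space_heat.
Context {R : realType}.
Implicit Types (x xi t tau zeta : R).

(* The oriented integral from 0 to zeta: one of the two terms vanishes. *)
Definition erf zeta : R :=
  2 / Num.sqrt pi *
  (\int[lebesgue_measure]_(X in `[0, zeta]) expR (- X ^+ 2)
   - \int[lebesgue_measure]_(X in `[zeta, 0]) expR (- X ^+ 2)).

Definition G x t xi tau : R :=
  (expR (- ((x - xi) ^+ 2 / (4 * (t - tau))))
   - expR (- ((x + xi) ^+ 2 / (4 * (t - tau)))))
  / (2 * Num.sqrt (pi * (t - tau))).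

Variable m : nat.
Implicit Types (y eta : 'rV[R]_m) (u : R -> 'rV[R]_m -> R -> R).

(* Squared Euclidean norm; the library's norm on 'rV[R]_m is the sup norm. *)
Definition sqnorm y : R := \sum_(i < m) y 0 i ^+ 2.

Definition gauss y eta t tau : R :=
  expR (- (sqnorm (y - eta) / (4 * (t - tau)))).

Definition G1 x y t xi eta tau : R :=
  gauss y eta t tau / (2 * Num.sqrt (pi * (t - tau))) ^+ m * G x t xi tau.

Definition G1x x y t xi eta tau : R :=
  derive1 (fun x' => G1 x' y t xi eta tau) x.

(* Extended-real valued, so that an equation with a finite real left-hand side
   also asserts that the integral converges. *)
Definition int_D (f : R -> 'rV[R]_m -> R) : \bar R :=
  (\int[lebesgue_measure \x @lebesgue_tuple R m]_(p in [set p | (0 < p.1)%R])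
     (f p.1 (vec p.2))%:E)%E.

Definition u0 (h : R -> 'rV[R]_m -> R) x y t : \bar R :=
  int_D (fun xi eta => G1 x y t xi eta 0 * h xi eta).

Definition V0 (h : R -> 'rV[R]_m -> R) y t : \bar R :=
  int_D (fun xi eta => G1x 0 y t xi eta 0 * h xi eta).

Definition dx u x y t : R := derive1 (fun x' => u x' y t) x.
Definition dt u x y t : R := derive1 (u x y) t.
Definition dy (i : 'I_m) u x y t : R :=
  'D_(delta_mx 0 i) (fun y' => u x y' t) y.

Definition laplacian u x y t : R :=
  dx (dx u) x y t + \sum_(i < m) dy i (dy i u) x y t.

(* u_x(0, y, t): since u lives on x >= 0, a one-sided derivative. *)
Definition flux_quotient u y t x : R := x^-1 * (u x y t - u 0 y t).
Definition flux u y t : R := lim (flux_quotient u y t x @[x --> 0^'+]).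

Definition calF (F : R -> R) (V : 'rV[R]_m -> R -> R) y t : R :=
  F (\int[lebesgue_measure]_(s in `]0, t[) V y s).

Definition jointly_continuous_at u x y t :=
  {for (x, y, t), continuous (fun p : R * 'rV[R]_m * R => u p.1.1 p.1.2 p.2)}.

(* The derivatives occurring in the heat equation exist and, together with u,
   are continuous on D x ]0, +oo[. *)
Definition classical_regularity u := forall x y t, 0 < x -> 0 < t ->
  [/\ jointly_continuous_at u x y t,
      derivable (u x y) t 1 /\ jointly_continuous_at (dt u) x y t,
      [/\ derivable (fun x' => u x' y t) x 1,
          derivable (fun x' => dx u x' y t) x 1 &
          jointly_continuous_at (dx (dx u)) x y t] &
      forall i : 'I_m,
      [/\ derivable (fun y' => u x y' t) y (delta_mx 0 i),
          derivable (fun y' => dy i u x y' t) y (delta_mx 0 i) &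
          jointly_continuous_at (dy i (dy i u)) x y t]].

(* The boundary flux exists and is integrable in time up to t = 0, so that
   the source term makes sense. *)
Definition has_flux u := forall y t, 0 < t ->
  cvg (flux_quotient u y t x @[x --> 0^'+]) /\
  lebesgue_measure.-integrable `]0, t[ (fun s => (flux u y s)%:E).

Record is_solution (F : R -> R) (h : R -> 'rV[R]_m -> R) u : Prop := {
  sol_regular : classical_regularity u ;
  sol_flux : has_flux u ;
  sol_eq : forall x y t, 0 < x -> 0 < t ->
    dt u x y t - laplacian u x y t = - calF F (flux u) y t ;
  sol_bdry : forall y t, 0 < t -> u 0 y t = 0 ;
  sol_init : forall x y, 0 < x ->
    u x y 0 = h x y /\ u x y t @[t --> 0^'+] --> h x y }.

(* Growth below every Gaussian, locally uniformly in time: without a growth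
   condition at infinity the problem is not uniquely solvable (Tychonoff) and
   the heat potentials need not converge. *)
Definition subgaussian_solution u := forall T eps : R, 0 < T -> 0 < eps ->
  exists A : R, forall x y t, 0 < x -> 0 < t <= T ->
    `|u x y t| <= A * expR (eps * (x ^+ 2 + sqnorm y)).

Definition subgaussian_source (f : 'rV[R]_m -> R -> R) :=
  forall T eps : R, 0 < T -> 0 < eps ->
  exists A : R, forall y t, 0 < t <= T ->
    `|f y t| <= A * expR (eps * sqnorm y).

End half_space_heat.

(* Main.v *)
Require Import Defs.
From HB Require Import structures.
From mathcomp Require Import all_boot all_order all_algebra.
From mathcomp Require Import all_classical all_reals all_analysis.
From mathcomp Require Import measurable_realfun ring lra.

Set Implicit Arguments.
Unset Strict Implicit.
Unset Printing Implicit Defensive.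

Import Order.TTheory GRing.Theory Num.Theory.
Import numFieldNormedType.Exports.

Local Open Scope classical_set_scope.
Local Open Scope ring_scope.

(** Fix a point (x, y, t).  As a function of (xi, eta, s) the Green function G
    of the half-space solves the backward heat equation and vanishes at xi = 0.
    Write f for the source.  Since u solves u_t - Laplacian u = - f and also
    vanishes at xi = 0, Green's second identity gives
       d/ds (integral over D of G(., s) u(., s))
          = - integral over D of G(., s) f(., s).
    The pairing on the left tends to u(x, y, t) as s tends to t, because G
    concentrates at (x, y), and to u0 as s tends to 0.  The source does not
    depend on xi, and the integral of G over xi > 0 is an error function times
    a Gaussian in y - eta: this is the representation of u.

    Two things stand in the way of Green's identity: only u itself is known to
    be small at infinity, not its derivatives, and the derivatives of u are
    controlled only inside D.  The identity is therefore applied on the box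
    [delta, delta + 1/beta] x [-1/beta, 1/beta]^m to the test function [Phi],
    which is G shifted by delta in xi and multiplied by the cutoff
    (1 - (beta z)^2)^2 in each variable.  The cutoff vanishes to second order
    on the outer faces and the shifted G vanishes on the face xi = delta, so
    no derivative of u contributes on a face.  What is left over is a
    flux term Phi_xi(delta) u(delta, .), which tends to 0 with delta by the
    boundary condition, and an error [Err] made of derivatives of the cutoff,
    which is O(beta).  All bounds are by a fixed Gaussian, because u and f grow
    less than any Gaussian; dominated convergence for beta = delta = 1/(k+1)
    gives [duality], and two more limits, s to 0 and s to t, give
    [representation_u].

    For the flux, the representation of u is divided by x and x = 1/(k+1)
    tends to 0.  For 0 < x <= 1 the quotient G/x is bounded by a Gaussian, and
    erf(x / (2 sqrt q)) / x is at most 1/sqrt(pi q), which is integrable in q up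
    to 0; dominated convergence gives [representation_flux]. *)

(** * Real-valued Lebesgue integrals *)

Section product_sigma_finite.
Context d1 d2 (T1 : measurableType d1) (T2 : measurableType d2) (R : realType).
Variables (m1 : {sigma_finite_measure set T1 -> \bar R})
  (m2 : {sigma_finite_measure set T2 -> \bar R}).

Lemma product_sigma_finite : sigma_finite setT (m1 \x m2)%E.
Proof.
have /sigma_finiteP[F [TF ndF Foo]] := sigma_finiteT m1.
have /sigma_finiteP[G [TG ndG Goo]] := sigma_finiteT m2.
exists (fun n => F n `*` G n).
  rewrite -setXTT TF TG predeqE => -[x y]; split.
    move=> [/= [n _ Fnx] [k _ Gky]]; exists (maxn n k) => //; split.
    - by move: x Fnx; exact/subsetPset/ndF/leq_maxl.
    - by move: y Gky; exact/subsetPset/ndG/leq_maxr.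
  by move=> [n _ []/= ? ?]; split; exists n.
move=> k; have [? ?] := Foo k; have [? ?] := Goo k.
split; first exact: measurableX.
by rewrite [X in (X < _)%E]product_measure1E// lte_mul_pinfty// ge0_fin_numE.
Qed.

Let P : {measure set (T1 * T2) -> \bar R} := (m1 \x m2)%E.
Let sP := Measure_isSigmaFinite.Build _ _ _ P product_sigma_finite.

(** Bundled as sigma-finite, so that it can be a factor of another product. *)
Definition prod_sf : {sigma_finite_measure set (T1 * T2)%type -> \bar R} :=
  HB.pack (Measure.sort P) sP.

End product_sigma_finite.

Section real_integrals.
Context d (T : measurableType d) (R : realType).
Variable mu : {measure set T -> \bar R}.
Implicit Types f g : T -> R.

Definition summable_fun f := mu.-integrable setT (EFin \o f).

Lemma EFin_Rintegral f : summable_fun f ->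
  (\int[mu]_x f x)%:E = (\int[mu]_x (f x)%:E)%E.
Proof. by move=> intf; rewrite fineK//; exact: integrable_fin_num. Qed.

Lemma summable_measurable f : summable_fun f -> measurable_fun setT f.
Proof. by move=> /measurable_int/measurable_EFinP. Qed.

Lemma summable_le f g : measurable_fun setT f -> summable_fun g ->
  (forall x, `|f x| <= g x) -> summable_fun f.
Proof.
move=> mf sg fg; apply: le_integrable sg => //; first exact/measurable_EFinP.
move=> x _ /=; rewrite lee_fin (le_trans (fg x))//.
exact: ler_norm.
Qed.

Lemma summable_scale k f : summable_fun f -> summable_fun (fun x => k * f x).
Proof.
move=> sf; apply: eq_integrable (integrableZl measurableT k sf) => //.
Qed.

Lemma summable_add f g : summable_fun f -> summable_fun g ->
  summable_fun (fun x => f x + g x).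
Proof.
move=> sf sg; apply: eq_integrable (integrableD measurableT sf sg) => //.
Qed.

Lemma summable_subr f g : summable_fun f -> summable_fun g ->
  summable_fun (fun x => f x - g x).
Proof.
move=> sf sg; apply: eq_integrable (integrableB measurableT sf sg) => //.
Qed.

Lemma summable_bigsum I (r : seq I) (P : pred I) (F : I -> T -> R) :
  (forall i, P i -> summable_fun (F i)) ->
  summable_fun (fun x => \sum_(i <- r | P i) F i x).
Proof.
move=> h; elim: r => [|i r IH].
  apply: eq_integrable (integrable0 _ _) => // x _ /=.
  by rewrite big_nil.
have [Pi|nPi] := boolP (P i).
  apply: eq_integrable (summable_add (h _ Pi) IH) => // x _ /=.
  by rewrite big_cons Pi.
apply: eq_integrable IH => // x _ /=.
by rewrite big_cons (negbTE nPi).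
Qed.

Lemma Rintegral_add f g : summable_fun f -> summable_fun g ->
  \int[mu]_x (f x + g x) = \int[mu]_x f x + \int[mu]_x g x.
Proof. by move=> sf sg; rewrite RintegralD. Qed.

Lemma Rintegral_subr f g : summable_fun f -> summable_fun g ->
  \int[mu]_x (f x - g x) = \int[mu]_x f x - \int[mu]_x g x.
Proof. by move=> sf sg; rewrite RintegralB. Qed.

Lemma Rintegral_scale k f : summable_fun f ->
  \int[mu]_x (k * f x) = k * \int[mu]_x f x.
Proof. by move=> sf; rewrite RintegralZl. Qed.

Lemma Rintegral_sum I (r : seq I) (P : pred I) (F : I -> T -> R) :
  (forall i, P i -> summable_fun (F i)) ->
  \int[mu]_x (\sum_(i <- r | P i) F i x) = \sum_(i <- r | P i) \int[mu]_x F i x.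
Proof.
move=> h; elim: r => [|i r IH].
  rewrite big_nil; under eq_Rintegral do rewrite big_nil.
  by rewrite Rintegral_cst// mul0r.
rewrite big_cons; under eq_Rintegral do rewrite big_cons.
case: ifPn => [Pi|_]; last exact: IH.
by rewrite RintegralD// ?IH//; [exact: h|exact: summable_bigsum].
Qed.

(** Dominated convergence.  The domination is required at every point, which
    avoids negligible sets throughout. *)
Lemma cvg_Rintegral (f_ : nat -> T -> R) f g :
  (forall n, measurable_fun setT (f_ n)) ->
  (forall x, f_ n x @[n --> \oo] --> f x) ->
  summable_fun g -> (forall n x, `|f_ n x| <= g x) ->
  summable_fun f /\ \int[mu]_x f_ n x @[n --> \oo] --> \int[mu]_x f x.
Proof.
move=> mf_ f_f sg f_g.
have mf : measurable_fun setT f by exact: (measurable_fun_cvg mf_).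
have sf_ n : summable_fun (f_ n) by exact: summable_le (f_g n).
have [] := @dominated_convergence _ _ _ mu setT measurableT
  (fun n => EFin \o f_ n) (EFin \o f) (EFin \o g).
- by move=> n; exact/measurable_EFinP.
- exact/measurable_EFinP.
- by apply: aeW => x _; apply/cvg_EFin; [exact: nearW|exact: f_f].
- exact: sg.
- by apply: aeW => x n _; rewrite /= lee_fin.
move=> sf _ cv; split=> //.
by apply: fine_cvg; rewrite EFin_Rintegral.
Qed.

Lemma Rintegral_le_norm f g : summable_fun f -> summable_fun g ->
  (forall x, `|f x| <= g x) -> `|\int[mu]_x f x| <= \int[mu]_x g x.
Proof.
move=> sf sg fg; apply: (le_trans (le_normr_Rintegral measurableT sf)).
apply: le_Rintegral => //.
by have := integrable_norm sf.
Qed.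

End real_integrals.

Section fubini_real.
Context d1 d2 (T1 : measurableType d1) (T2 : measurableType d2) (R : realType).
Variables (m1 : {sigma_finite_measure set T1 -> \bar R})
  (m2 : {sigma_finite_measure set T2 -> \bar R}).

(** The hypothesis on the slices is required at every point, so that the inner
    integral is a genuine real number everywhere and not just almost
    everywhere. *)
Lemma Rfubini1 (f : T1 * T2 -> R) : summable_fun (prod_sf m1 m2) f ->
  (forall x, summable_fun m2 (fun y => f (x, y))) ->
  summable_fun m1 (fun x => \int[m2]_y f (x, y)) /\
  \int[m1]_x \int[m2]_y f (x, y) = \int[prod_sf m1 m2]_p f p.
Proof.
move=> sf sf2.
have E : EFin \o (fun x => \int[m2]_y f (x, y)) =
    fubini_F m2 (EFin \o f).
  by apply/funext => x /=; rewrite EFin_Rintegral.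
split; first by rewrite /summable_fun E; exact: integrable_fubini_F.
rewrite {1}/Rintegral; congr fine.
rewrite -(integral12_prod_meas1 sf).
by apply: eq_integral => x _; exact: (congr1 (fun h => h x) E).
Qed.

Lemma Rfubini2 (f : T1 * T2 -> R) : summable_fun (prod_sf m1 m2) f ->
  (forall y, summable_fun m1 (fun x => f (x, y))) ->
  summable_fun m2 (fun y => \int[m1]_x f (x, y)) /\
  \int[m2]_y \int[m1]_x f (x, y) = \int[prod_sf m1 m2]_p f p.
Proof.
move=> sf sf2.
have E : EFin \o (fun y => \int[m1]_x f (x, y)) =
    fubini_G m1 (EFin \o f).
  by apply/funext => x /=; rewrite EFin_Rintegral.
split.
  rewrite /summable_fun E; apply/integrableP; split.
    exact: (measurable_fubini_G sf).
  have lty := (integrable21ltyP m1 m2 (measurable_int _ sf)).1 sf.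
  apply: le_lt_trans lty.
  apply: ge0_le_integral => //.
  - by apply: measurableT_comp => //; exact: (measurable_fubini_G sf).
  - apply: (measurable_fun_fubini_tonelli_G (abse \o (EFin \o f))) => //.
      by apply: measurableT_comp => //; exact: (measurable_int _ sf).
    by move=> z; exact: abse_ge0.
  - move=> y _; apply: le_abse_integral => //.
    exact: (measurable_int _ (sf2 y)).
rewrite {1}/Rintegral; congr fine.
rewrite -(integral21_prod_meas1 sf).
by apply: eq_integral => x _; exact: (congr1 (fun h => h x) E).
Qed.

Lemma summable_prod (g1 : T1 -> R) (g2 : T2 -> R) :
  summable_fun m1 g1 -> summable_fun m2 g2 ->
  summable_fun (prod_sf m1 m2) (fun p => g1 p.1 * g2 p.2).
Proof.
move=> s1 s2.
have mg1 := summable_measurable s1; have mg2 := summable_measurable s2.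
have mg : measurable_fun setT (EFin \o (fun p : T1 * T2 => g1 p.1 * g2 p.2)).
  apply/measurable_EFinP; apply: measurable_funM.
    by apply: measurableT_comp.
  by apply: measurableT_comp.
apply/(integrable12ltyP m1 m2 mg).
rewrite [ltLHS](_ : _ = (\int[m1]_x ((\int[m2]_y `|(g2 y)%:E|) * `|(g1 x)%:E|))%E).
  have [/= _ f1] := (integrableP _ _ _ s1).
  have [/= _ f2] := (integrableP _ _ _ s2).
  have I0 : (0 <= \int[m2]_y `|g2 y|%:E)%E by exact: integral_ge0.
  have mg1' : measurable_fun setT (fun x => `|g1 x|%:E).
    by apply/measurable_EFinP; exact: measurableT_comp.
  rewrite ge0_integralZl// lte_mul_pinfty//.
  by rewrite ge0_fin_numE//; exact: integral_ge0.
have mg2' : measurable_fun setT (fun x => `|g2 x|%:E).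
  by apply/measurable_EFinP; exact: measurableT_comp.
apply: eq_integral => x _ /=.
under eq_integral do rewrite normrM EFinM muleC.
by rewrite ge0_integralZr.
Qed.

Lemma Rintegral_prod (g1 : T1 -> R) (g2 : T2 -> R) :
  summable_fun m1 g1 -> summable_fun m2 g2 ->
  \int[prod_sf m1 m2]_p (g1 p.1 * g2 p.2) = (\int[m1]_x g1 x) * \int[m2]_y g2 y.
Proof.
move=> s1 s2; have s := summable_prod s1 s2.
have [|_ <-] := Rfubini1 s; first by move=> x /=; exact: summable_scale.
rewrite /=; under eq_Rintegral => x _ do rewrite RintegralZl//.
by rewrite RintegralZr.
Qed.

End fubini_real.

(** * Changes of variables with constant Jacobian *)

Section scaling_maps.
Context {R : realType}.

(** [phi] is a change of variables whose Jacobian has the constant absolute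
    value [c].  Stated for nonnegative measurable functions, because in that
    form it passes to products by Tonelli's theorem without integrability
    conditions. *)
Definition scales d (T : measurableType d) (mu : {measure set T -> \bar R})
    (phi : T -> T) (c : R) :=
  [/\ measurable_fun setT phi, 0 <= c & forall f : T -> \bar R,
    measurable_fun setT f -> (forall x, 0 <= f x)%E ->
    (\int[mu]_x f x = c%:E * \int[mu]_x f (phi x))%E].

Lemma scales_summable d (T : measurableType d) (mu : {measure set T -> \bar R})
    phi c (f : T -> R) : scales mu phi c -> 0 < c ->
  measurable_fun setT f ->
  summable_fun mu (f \o phi) -> summable_fun mu f.
Proof.
move=> [mphi _ cphi] c0 mf sf; apply/integrableP; split.
  exact/measurable_EFinP.
have [_ fo] := (integrableP _ _ _ sf).
rewrite cphi//; first by rewrite lte_mul_pinfty// lee_fin ltW.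
by apply: measurableT_comp => //; exact/measurable_EFinP.
Qed.

Lemma scales_Rintegral d (T : measurableType d) (mu : {measure set T -> \bar R})
    phi c (f : T -> R) : scales mu phi c -> 0 < c ->
  measurable_fun setT f -> summable_fun mu (f \o phi) ->
  \int[mu]_x f x = c * \int[mu]_x f (phi x).
Proof.
move=> sphi c0 mf sf; have sf' := scales_summable sphi c0 mf sf.
have [mphi _ cphi] := sphi.
apply: EFin_inj; rewrite EFinM !EFin_Rintegral//.
rewrite integralE [in RHS]integralE muleBr//; last first.
  have h := integrable_neg_fin_num measurableT sf.
  by apply: fin_num_adde_defl; rewrite fin_numN.
have mf' : measurable_fun setT (EFin \o f) by exact/measurable_EFinP.
rewrite cphi//; last exact: measurable_funepos.
rewrite [in LHS](cphi ((EFin \o f)^\-%E))//; last exact: measurable_funeneg.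
by congr (_ * _ - _ * _)%E; apply: eq_integral => x _; rewrite ?funeposE ?funenegE.
Qed.

(** By uniqueness of Lebesgue measure it is enough to compare the measures of
    intervals. *)
Lemma scales_affine (a b : R) : 0 < a ->
  scales (@lebesgue_measure R) (fun z => a * z + b) a.
Proof.
move=> a0; split; [|exact: ltW|move=> f mf f0].
  by apply: measurable_funD => //; exact: measurable_funM.
pose phi : R -> measurableTypeR R := fun z => a * z + b.
have mphi : measurable_fun setT phi.
  by apply: measurable_funD => //; exact: measurable_funM.
pose a' : {nonneg R} := NngNum (ltW a0).
pose pf : {measure set (measurableTypeR R) -> \bar R} :=
  measure_function_pushforward__canonical__measure_function_Measure
    (@lebesgue_measure R) mphi.
pose nu := mscale a' pf.
have nuE A : measurable A -> lebesgue_measure A = nu A.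
  apply: lebesgue_measure_unique => _ [[x y] /= _ <-].
  rewrite /nu /mscale/= /pf/= /pushforward.
  rewrite (_ : phi @^-1` _ = `](x - b) / a, (y - b) / a]%classic); last first.
    apply/seteqP; split=> z /=; rewrite !in_itv/= /phi
      ltr_pdivrMr// ler_pdivlMr// ltrBlDr lerBrDr (mulrC z)//.
  rewrite [in RHS]lebesgue_measure_itv/= [in LHS]lebesgue_measure_itv/= !lte_fin.
  rewrite ltr_pM2r ?invr_gt0// ltrD2r.
  case: ifPn => _; last by rewrite mule0.
  by rewrite -!EFinD -EFinM; congr EFin; field; exact: lt0r_neq0.
rewrite (eq_measure_integral nu); last by move=> A mA _; exact: nuE.
rewrite ge0_integral_mscale//; congr (_ * _)%E.
rewrite ge0_integral_pushforward//.
Qed.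

Lemma scales_prod d1 d2 (T1 : measurableType d1) (T2 : measurableType d2)
    (m1 : {sigma_finite_measure set T1 -> \bar R})
    (m2 : {sigma_finite_measure set T2 -> \bar R}) phi1 phi2 c1 c2 :
  scales m1 phi1 c1 -> scales m2 phi2 c2 ->
  scales (prod_sf m1 m2) (fun p => (phi1 p.1, phi2 p.2)) (c1 * c2).
Proof.
move=> [mphi1 c10 h1] [mphi2 c20 h2].
have mphi : measurable_fun setT (fun p : T1 * T2 => (phi1 p.1, phi2 p.2)).
  by apply: measurable_fun_pair; exact: measurableT_comp.
split; [exact: mphi|exact: mulr_ge0|move=> f mf f0].
rewrite [LHS](fubini_tonelli1 (m1 := m1) (m2 := m2) f)//.
rewrite h1/=; last 2 first.
- exact: measurable_fun_fubini_tonelli_F.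
- by move=> x; exact: integral_ge0.
rewrite [X in (_ = _ * X)%E](fubini_tonelli1 (m1 := m1) (m2 := m2)
  (fun p => f (phi1 p.1, phi2 p.2)))//; last exact: measurableT_comp.
rewrite EFinM -muleA; congr (_ * _)%E.
rewrite -ge0_integralZl//; first last.
- by move=> x _; exact: integral_ge0.
- apply: (measurable_fun_fubini_tonelli_F (fun p => f (phi1 p.1, phi2 p.2))) => //.
  exact: measurableT_comp.
apply: eq_integral => x _.
rewrite /fubini_F /= h2//.
exact: measurableT_comp.
Qed.

End scaling_maps.

Section tuples.
Context {R : realType}.
Local Notation leb := (@lebesgue_measure R).
Local Notation lebt m := (@lebesgue_tuple R m).
Notation tR m := (m.-tuple (measurableTypeR R)).

Definition tuncons m (t : tR m.+1) : measurableTypeR R * tR m :=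
  (thead t, [tuple of behead t]).

Lemma tconsK m : cancel (@tuncons m) (@tcons R m).
Proof. by move=> t; rewrite /tuncons /tcons/=; apply/val_inj; case/tupleP: t. Qed.

Lemma measurable_tuncons m : measurable_fun setT (@tuncons m).
Proof.
apply: measurable_fun_pair; first exact: measurable_tnth.
exact: measurable_behead.
Qed.

Lemma integral_tuple_cons m (f : tR m.+1 -> \bar R) : measurable_fun setT f ->
  (forall x, 0 <= f x)%E ->
  (\int[lebt m.+1]_t f t = \int[prod_sf leb (lebt m)]_p f (tcons p))%E.
Proof.
move=> mf f0.
rewrite (eq_measure_integral (pushforward (prod_sf leb (lebt m)) (@tcons R m)))//.
  exact: measurable_tcons.
by move=> mt; rewrite ge0_integral_pushforward.
Qed.

Lemma summable_tuple_cons m (f : tR m.+1 -> R) : measurable_fun setT f ->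
  summable_fun (prod_sf leb (lebt m)) (f \o @tcons R m) ->
  summable_fun (lebt m.+1) f.
Proof.
move=> mf sf; apply/integrableP; split; first exact/measurable_EFinP.
have [_ fo] := (integrableP _ _ _ sf).
rewrite integral_tuple_cons//.
by apply: measurableT_comp => //; exact/measurable_EFinP.
Qed.

Lemma Rintegral_tuple_cons m (f : tR m.+1 -> R) : measurable_fun setT f ->
  \int[lebt m.+1]_t f t = \int[prod_sf leb (lebt m)]_p f (tcons p).
Proof.
move=> mf; have mf' : measurable_fun setT (EFin \o f) by exact/measurable_EFinP.
congr fine; rewrite integralE [RHS]integralE.
rewrite (integral_tuple_cons (measurable_funepos mf'))//.
rewrite (integral_tuple_cons (measurable_funeneg mf'))//.
by congr (_ - _)%E; apply: eq_integral => x _; rewrite ?funeposE ?funenegE.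
Qed.

(** Induction on [m]: a tuple of length [m.+1] is a real number and a tuple of
    length [m], and dilations act separately on the two. *)
Lemma scales_tuple m (a : R) (b : 'I_m -> R) : 0 < a ->
  scales (lebt m) (fun t => [tuple (a * tnth t i + b i) | i < m]) (a ^+ m).
Proof.
move=> a0; elim: m b => [|m IH] b.
  split; [|by rewrite expr0|move=> f mf f0].
    rewrite (_ : (fun _ => _) = id); first exact: measurable_id.
    by apply/funext => t; rewrite (tuple0 t); exact: tuple0.
  rewrite expr0 mul1e; apply: eq_integral => t _; congr f.
  by rewrite (tuple0 t); apply/esym; exact: tuple0.
pose phi1 z := a * z + b ord0.
pose phi2 (t : tR m) : tR m := [tuple a * tnth t i + b (lift ord0 i) | i < m].
pose phi (t : tR m.+1) : tR m.+1 := [tuple (a * tnth t i + b i) | i < m.+1].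
have [mphi c0 h] := scales_prod (scales_affine (b ord0) a0)
  (IH (fun i => b (lift ord0 i))).
have phiE p : phi (tcons p) = tcons (phi1 p.1, phi2 p.2).
  case: p => z t; apply: eq_from_tnth => i; rewrite tnth_mktuple.
  case: (unliftP ord0 i) => [j ->|->].
    by rewrite /tcons !tnthS tnth_mktuple.
  by rewrite /tcons !tnth0.
have mphi' : measurable_fun setT phi.
  rewrite (_ : phi = @tcons R m \o (fun p => (phi1 p.1, phi2 p.2)) \o @tuncons m).
    apply: measurableT_comp; last exact: measurable_tuncons.
    by apply: measurableT_comp; [exact: measurable_tcons|exact: mphi].
  by apply/funext => t; rewrite /comp -(phiE (tuncons t)) tconsK.
split; [exact: mphi'|by rewrite exprn_ge0// ltW|move=> f mf f0].
rewrite !integral_tuple_cons//; last first.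
  by apply: measurableT_comp => //.
rewrite h//; last by apply: measurableT_comp => //; exact: measurable_tcons.
rewrite exprS; congr (_ * _)%E.
by apply: eq_integral => p _; rewrite -[in RHS]/(phi _) phiE.
Qed.

End tuples.

(** * Measurability of continuous functions on R x R^m x R *)

Section rows.
Context {R : realType}.

Lemma cvg_rV m T (F : set_system T) {FF : Filter F} (f : T -> 'rV[R]_m) (v : 'rV[R]_m) :
  (forall i, f x ord0 i @[x --> F] --> v ord0 i) -> f x @[x --> F] --> v.
Proof.
move=> h; apply/cvgrPdist_le => e e0.
have : \forall x \near F, forall i : 'I_m, `|v ord0 i - f x ord0 i| <= e.
  by apply: filter_forall => i; move/cvgrPdist_le : (h i) => /(_ _ e0).
apply: filterS => x hx.
rewrite [leLHS]/Num.norm /= mx_normrE; apply: bigmax_le => [|[i j] _ /=]; first exact: ltW.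
by rewrite !mxE ord1.
Qed.

End rows.

Section measurability.
Context {R : realType}.
Notation tR m := (m.-tuple (measurableTypeR R)).

Lemma measurable_fun_countable d (T : measurableType d) (C : countType)
    (dm : T -> C) (g : C -> R) :
  (forall c, measurable (dm @^-1` [set c])) -> measurable_fun setT (g \o dm).
Proof.
move=> h _ A mA; rewrite setTI comp_preimage.
rewrite (_ : dm @^-1` _ = \bigcup_(c in g @^-1` A) (dm @^-1` [set c])); last first.
  apply/seteqP; split=> [x /= Ax|x [c /= Ac]]; last by move=> /= ->.
  by exists (dm x).
rewrite bigcup_mkcond; apply: countable_bigcupT_measurable => // c.
by case: ifP.
Qed.

Definition grid (k : nat) (z : R) : R := (Num.floor (z * k.+1%:R))%:~R / k.+1%:R.

Lemma grid_near k z : `|z - grid k z| <= k.+1%:R^-1.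
Proof.
have k0 : 0 < k.+1%:R :> R by rewrite ltr0n.
have /andP[h1 h2] := floor_itv (z * k.+1%:R).
rewrite (_ : z - _ = (z * k.+1%:R - (Num.floor (z * k.+1%:R))%:~R) / k.+1%:R); last first.
  by rewrite /grid mulrBl mulfK// gt_eqF.
rewrite normrM [X in _ * X]ger0_norm ?invr_ge0 ?(ltW k0)//.
rewrite -[leRHS]mul1r ler_wpM2r ?invr_ge0 ?(ltW k0)//.
rewrite ger0_norm ?subr_ge0//.
by move: h2; rewrite intrD; lra.
Qed.

Lemma cvg_grid z : grid k z @[k --> \oo] --> z.
Proof.
apply/cvgrPdist_le => e e0.
have /cvgrPdist_le/(_ _ e0) := @cvg_harmonic R.
apply: filterS => k; rewrite sub0r normrN ger0_norm ?invr_ge0//.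
exact/le_trans/grid_near.
Qed.

Lemma measurable_floor_fiber k (c : int) :
  measurable ([set z : measurableTypeR R | Num.floor (z * k.+1%:R) = c]).
Proof.
have k0 : 0 < k.+1%:R :> R by rewrite ltr0n.
rewrite (_ : mkset _ = `[c%:~R / k.+1%:R, (c + 1)%:~R / k.+1%:R[%classic).
  exact: measurable_itv.
apply/seteqP; split=> z /=; rewrite in_itv/= ler_pdivrMr// ltr_pdivlMr//.
  by move=> <-; exact: floor_itv.
exact: floor_def.
Qed.

Variable m : nat.

(** Tuples carry a product sigma-algebra and row vectors a topology, so
    measurability is not read off from preimages of open sets.  Instead, the
    argument is rounded down to the grid of mesh 1/(k+1): the rounded function
    takes its value from a countable set of cells, each a product of
    intervals, and by continuity it converges pointwise. *)
Lemma measurable_of_continuous (f : R * 'rV[R]_m * R -> R)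
    (A : set ((measurableTypeR R * tR m) * measurableTypeR R)) :
  (forall p, A p -> {for (p.1.1, vec p.1.2, p.2), continuous f}) ->
  measurable_fun A (fun p => f (p.1.1, vec p.1.2, p.2)).
Proof.
move=> cf.
pose dm k (p : (measurableTypeR R * tR m) * measurableTypeR R) :
    int * m.-tuple int * int :=
  (Num.floor (p.1.1 * k.+1%:R : R), [tuple Num.floor (tnth p.1.2 i * k.+1%:R : R) | i < m],
   Num.floor (p.2 * k.+1%:R : R)).
pose gr k (c : int * m.-tuple int * int) : R * 'rV[R]_m * R :=
  (c.1.1%:~R / k.+1%:R, \row_i ((tnth c.1.2 i)%:~R / k.+1%:R), c.2%:~R / k.+1%:R).
apply: (@measurable_fun_cvg _ _ _ _ (fun k p => f (gr k (dm k p)))).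
  move=> k; apply: measurable_funTS.
  apply: (@measurable_fun_countable _ _ _ (dm k) (f \o gr k)) => -[[a b] c].
  rewrite (_ : dm k @^-1` _ =
    (fst \o fst) @^-1` [set z : measurableTypeR R | Num.floor (z * k.+1%:R) = a] `&`
    (\bigcap_(i in [set: 'I_m]) (((fun t : tR m => tnth t i) \o (snd \o fst)) @^-1`
         [set z : measurableTypeR R | Num.floor (z * k.+1%:R) = tnth b i])) `&`
    snd @^-1` [set z : measurableTypeR R | Num.floor (z * k.+1%:R) = c]); last first.
    apply/seteqP; split=> [p /= [<- <- <-]|p /= [[<- h2] <-]].
      by split=> //; split=> // i _ /=; rewrite tnth_mktuple.
    rewrite /dm; congr (_, _, _); apply: eq_from_tnth => i.
    by rewrite tnth_mktuple h2.
  apply: measurableI; [apply: measurableI|].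
  - rewrite -[X in measurable X]setTI.
    have : measurable_fun setT (fst \o fst : (measurableTypeR R * tR m) * measurableTypeR R -> _).
      by apply: measurableT_comp.
    by apply => //; exact: measurable_floor_fiber.
  - apply: fin_bigcap_measurable => // i _; rewrite -[X in measurable X]setTI.
    have : measurable_fun setT ((fun t : tR m => tnth t i) \o (snd \o fst :
         (measurableTypeR R * tR m) * measurableTypeR R -> _)).
      apply: measurableT_comp; first exact: measurable_tnth.
      exact: measurableT_comp.
    by apply => //; exact: measurable_floor_fiber.
  - rewrite -[X in measurable X]setTI.
    by apply: measurable_snd => //; exact: measurable_floor_fiber.
move=> p Ap; apply: (@cvg_comp _ _ _ (fun k => gr k (dm k p)) f _ _ _ _ (cf p Ap)).
have c1 : grid k p.1.1 @[k --> \oo] --> (p.1.1 : R) by exact: cvg_grid.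
have c3 : grid k p.2 @[k --> \oo] --> (p.2 : R) by exact: cvg_grid.
have c2 : (\row_i ((tnth (dm k p).1.2 i)%:~R / k.+1%:R) : 'rV[R]_m) @[k --> \oo]
    --> vec p.1.2.
  apply: cvg_rV => i; rewrite /vec !mxE.
  by under eq_fun do rewrite mxE tnth_mktuple; exact: cvg_grid.
exact: (cvg_pair (cvg_pair c1 c2) c3).
Qed.

End measurability.

(** * Gaussian functions *)

Section gaussians.
Context {R : realType}.
Local Notation leb := (@lebesgue_measure R).
Local Notation lebt m := (@lebesgue_tuple R m).
Notation tR m := (m.-tuple (measurableTypeR R)).

Definition lebT m := prod_sf leb (lebt m).

Lemma sqnorm_vec m (t : tR m) : sqnorm (vec t) = \sum_(i < m) tnth t i ^+ 2.
Proof. by apply: eq_bigr => i _; rewrite mxE. Qed.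

Lemma sqnorm_ge0 m (y : 'rV[R]_m) : 0 <= sqnorm y.
Proof. by apply: sumr_ge0 => i _; exact: sqr_ge0. Qed.

Lemma sqnorm_tcons m z (t : tR m) :
  sqnorm (vec (tcons (z, t))) = z ^+ 2 + sqnorm (vec t).
Proof.
rewrite !sqnorm_vec big_ord_recl; congr (_ + _).
by apply: eq_bigr => i _; rewrite /tcons tnthS.
Qed.

Lemma measurable_sqnorm_vec m : measurable_fun setT (fun t : tR m => sqnorm (vec t)).
Proof.
rewrite (_ : (fun _ => _) = fun t : tR m => \sum_(i < m) tnth t i ^+ 2).
  apply: measurable_sum => i; apply: measurable_funX; exact: measurable_tnth.
by apply/funext => t; rewrite sqnorm_vec.
Qed.

Definition gauss1 (c z : R) : R := expR (- (c * z ^+ 2)).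
Definition gausst m (c : R) (t : tR m) : R := expR (- (c * sqnorm (vec t))).
Definition gaussT m (c : R) (p : measurableTypeR R * tR m) : R :=
  expR (- (c * (p.1 ^+ 2 + sqnorm (vec p.2)))).

Lemma gaussTE m c p : @gaussT m c p = gauss1 c p.1 * gausst c p.2.
Proof. by rewrite /gaussT mulrDr opprD expRD. Qed.

Lemma gausst_cons m c p : gausst c (tcons p) = @gaussT m c p.
Proof. by case: p => z t; rewrite /gausst sqnorm_tcons. Qed.

Lemma measurable_gausst m c : measurable_fun setT (@gausst m c).
Proof.
apply: measurableT_comp => //; apply: measurableT_comp => //.
by apply: measurable_funM => //; exact: measurable_sqnorm_vec.
Qed.

Lemma measurable_gauss1 c : measurable_fun (@setT (measurableTypeR R)) (gauss1 c).
Proof.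
apply: measurableT_comp => //; apply: measurableT_comp => //.
apply: measurable_funM => //; exact: measurable_funX.
Qed.

Lemma summable_gauss1 c : 0 < c -> summable_fun leb (gauss1 c).
Proof.
move=> c0; have s0 : 0 < Num.sqrt c by rewrite sqrtr_gt0.
have i0 : 0 < (Num.sqrt c)^-1 by rewrite invr_gt0.
apply: (scales_summable (scales_affine 0 i0) i0); first exact: measurable_gauss1.
apply: eq_integrable (@integrableT_gauss R) => // z _ /=.
rewrite /gauss_integral.gauss_fun /gauss1 addr0 exprMn exprVn sqr_sqrtr ?ltW//.
by rewrite mulrA divff ?mul1r// gt_eqF.
Qed.

Lemma summable_gausst m c : 0 < c -> summable_fun (lebt m) (@gausst m c).
Proof.
move=> c0; elim: m => [|m IH].
  apply/integrableP; split; first by apply/measurable_EFinP; exact: measurable_gausst.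
  rewrite (_ : (fun _ => _) = cst 1%E); last first.
    apply/funext => t /=.
    by rewrite /gausst sqnorm_vec big_ord0 mulr0 oppr0 expR0 normr1.
  by rewrite integral_cst// mul1e/= diracE in_setT ltry.
apply: summable_tuple_cons; first exact: measurable_gausst.
apply: eq_integrable (summable_prod (summable_gauss1 c0) IH) => // p _.
by rewrite /= gausst_cons gaussTE.
Qed.

Lemma summable_gaussT m c : 0 < c -> summable_fun (lebT m) (@gaussT m c).
Proof.
move=> c0; apply: eq_integrable (summable_prod (summable_gauss1 c0) (summable_gausst m c0)) => // p _.
by rewrite /= gaussTE.
Qed.

Lemma measurable_gaussT m c : measurable_fun setT (@gaussT m c).
Proof.
apply: (eq_measurable_fun (fun p => gauss1 c p.1 * gausst c p.2)).
  by move=> p _; rewrite gaussTE.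
apply: measurable_funM; first exact: measurableT_comp (measurable_gauss1 c) _.
exact: measurableT_comp (measurable_gausst _) _.
Qed.

Lemma Rintegral_gauss1 : \int[leb]_z gauss1 1 z = Num.sqrt pi.
Proof.
rewrite /Rintegral (_ : (\int[leb]_x (gauss1 1 x)%:E)%E = (Num.sqrt pi)%:E)//.
rewrite -integralT_gauss; apply: eq_integral => z _.
by rewrite /gauss1 mul1r.
Qed.

Lemma Rintegral_gausst m : \int[lebt m]_t gausst 1 t = Num.sqrt pi ^+ m.
Proof.
elim: m => [|m IH].
  rewrite (_ : gausst 1 = cst 1); last first.
    by apply/funext => t; rewrite /gausst sqnorm_vec big_ord0 mulr0 oppr0 expR0.
  have d1 : lebt 0 setT = 1%E by rewrite [LHS]diracE in_setT.
  by rewrite Rintegral_cst// [X in fine X]d1 mulr1.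
rewrite Rintegral_tuple_cons; last exact: measurable_gausst.
under eq_Rintegral => p _ do rewrite gausst_cons gaussTE.
rewrite (Rintegral_prod (summable_gauss1 ltr01) (summable_gausst m ltr01)).
by rewrite IH Rintegral_gauss1 exprS.
Qed.

Lemma Rintegral_gaussT m : \int[lebT m]_p gaussT 1 p = Num.sqrt pi ^+ m.+1.
Proof.
under eq_Rintegral => p _ do rewrite gaussTE.
rewrite (Rintegral_prod (summable_gauss1 ltr01) (summable_gausst m ltr01)).
by rewrite Rintegral_gausst Rintegral_gauss1 exprS.
Qed.

Lemma gauss1_le1 c z : 0 <= c -> gauss1 c z <= 1.
Proof.
move=> c0; rewrite /gauss1 -expR0 ler_expR oppr_le0.
by rewrite mulr_ge0// sqr_ge0.
Qed.

End gaussians.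

Section coordinate.
Context {R : realType}.
Local Notation leb := (@lebesgue_measure R).
Local Notation lebt m := (@lebesgue_tuple R m).
Notation tR m := (m.-tuple (measurableTypeR R)).

(** A class of functions whose slices along any coordinate are in the same
    class, hence integrable at every point. *)
Definition gauss_dominated m (f : tR m -> R) := measurable_fun setT f /\
  exists C, forall t, `|f t| <= C * gausst 1 t.

Definition set_tnth m (t : tR m) (i : 'I_m) (z : R) : tR m :=
  [tuple if j == i then z else tnth t j | j < m].

(** Fubini's theorem with the [i]-th variable integrated first.  The induction
    follows the definition of the measure on tuples: the [i]-th coordinate is
    either the head or a coordinate of the tail. *)
Lemma Rintegral_line_eq0 m (i : 'I_m) (f : tR m -> R) : gauss_dominated f ->
  (forall t, \int[leb]_z f (set_tnth t i z) = 0) ->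
  \int[lebt m]_t f t = 0.
Proof.
elim: m i f => [[//]|m IH] i f [mf [C fC]] f0.
have C0 : 0 <= C.
  have := fC [tuple of nseq m.+1 0]; move/(le_trans (normr_ge0 _)).
  by rewrite pmulr_lge0// expR_gt0.
have mfc : measurable_fun setT (f \o @tcons R m).
  by apply: measurableT_comp => //; exact: measurable_tcons.
have sf : summable_fun (prod_sf leb (lebt m)) (f \o @tcons R m).
  apply: (summable_le mfc (summable_scale C (summable_gaussT m ltr01))) => p.
  by rewrite /= -gausst_cons; exact: fC.
have mf1 z : measurable_fun setT (fun t => f (tcons (z, t))).
  by apply: measurableT_comp mfc _; exact: measurable_fun_pair.
have mf2 t : measurable_fun setT (fun z => f (tcons (z, t))).
  by apply: measurableT_comp mfc _; exact: measurable_fun_pair.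
have fC2 z t : `|f (tcons (z, t))| <= C * (gauss1 1 z * gausst 1 t).
  by have := fC (tcons (z, t)); rewrite gausst_cons gaussTE.
have sf1 z : summable_fun (lebt m) (fun t => f (tcons (z, t))).
  apply: (summable_le (mf1 z) (summable_scale (C * gauss1 1 z) (summable_gausst m ltr01))) => t.
  by rewrite -mulrA; exact: fC2.
have sf2 t : summable_fun leb (fun z => f (tcons (z, t))).
  apply: (summable_le (mf2 t) (summable_scale (C * gausst 1 t) (summable_gauss1 ltr01))) => z.
  by rewrite -mulrA (mulrC (gausst _ _)); exact: fC2.
rewrite Rintegral_tuple_cons//.
case: (unliftP ord0 i) f0 => [j ->|->] f0.
  have [_ <-] := Rfubini1 sf sf1.
  under eq_Rintegral => z _.
    rewrite (IH j (fun t => f (tcons (z, t)))); first over.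
      split; first exact: mf1.
      exists C => t; apply: (le_trans (fC2 z t)); rewrite ler_wpM2l//.
      by rewrite -[leRHS]mul1r ler_wpM2r ?gauss1_le1// expR_ge0.
    move=> t; rewrite -[RHS](f0 (tcons (z, t))); apply: eq_Rintegral => w _.
    congr f; apply: eq_from_tnth => k; rewrite tnth_mktuple.
    case: (unliftP ord0 k) => [l ->|->]; last by rewrite /tcons !tnth0.
    by rewrite /tcons !tnthS tnth_mktuple (inj_eq lift_inj).
  by rewrite Rintegral_cst// mul0r.
have [_ <-] := Rfubini2 sf sf2.
under eq_Rintegral => t _.
  rewrite (_ : \int[leb]_x _ = 0); first over.
  rewrite -[RHS](f0 (tcons (0, t))); apply: eq_Rintegral => w _.
  rewrite /=; congr f; apply: eq_from_tnth => k; rewrite tnth_mktuple.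
  case: (unliftP ord0 k) => [l ->|->]; last by rewrite /tcons !tnth0 eqxx.
  by rewrite /tcons !tnthS.
by rewrite Rintegral_cst// mul0r.
Qed.

End coordinate.

(** * One-variable calculus *)

Section calculus.
Context {R : realType}.
Local Notation leb := (@lebesgue_measure R).
Implicit Types (f g v w : R -> R) (x df dg a b : R).

(** A transparent synonym of the class [is_derive] in direction 1: instance
    resolution does not see it, so derivatives are computed only by the rules
    below. *)
Definition hasder x f df := is_derive x 1 f df.

Lemma hasder_eq x f df df' : hasder x f df -> df = df' -> hasder x f df'.
Proof. by move=> h <-. Qed.

Lemma hasder_comp f g x df dg : hasder (g x) f df -> hasder x g dg ->
  hasder x (fun z => f (g z)) (df * dg).
Proof. by move=> hf hg; exact: is_derive1_comp hf hg. Qed.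

Lemma hasder_derive1 f x : derivable f x 1 -> hasder x f (derive1 f x).
Proof. by move=> h; split => //; rewrite derive1E. Qed.

Lemma hasder_sqrt x : 0 < x -> hasder x Num.sqrt (2 * Num.sqrt x)^-1.
Proof. exact: is_derive1_sqrt. Qed.

Lemma hasder_cst_fun (c x : R) : hasder x (fun _ : R => c) 0.
Proof. exact: is_derive_cst. Qed.

Lemma hasder_id_fun (x : R) : hasder x (fun z : R => z) 1.
Proof. exact: is_derive_id. Qed.

Lemma hasder_add f g x df dg : hasder x f df -> hasder x g dg ->
  hasder x (fun z => f z + g z) (df + dg).
Proof. exact: is_deriveD. Qed.

Lemma hasder_sub f g x df dg : hasder x f df -> hasder x g dg ->
  hasder x (fun z => f z - g z) (df - dg).
Proof. exact: is_deriveB. Qed.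

Lemma hasder_opp f x df : hasder x f df ->
  hasder x (fun z => - f z) (- df).
Proof. exact: is_deriveN. Qed.

Lemma hasder_mul f g x df dg : hasder x f df -> hasder x g dg ->
  hasder x (fun z => f z * g z) (df * g x + f x * dg).
Proof.
move=> hf hg; apply: hasder_eq (is_deriveM hf hg) _.
by rewrite /GRing.scale/= addrC mulrC.
Qed.

Lemma hasder_scale (c : R) f x df : hasder x f df ->
  hasder x (fun z => c * f z) (c * df).
Proof.
move=> h; apply: hasder_eq (hasder_mul (hasder_cst_fun c x) h) _.
by rewrite mul0r add0r.
Qed.

Lemma hasder_pow n f x df : hasder x f df ->
  hasder x (fun z => f z ^+ n) (n%:R * f x ^+ n.-1 * df).
Proof.
move=> h; have := is_deriveX n h.
rewrite (_ : f ^+ n = fun z => f z ^+ n)//; apply/funext => z.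
by elim: n => [|n IH]; rewrite ?expr0// !exprS -IH.
Qed.

Lemma hasder_exp f x df : hasder x f df ->
  hasder x (fun z => expR (f z)) (expR (f x) * df).
Proof. by move=> h; exact: is_derive1_comp (is_derive_expR _) h. Qed.

Lemma hasder_inv f x df : f x != 0 -> hasder x f df ->
  hasder x (fun z => (f z)^-1) (- (f x ^- 2) * df).
Proof. by move=> fx h; exact: is_deriveV. Qed.

Lemma hasder_comp_shift f (c x : R) df : hasder (x - c) f df ->
  hasder x (fun z => f (z - c)) df.
Proof.
move=> h; have hs := hasder_sub (hasder_id_fun x) (hasder_cst_fun c x).
have h2 := @is_derive1_comp _ f (fun z => z - c) x _ _ h hs.
by apply: (hasder_eq h2); rewrite subr0 mulr1.
Qed.

Lemma hasder_continuous f x df : hasder x f df -> {for x, continuous f}.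
Proof.
by move=> [h _]; apply: differentiable_continuous; apply/derivable1_diffP.
Qed.

Lemma within_continuous_for f a b :
  (forall z : R, a <= z <= b -> {for z, continuous f}) ->
  {within `[a, b], continuous f}.
Proof.
by move=> h; apply: continuous_in_subspaceT => z; rewrite inE/= in_itv/=; exact: h.
Qed.

Lemma Rintegral_derive f g a b : a < b ->
  (forall z : R, a <= z <= b -> hasder z f (g z)) ->
  (forall z : R, a <= z <= b -> {for z, continuous g}) ->
  \int[leb]_(z in `[a, b]) g z = f b - f a.
Proof.
move=> ab fg cg; rewrite /Rintegral (continuous_FTC2 (F := f) ab)//.
- exact: within_continuous_for.
- split.
  + by move=> z /[!in_itv]/= /andP[az zb]; have [] := fg z; rewrite ?ltW.
  + apply: cvg_at_right_filter.
    by apply: (hasder_continuous (fg a _)); rewrite lexx ltW.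
  + apply: cvg_at_left_filter.
    by apply: (hasder_continuous (fg b _)); rewrite lexx ltW.
- move=> z /[!in_itv]/= /andP[az zb]; rewrite derive1E.
  have h : hasder z f (g z) by apply: fg; rewrite !ltW.
  by case: h.
Qed.

(** The integrand is the derivative of v w' - v' w. *)
Lemma Green_identity v v1 v2 w w1 w2 a b : a < b ->
  (forall z : R, a <= z <= b -> hasder z v (v1 z)) ->
  (forall z : R, a <= z <= b -> hasder z v1 (v2 z)) ->
  (forall z : R, a <= z <= b -> hasder z w (w1 z)) ->
  (forall z : R, a <= z <= b -> hasder z w1 (w2 z)) ->
  (forall z : R, a <= z <= b -> {for z, continuous v2}) ->
  (forall z : R, a <= z <= b -> {for z, continuous w2}) ->
  \int[leb]_(z in `[a, b]) (v z * w2 z - v2 z * w z) =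
  (v b * w1 b - v1 b * w b) - (v a * w1 a - v1 a * w a).
Proof.
move=> ab hv hv1 hw hw1 cv2 cw2.
pose F z := v z * w1 z - v1 z * w z.
have HF z : a <= z <= b -> hasder z F (v z * w2 z - v2 z * w z).
  move=> zab; apply: hasder_eq (hasder_sub (hasder_mul (hv z zab) (hw1 z zab))
    (hasder_mul (hv1 z zab) (hw z zab))) _.
  by ring.
apply: (Rintegral_derive ab HF) => z zab.
apply: continuousB; apply: continuousM.
- exact: hasder_continuous (hv z zab).
- exact: cw2.
- exact: cv2.
- exact: hasder_continuous (hw z zab).
Qed.

End calculus.

Section cutoff.
Context {R : realType}.
Implicit Types (beta a q z : R).

(** [cutoff1] and [cutoff2] are the first two derivatives of [cutoff].  The
    outer square makes [cutoff] and [cutoff1] vanish at -1/beta and 1/beta, the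
    end points of the box. *)
Definition cutoff beta z : R := (1 - (beta * z) ^+ 2) ^+ 2.
Definition cutoff1 beta z : R := - 4 * beta ^+ 2 * z * (1 - (beta * z) ^+ 2).
Definition cutoff2 beta z : R := - 4 * beta ^+ 2 + 12 * beta ^+ 2 * (beta * z) ^+ 2.

Definition bell a q z : R := expR (- ((a - z) ^+ 2 / (4 * q))).

Lemma hasder_cutoff beta z : hasder z (cutoff beta) (cutoff1 beta z).
Proof.
apply: hasder_eq.
  apply: hasder_pow; apply: hasder_sub; first exact: hasder_cst_fun.
  by apply: hasder_pow; apply: hasder_scale; exact: hasder_id_fun.
by rewrite /cutoff1 /=; ring.
Qed.

Lemma hasder_cutoff1 beta z : hasder z (cutoff1 beta) (cutoff2 beta z).
Proof.
apply: hasder_eq.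
  apply: hasder_mul.
    by apply: hasder_scale; exact: hasder_id_fun.
  apply: hasder_sub; first exact: hasder_cst_fun.
  by apply: hasder_pow; apply: hasder_scale; exact: hasder_id_fun.
by rewrite /cutoff2 /=; ring.
Qed.

Lemma hasder_bell a q z : q != 0 ->
  hasder z (bell a q) ((a - z) / (2 * q) * bell a q z).
Proof.
move=> q0; apply: hasder_eq.
  apply: hasder_exp; apply: hasder_opp.
  apply: hasder_mul; last exact: hasder_cst_fun.
  apply: hasder_pow; apply: hasder_sub; first exact: hasder_cst_fun.
  exact: hasder_id_fun.
by rewrite /bell /=; field.
Qed.

Lemma hasder_bell1 a q z : q != 0 ->
  hasder z (fun z => (a - z) / (2 * q) * bell a q z)
    (((a - z) ^+ 2 / (4 * q ^+ 2) - (2 * q)^-1) * bell a q z).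
Proof.
move=> q0; apply: hasder_eq.
  apply: hasder_mul (hasder_bell a z q0).
  apply: hasder_mul; last exact: hasder_cst_fun.
  apply: hasder_sub; first exact: hasder_cst_fun.
  exact: hasder_id_fun.
by rewrite /=; field.
Qed.

(** The first and second derivatives of [cutoff beta * bell a q], with the
    factor [bell a q] put aside in [lapc]. *)
Definition cutoffbell1 beta a q z : R :=
  (cutoff1 beta z + cutoff beta z * ((a - z) / (2 * q))) * bell a q z.
Definition lapc beta a q z : R :=
  cutoff2 beta z + 2 * cutoff1 beta z * ((a - z) / (2 * q))
   + cutoff beta z * ((a - z) ^+ 2 / (4 * q ^+ 2) - (2 * q)^-1).
Definition cutoffbell2 beta a q z : R := lapc beta a q z * bell a q z.

Lemma hasder_cutoffbell beta a q z : q != 0 ->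
  hasder z (fun z => cutoff beta z * bell a q z) (cutoffbell1 beta a q z).
Proof.
move=> q0; apply: hasder_eq.
  by apply: hasder_mul; [exact: hasder_cutoff|exact: hasder_bell].
by rewrite /cutoffbell1; ring.
Qed.

Lemma hasder_cutoffbell1 beta a q z : q != 0 ->
  hasder z (cutoffbell1 beta a q) (cutoffbell2 beta a q z).
Proof.
move=> q0.
rewrite (_ : cutoffbell1 beta a q = fun z => cutoff1 beta z * bell a q z +
   cutoff beta z * ((a - z) / (2 * q) * bell a q z)); last first.
  by apply/funext => w; rewrite /cutoffbell1; ring.
apply: hasder_eq.
  apply: hasder_add; apply: hasder_mul.
  - exact: hasder_cutoff1.
  - exact: hasder_bell.
  - exact: hasder_cutoff.
  - exact: hasder_bell1.
by rewrite /cutoffbell2 /lapc /=; field.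
Qed.

Lemma continuous_cutoffbell2 beta a q z : q != 0 ->
  {for z, continuous (cutoffbell2 beta a q)}.
Proof.
move=> q0; apply: hasder_continuous.
apply: hasder_mul; last exact: hasder_bell.
apply: hasder_add; last first.
  apply: hasder_mul; first exact: hasder_cutoff.
  apply: hasder_sub; last exact: hasder_cst_fun.
  apply: hasder_mul; last exact: hasder_cst_fun.
  apply: hasder_pow; apply: hasder_sub; first exact: hasder_cst_fun.
  exact: hasder_id_fun.
apply: hasder_add; last first.
  apply: hasder_mul; first by apply: hasder_scale; exact: hasder_cutoff1.
  apply: hasder_mul; last exact: hasder_cst_fun.
  apply: hasder_sub; first exact: hasder_cst_fun.
  exact: hasder_id_fun.
apply: hasder_add; first exact: hasder_cst_fun.
apply: hasder_scale; apply: hasder_pow; apply: hasder_scale.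
exact: hasder_id_fun.
Qed.

End cutoff.

Section heat_kernel.
Context {R : realType}.
Implicit Types (r q s t : R).

(** The heat kernel of R^N at time [q] and squared distance [r], that is
    (4 pi q)^(-N/2) exp(-r/(4q)).  Keeping [r] and [N] as free parameters lets
    the kernel factor along coordinates without splitting vectors. *)
Definition hk (N : nat) r q : R :=
  expR (- (r / (4 * q))) / (2 * Num.sqrt (pi * q)) ^+ N.

Lemma hasder_hk N r t s : s < t ->
  hasder s (fun s => hk N r (t - s))
    (- ((r / (4 * (t - s) ^+ 2) - N%:R / (2 * (t - s))) * hk N r (t - s))).
Proof.
move=> st; have q0 : 0 < t - s by rewrite subr_gt0.
have pq0 : 0 < pi * (t - s) by rewrite mulr_gt0// pi_gt0.
have sq0 : 0 < Num.sqrt (pi * (t - s)) by rewrite sqrtr_gt0.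
have hs : hasder s (fun s => t - s) (0 - 1).
  by apply: hasder_sub; [exact: hasder_cst_fun|exact: hasder_id_fun].
apply: hasder_eq.
  apply: hasder_mul.
    apply: hasder_exp; apply: hasder_opp; apply: hasder_scale.
    by apply: hasder_inv; [rewrite mulf_neq0// gt_eqF|apply: hasder_scale; exact: hs].
  apply: hasder_inv; first by rewrite expf_neq0// mulf_neq0// gt_eqF.
  apply: hasder_pow; apply: hasder_scale.
  apply: (@hasder_comp _ Num.sqrt (fun s => pi * (t - s))).
    exact: hasder_sqrt.
  by apply: hasder_scale; exact: hs.
rewrite /hk /=; set Q := Num.sqrt _ in sq0 *.
have QE : pi = Q ^+ 2 / (t - s) :> R by rewrite sqr_sqrtr ?ltW// mulfK// gt_eqF.
have Qn0 : Q != 0 by rewrite gt_eqF.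
have qn0 : t - s != 0 by rewrite gt_eqF.
rewrite {1}QE; case: N => [|N] /=.
  by rewrite !mul0r; field.
rewrite !exprS; have P0 : (2 * Q) ^+ N != 0 by rewrite expf_neq0// mulf_neq0.
set P := (2 * Q) ^+ N in P0 *; rewrite -[N.+1%:R]natr1.
by field; rewrite P0 Qn0 qn0.
Qed.

End heat_kernel.

(** * Continuity and restriction to coordinate lines; boxes *)

Section points.
Context {R : realType} {m : nat}.
Local Notation pt := (R * 'rV[R]_m * R)%type.
Implicit Types (f g : pt -> R) (p : pt).

(** A name for continuity at a point, which keeps the closure rules below
    applicable by unification on the head symbol. *)
Definition cont_at f p := {for p, continuous f}.

Lemma cont_cst c p : cont_at (fun=> c) p.
Proof. exact: cvg_cst. Qed.

Lemma cont_x p : cont_at (fun p => p.1.1) p.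
Proof. by apply: (@cvg_comp _ _ _ fst fst _ _ _ (cvg_fst)); exact: cvg_fst. Qed.

Lemma cont_row p : {for p, continuous (fun p : pt => p.1.2)}.
Proof. by apply: (@cvg_comp _ _ _ fst snd _ _ _ (cvg_fst)); exact: cvg_snd. Qed.

Lemma cont_y i p : cont_at (fun p => p.1.2 0 i) p.
Proof.
apply: (@cvg_comp _ _ _ (fun p : pt => p.1.2) (fun v : 'rV[R]_m => v 0 i) _ _ _ (cont_row (p := p))).
exact: coord_continuous.
Qed.

Lemma cont_t p : cont_at (fun p => p.2) p.
Proof. exact: cvg_snd. Qed.

Lemma cont_add f g p : cont_at f p -> cont_at g p -> cont_at (fun p => f p + g p) p.
Proof. exact: continuousD. Qed.

Lemma cont_opp f p : cont_at f p -> cont_at (fun p => - f p) p.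
Proof. exact: continuousN. Qed.

Lemma cont_sub f g p : cont_at f p -> cont_at g p -> cont_at (fun p => f p - g p) p.
Proof. exact: continuousB. Qed.

Lemma cont_mul f g p : cont_at f p -> cont_at g p -> cont_at (fun p => f p * g p) p.
Proof. exact: continuousM. Qed.

Lemma cont_pow n f p : cont_at f p -> cont_at (fun p => f p ^+ n) p.
Proof.
move=> h; elim: n => [|n IH]; first exact: cont_cst.
by under eq_fun do rewrite exprS; exact: cont_mul.
Qed.

Lemma cont_inv f p : f p != 0 -> cont_at f p -> cont_at (fun p => (f p)^-1) p.
Proof. by move=> fp h; exact: cvgV. Qed.

Lemma cont_comp (h : R -> R) f p : {for f p, continuous h} -> cont_at f p ->
  cont_at (fun p => h (f p)) p.
Proof. by move=> hh hf; exact: continuous_comp hf hh. Qed.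

Lemma cont_sum I (r : seq I) (P : pred I) (F : I -> pt -> R) p :
  (forall i, P i -> cont_at (F i) p) ->
  cont_at (fun p => \sum_(i <- r | P i) F i p) p.
Proof.
move=> h; apply: cvg_big => //; exact: add_continuous.
Qed.

Lemma cont_prod I (r : seq I) (P : pred I) (F : I -> pt -> R) p :
  (forall i, P i -> cont_at (F i) p) ->
  cont_at (fun p => \prod_(i <- r | P i) F i p) p.
Proof.
move=> h; apply: cvg_big => //; exact: mul_continuous.
Qed.

(** Written as a translate of [eta] along the [i]-th axis, so that partial
    derivatives are derivatives of [fun z => f (upd eta i z)]. *)
Definition upd (eta : 'rV[R]_m) (i : 'I_m) (z : R) : 'rV[R]_m :=
  eta + (z - eta 0 i) *: delta_mx 0 i.

Lemma updE eta i z j : upd eta i z 0 j = if j == i then z else eta 0 j.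
Proof.
rewrite /upd !mxE eqxx/=; case: eqP => [->|_]; last by rewrite mulr0 addr0.
by rewrite mulr1 addrC subrK.
Qed.

Lemma vec_set_tnth (t : m.-tuple (measurableTypeR R)) i z :
  vec (set_tnth t i z) = upd (vec t) i z.
Proof. by apply/rowP => j; rewrite updE !mxE tnth_mktuple. Qed.

Lemma upd_shift eta i z (k : R) :
  upd eta i (k + z) = k *: delta_mx 0 i + upd eta i z.
Proof. by apply/rowP => j; rewrite /upd !mxE; ring. Qed.

Lemma cvg_upd eta i z : upd eta i w @[w --> z] --> upd eta i z.
Proof.
apply: cvg_rV => j; rewrite updE; under eq_fun do rewrite updE.
by case: eqP => _; [exact: cvg_id|exact: cvg_cst].
Qed.

Lemma cont_xline f eta s (x : R) : cont_at f (x, eta, s) ->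
  {for x, continuous (fun z : R => f (z, eta, s))}.
Proof.
move=> h; apply: (@cvg_comp _ _ _ (fun z : R => (z, eta, s)) f _ _ _ _ h).
exact: (cvg_pair (cvg_pair (@cvg_id _ (nbhs x)) (cvg_cst eta)) (cvg_cst s)).
Qed.

Lemma cont_yline f x eta s i (z : R) : cont_at f (x, upd eta i z, s) ->
  {for z, continuous (fun w : R => f (x, upd eta i w, s))}.
Proof.
have cx : x @[_ --> z] --> x by exact: cvg_cst.
have cs : s @[_ --> z] --> s by exact: cvg_cst.
have c : (x, upd eta i w, s) @[w --> z] --> (x, upd eta i z, s).
  exact: (cvg_pair (cvg_pair cx (@cvg_upd eta i z)) cs).
move=> h; exact: (cvg_comp _ _ c h).
Qed.

Lemma cont_tline f x eta (s : R) : cont_at f (x, eta, s) ->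
  {for s, continuous (fun s : R => f (x, eta, s))}.
Proof.
have cx : x @[_ --> s] --> x by exact: cvg_cst.
have ce : eta @[_ --> s] --> eta by exact: cvg_cst.
have c : (x, eta, w) @[w --> s] --> (x, eta, s).
  exact: (cvg_pair (cvg_pair cx ce) (@cvg_id _ (nbhs s))).
move=> h; exact: (cvg_comp _ _ c h).
Qed.

Lemma hasder_yline (f : 'rV[R]_m -> R) eta i (z : R) :
  derivable f (upd eta i z) (delta_mx 0 i) ->
  hasder z (fun w => f (upd eta i w)) ('D_(delta_mx 0 i) f (upd eta i z)).
Proof.
move=> h.
have E : (fun k : R => k^-1 *: (f (upd eta i (k *: (1 : R) + z)) - f (upd eta i z))) =
    fun k : R => k^-1 *: (f (k *: delta_mx 0 i + upd eta i z) - f (upd eta i z)).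
  by apply/funext => k; rewrite -upd_shift /GRing.scale/= mulr1.
split; first by rewrite /derivable /= E.
by rewrite /derive /= E.
Qed.

End points.

Lemma sqr_between (R : realType) (a b x : R) : a <= x <= b -> x ^+ 2 <= a ^+ 2 + b ^+ 2.
Proof. by move=> /andP[ax xb]; case: (lerP 0 x) => x0; nra. Qed.

Lemma sqr_between1 (R : realType) (L x : R) : - L <= x <= L -> x ^+ 2 <= L ^+ 2.
Proof. by move=> /andP[ax xb]; nra. Qed.

Section boxes.
Context {R : realType} (m : nat).
Notation leb := (@lebesgue_measure R).
Notation tR := (m.-tuple (measurableTypeR R)).
Notation pt := (R * 'rV[R]_m * R)%type.
Variables (a b L s1 s2 : R).

Definition cube (t : tR) : bool := [forall i, - L <= tnth t i <= L].
Definition box (p : measurableTypeR R * tR) : bool := (a <= p.1 <= b) && cube p.2.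

Definition cutbox (g : pt -> R) s (p : measurableTypeR R * tR) : R :=
  if box p then g (p.1, vec p.2, s) else 0.

Definition cutcube (g : 'rV[R]_m -> R) (t : tR) : R :=
  if cube t then g (vec t) else 0.

Lemma measurable_cube : measurable [set t : tR | cube t].
Proof.
rewrite (_ : mkset _ = \bigcap_(i in [set: 'I_m])
    ((fun t : tR => tnth t i) @^-1` `[- L, L])).
  apply: fin_bigcap_measurable => // i _; rewrite -[X in measurable X]setTI.
  exact: measurable_tnth.
apply/seteqP; split=> t /=.
  by move=> /forallP h i _ /=; rewrite in_itv/=; exact: h.
by move=> h; apply/forallP => i; have := h i I; rewrite /= in_itv.
Qed.

Lemma measurable_box : measurable [set p : measurableTypeR R * tR | box p].
Proof.
rewrite (_ : mkset _ = `[a, b] `*` [set t : tR | cube t]).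
  by apply: measurableX => //; exact: measurable_cube.
apply/seteqP; split=> -[x t] /=; rewrite /box/= in_itv/=.
  by move=> /andP[].
by move=> [-> ->].
Qed.

Definition cont_on_box (g : pt -> R) :=
  forall (x : R) (t : tR) (s : R), box (x, t) -> s1 <= s <= s2 ->
  cont_at g (x, vec t, s).

Lemma compact_box :
  compact [set p : pt | [/\ a <= p.1.1 <= b, s1 <= p.2 <= s2 &
    forall i, - L <= p.1.2 ord0 i <= L]].
Proof.
have := compact_setX (compact_setX (@segment_compact R a b)
  (@rV_compact R m (fun=> `[- L, L]%classic) (fun=> @segment_compact R _ _)))
  (@segment_compact R s1 s2).
congr compact; apply/seteqP; split=> -[[x v] s] /=; rewrite !in_itv/=.
  by move=> [[ax vL] sx]; split.
by move=> [ax sx vL]; do 2 split=> //.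
Qed.

Lemma bounded_on_box (g : pt -> R) : cont_on_box g ->
  exists2 C, 0 <= C & forall x t s, box (x, t) -> s1 <= s <= s2 ->
    `|g (x, vec t, s)| <= C.
Proof.
move=> cg.
have : compact (g @` [set p : pt | [/\ a <= p.1.1 <= b, s1 <= p.2 <= s2 &
    forall i, - L <= p.1.2 ord0 i <= L]]).
  apply: continuous_compact; last exact: compact_box.
  apply: continuous_in_subspaceT => -[[x v] s]; rewrite inE/= => -[xab s12 vL].
  have vE : v = vec [tuple v ord0 i | i < m].
    by apply/rowP => i; rewrite mxE tnth_mktuple.
  rewrite vE; apply: cg => //; rewrite /box/= xab/=; apply/forallP => i.
  by rewrite tnth_mktuple.
move=> /compact_bounded[M [Mr hM]].
exists (`|M| + 1) => [|x t s /andP[/= xab /forallP tL] s12].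
  by rewrite addr_ge0.
apply: (hM (`|M| + 1)); first by rewrite (le_lt_trans (ler_norm _))// ltrDl.
exists (x, vec t, s) => //=; split=> // i; rewrite mxE; exact: tL.
Qed.

Lemma box_gauss_lower : exists2 c, 0 < c & forall p, box p -> c <= gaussT 1 p.
Proof.
exists (expR (- (a ^+ 2 + b ^+ 2 + m%:R * L ^+ 2))) => [|p /andP[pab /forallP tL]].
  exact: expR_gt0.
rewrite ler_expR mul1r lerN2 lerD//.
  exact: sqr_between.
rewrite sqnorm_vec mulr_natl -[X in _ <= _ *+ X]card_ord -sumr_const.
by apply: ler_sum => i _; exact: sqr_between1.
Qed.

(** A Gaussian is bounded below on a box, so a function bounded on a box and
    zero elsewhere is dominated by a Gaussian: this puts truncated functions
    among the Gaussian-dominated ones, where Fubini's theorem applies slice by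
    slice. *)
Lemma cutbox_gauss g : cont_on_box g -> exists2 C, 0 <= C &
  forall s p, s1 <= s <= s2 -> `|cutbox g s p| <= C * gaussT 1 p.
Proof.
move=> cg; have [C C0 hC] := bounded_on_box cg; have [c c0 hc] := box_gauss_lower.
exists (C / c) => [|s p s12]; first by rewrite divr_ge0// ltW.
rewrite /cutbox; case: ifPn => bp; last first.
  by rewrite normr0 mulr_ge0 ?expR_ge0// divr_ge0// ltW.
apply: (@le_trans _ _ C); first by apply: hC => //; case: p bp.
by rewrite -mulrA ler_peMr// mulrC ler_pdivlMr// mul1r; exact: hc.
Qed.

Lemma measurable_cutbox2 g : cont_on_box g ->
  measurable_fun setT (fun q : measurableTypeR R * (measurableTypeR R * tR) =>
    if s1 <= q.1 <= s2 then cutbox g q.1 q.2 else 0).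
Proof.
move=> cg.
pose A := [set q : (measurableTypeR R * tR) * measurableTypeR R |
  box q.1 && (s1 <= q.2 <= s2)].
have mA : measurable A.
  rewrite (_ : A = [set p : measurableTypeR R * tR | box p] `*` `[s1, s2]).
    by apply: measurableX => //; exact: measurable_box.
  apply/seteqP; split=> -[x t] /=; rewrite /A/= in_itv/=.
    by move=> /andP[].
  by move=> [-> ->].
have mgA : measurable_fun A (fun p => g (p.1.1, vec p.1.2, p.2)).
  apply: measurable_of_continuous => -[[x t] s] /= /andP[/= bp s12].
  exact: cg.
move/(measurable_restrictT _ mA) : mgA => mgA.
rewrite (_ : (fun _ => _) = ((fun p : (measurableTypeR R * tR) * measurableTypeR R =>
  g (p.1.1, vec p.1.2, p.2)) \_ A) \o (fun q => (q.2, q.1))).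
  by apply: measurableT_comp => //; exact: measurable_fun_pair.
apply/funext => -[s [x t]]; rewrite /= patchE /cutbox/=.
have -> : ((x, t, s) \in A) = box (x, t) && (s1 <= s <= s2).
  by apply/idP/idP; rewrite inE.
by case: (s1 <= s <= s2); case: (box _).
Qed.

Lemma measurable_cutbox g s : cont_on_box g -> s1 <= s <= s2 ->
  measurable_fun setT (cutbox g s).
Proof.
move=> cg s12.
have mp : measurable_fun setT (fun p : measurableTypeR R * tR => (s : measurableTypeR R, p)).
  exact: measurable_fun_pair.
have := measurableT_comp (measurable_cutbox2 cg) mp.
by congr measurable_fun; apply/funext => p /=; rewrite s12.
Qed.

Lemma summable_cutbox g s : cont_on_box g -> s1 <= s <= s2 ->
  summable_fun (@lebT R m) (cutbox g s).
Proof.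
move=> cg s12; have [C C0 hC] := cutbox_gauss cg.
apply: (summable_le (measurable_cutbox cg s12) (summable_scale C (summable_gaussT m ltr01))).
by move=> p; exact: hC.
Qed.

End boxes.

(** * The truncated Green function as a test function *)

Lemma rV_subE (R : realType) m (v w : 'rV[R]_m) i : (v - w) 0 i = v 0 i - w 0 i.
Proof. by rewrite !mxE. Qed.

Section test_function.
Context {R : realType} {m : nat}.
Local Notation pt := (R * 'rV[R]_m * R)%type.
Variables (x : R) (y : 'rV[R]_m) (t beta delta : R).
Implicit Types (xi s z : R) (eta : 'rV[R]_m).

(** The heat kernel of R x R^m with pole (a, y, t), as a function of the
    backward variables (xi, eta, s). *)
Definition HK a xi eta s : R :=
  hk m.+1 ((a - xi) ^+ 2 + sqnorm (y - eta)) (t - s).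
(** Minus the logarithmic derivative of [HK] in [s]. *)
Definition hkc a xi eta s : R :=
  ((a - xi) ^+ 2 + sqnorm (y - eta)) / (4 * (t - s) ^+ 2) - m.+1%:R / (2 * (t - s)).
Definition cutoffs eta : R := \prod_i cutoff beta (eta 0 i).
Definition cutoffs' (i : 'I_m) eta : R := \prod_(j | j != i) cutoff beta (eta 0 j).

(** The test function: the Green function with poles at x and -x, shifted by
    [delta] and cut off.  [Phis], [Phixx] and [Phiyy i] are its derivatives in
    the variables named by the suffix, and [Phix0] is its normal derivative on
    the face xi = delta. *)
Definition Phi xi eta s : R := cutoff beta (xi - delta) * cutoffs eta *
  (HK x (xi - delta) eta s - HK (- x) (xi - delta) eta s).
Definition Phis xi eta s : R := - (cutoff beta (xi - delta) * cutoffs eta *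
  (hkc x (xi - delta) eta s * HK x (xi - delta) eta s
   - hkc (- x) (xi - delta) eta s * HK (- x) (xi - delta) eta s)).
Definition Phixx xi eta s : R := cutoffs eta *
  (lapc beta x (t - s) (xi - delta) * HK x (xi - delta) eta s
   - lapc beta (- x) (t - s) (xi - delta) * HK (- x) (xi - delta) eta s).
Definition Phiyy i xi eta s : R := cutoff beta (xi - delta) * cutoffs' i eta *
  lapc beta (y 0 i) (t - s) (eta 0 i) *
  (HK x (xi - delta) eta s - HK (- x) (xi - delta) eta s).
Definition Phix0 eta s : R := cutoffs eta * (x / (t - s)) *
  hk m.+1 (x ^+ 2 + sqnorm (y - eta)) (t - s).

(** The part of (cutoff * bell)'' in which the cutoff is differentiated, divided
    by [bell]. *)
Definition errc a q z : R := cutoff2 beta z + cutoff1 beta z * ((a - z) / q).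
Definition Err xi eta s : R :=
  cutoffs eta * (errc x (t - s) (xi - delta) * HK x (xi - delta) eta s
   - errc (- x) (t - s) (xi - delta) * HK (- x) (xi - delta) eta s) +
  \sum_i cutoff beta (xi - delta) * cutoffs' i eta * errc (y 0 i) (t - s) (eta 0 i) *
    (HK x (xi - delta) eta s - HK (- x) (xi - delta) eta s).

Lemma hkD N (r r' q : R) : hk N (r + r') q = hk N r q * expR (- (r' / (4 * q))).
Proof. by rewrite /hk mulrDl opprD expRD mulrAC. Qed.

Lemma cutoffsD i eta : cutoffs eta = cutoff beta (eta 0 i) * cutoffs' i eta.
Proof. by rewrite /cutoffs (bigD1 i). Qed.

Lemma cutoffs'_upd i eta z : cutoffs' i (upd eta i z) = cutoffs' i eta.
Proof. by apply: eq_bigr => j ji; rewrite updE (negbTE ji). Qed.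

Lemma lapc_errc a q z : lapc beta a q z =
  errc a q z + cutoff beta z * ((a - z) ^+ 2 / (4 * q ^+ 2) - (2 * q)^-1).
Proof.
rewrite /lapc /errc; congr (_ + _ + _); rewrite invfM.
by set w := q^-1; field.
Qed.

(** The heat kernel satisfies the backward heat equation exactly, so the
    backward heat operator applied to [Phi] leaves only the terms in which a
    cutoff is differentiated. *)
Lemma ErrE xi eta s : Phis xi eta s + Phixx xi eta s + \sum_i Phiyy i xi eta s =
  Err xi eta s.
Proof.
pose z := xi - delta; pose D := HK x z eta s - HK (- x) z eta s.
have -> : \sum_i Phiyy i xi eta s =
   \sum_i cutoff beta z * cutoffs' i eta * errc (y 0 i) (t - s) (eta 0 i) * D +
   cutoff beta z * cutoffs eta * D *
     (sqnorm (y - eta) / (4 * (t - s) ^+ 2) - m%:R * (2 * (t - s))^-1).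
  have -> : m%:R * (2 * (t - s))^-1 = \sum_(i < m) (2 * (t - s))^-1.
    by rewrite sumr_const card_ord mulr_natl.
  rewrite /sqnorm mulr_suml -sumrB mulr_sumr -big_split/=; apply: eq_bigr => i _.
  rewrite /Phiyy -/z -/D lapc_errc (cutoffsD i) !mxE; ring.
rewrite /Err /Phis /Phixx -/z !lapc_errc -/D /hkc -natr1 /D.
set S := \sum_(_ | _) _; rewrite !mulrDl; ring.
Qed.

Definition sq' i eta : R := \sum_(j | j != i) (y 0 j - eta 0 j) ^+ 2.

Lemma sqnorm_upd i eta z :
  sqnorm (y - upd eta i z) = sq' i eta + (y 0 i - z) ^+ 2.
Proof.
rewrite /sqnorm (bigD1 i)//= addrC; congr (_ + _); last first.
  by rewrite rV_subE updE eqxx.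
by apply: eq_bigr => j ji; rewrite rV_subE updE (negbTE ji).
Qed.

Lemma HK_upd a i xi eta z s : HK a xi (upd eta i z) s =
  hk m.+1 ((a - xi) ^+ 2 + sq' i eta) (t - s) * bell (y 0 i) (t - s) z.
Proof. by rewrite /HK sqnorm_upd addrA hkD. Qed.

(** The factor of [Phi] that is constant along the [i]-th axis. *)
Definition kapy i xi eta s : R := cutoff beta (xi - delta) * cutoffs' i eta *
  (hk m.+1 ((x - (xi - delta)) ^+ 2 + sq' i eta) (t - s)
   - hk m.+1 ((- x - (xi - delta)) ^+ 2 + sq' i eta) (t - s)).

Lemma Phi_yline i xi eta z s : Phi xi (upd eta i z) s =
  kapy i xi eta s * (cutoff beta z * bell (y 0 i) (t - s) z).
Proof.
rewrite /Phi !HK_upd (cutoffsD i) cutoffs'_upd updE eqxx /kapy; ring.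
Qed.

Lemma Phiyy_yline i xi eta z s : Phiyy i xi (upd eta i z) s =
  kapy i xi eta s * cutoffbell2 beta (y 0 i) (t - s) z.
Proof.
rewrite /Phiyy !HK_upd cutoffs'_upd updE eqxx /kapy /cutoffbell2; ring.
Qed.

(** The factor of [Phi] that is constant along the xi-axis. *)
Definition kapx eta s : R := cutoffs eta * hk m.+1 (sqnorm (y - eta)) (t - s).

Lemma HK_x a xi eta s : HK a xi eta s =
  hk m.+1 (sqnorm (y - eta)) (t - s) * bell a (t - s) xi.
Proof. by rewrite /HK addrC hkD. Qed.

Lemma Phi_xline xi eta s : Phi xi eta s = kapx eta s *
  (cutoff beta (xi - delta) * bell x (t - s) (xi - delta)
   - cutoff beta (xi - delta) * bell (- x) (t - s) (xi - delta)).
Proof. rewrite /Phi !HK_x /kapx; ring. Qed.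

Lemma Phixx_xline xi eta s : Phixx xi eta s = kapx eta s *
  (cutoffbell2 beta x (t - s) (xi - delta)
   - cutoffbell2 beta (- x) (t - s) (xi - delta)).
Proof. rewrite /Phixx !HK_x /kapx /cutoffbell2; ring. Qed.

Definition Phix xi eta s : R := kapx eta s *
  (cutoffbell1 beta x (t - s) (xi - delta)
   - cutoffbell1 beta (- x) (t - s) (xi - delta)).

Lemma Phix_delta eta s : s < t -> Phix delta eta s = Phix0 eta s.
Proof.
move=> st; have q0 : t - s != 0 by rewrite subr_eq0 gt_eqF.
rewrite /Phix /Phix0 /kapx /cutoffbell1 subrr /cutoff1 /cutoff !mulr0 mul0r expr0n/= subr0.
rewrite /bell !subr0 sqrrN (addrC (x ^+ 2)) hkD; field.
exact: q0.
Qed.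

Lemma hasder_Phis xi eta s : s < t ->
  hasder s (fun s => Phi xi eta s) (Phis xi eta s).
Proof.
move=> st; apply: hasder_eq.
  apply: hasder_scale; apply: hasder_sub; exact: hasder_hk.
by rewrite /Phis /hkc /HK; ring.
Qed.

Section continuity.
Variable p : pt.
Hypothesis pt : p.2 < t.
Let q0 : t - p.2 != 0. Proof. by rewrite subr_eq0 gt_eqF. Qed.

Lemma cont_cutoff (g : _ -> R) : cont_at g p -> cont_at (fun p => cutoff beta (g p)) p.
Proof.
by move=> h; apply: cont_comp h; exact: hasder_continuous (hasder_cutoff _ _).
Qed.

Lemma cont_cutoffs : cont_at (fun p => cutoffs p.1.2) p.
Proof. by apply: cont_prod => i _; apply: cont_cutoff; exact: cont_y. Qed.

Lemma cont_cutoffs' i : cont_at (fun p => cutoffs' i p.1.2) p.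
Proof. by apply: cont_prod => j _; apply: cont_cutoff; exact: cont_y. Qed.

Lemma cont_xid : cont_at (fun p : R * 'rV[R]_m * R => p.1.1 - delta) p.
Proof. by apply: cont_sub; [exact: cont_x|exact: cont_cst]. Qed.

Lemma cont_q : cont_at (fun p : R * 'rV[R]_m * R => t - p.2) p.
Proof. by apply: cont_sub; [exact: cont_cst|exact: cont_t]. Qed.

Lemma cont_r a : cont_at (fun p : R * 'rV[R]_m * R =>
  (a - (p.1.1 - delta)) ^+ 2 + sqnorm (y - p.1.2)) p.
Proof.
apply: cont_add.
  by apply: cont_pow; apply: cont_sub; [exact: cont_cst|exact: cont_xid].
rewrite /sqnorm; apply: cont_sum => i _; apply: cont_pow.
rewrite (_ : (fun _ => _) = fun p : R * 'rV[R]_m * R => y 0 i - p.1.2 0 i).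
  by apply: cont_sub; [exact: cont_cst|exact: cont_y].
by apply/funext => r; rewrite !mxE.
Qed.

Lemma cont_HK a : cont_at (fun p => HK a (p.1.1 - delta) p.1.2 p.2) p.
Proof.
apply: cont_mul.
  apply: cont_comp; first exact: continuous_expR.
  apply: cont_opp; apply: cont_mul; first exact: cont_r.
  apply: cont_inv; first by rewrite mulf_neq0.
  by apply: cont_mul; [exact: cont_cst|exact: cont_q].
apply: cont_inv.
  rewrite expf_neq0// mulf_neq0// gt_eqF// sqrtr_gt0 mulr_gt0 ?pi_gt0//.
  by rewrite subr_gt0.
apply: cont_pow; apply: cont_mul; first exact: cont_cst.
apply: cont_comp; first exact: sqrt_continuous.
by apply: cont_mul; [exact: cont_cst|exact: cont_q].
Qed.

Lemma cont_hkc a : cont_at (fun p => hkc a (p.1.1 - delta) p.1.2 p.2) p.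
Proof.
apply: cont_sub.
  apply: cont_mul; first exact: cont_r.
  apply: cont_inv; first by rewrite mulf_neq0// expf_neq0.
  by apply: cont_mul; [exact: cont_cst|apply: cont_pow; exact: cont_q].
apply: cont_mul; first exact: cont_cst.
apply: cont_inv; first by rewrite mulf_neq0.
by apply: cont_mul; [exact: cont_cst|exact: cont_q].
Qed.

Lemma cont_lapc a (g : _ -> R) : cont_at g p ->
  cont_at (fun p => lapc beta a (t - p.2) (g p)) p.
Proof.
move=> cg.
have cag : cont_at (fun p => a - g p) p by apply: cont_sub => //; exact: cont_cst.
apply: cont_add; first apply: cont_add.
- apply: (@cont_comp _ _ (cutoff2 beta)) => //; apply: hasder_continuous.
  apply: hasder_add; first exact: hasder_cst_fun.
  apply: hasder_scale; apply: hasder_pow; apply: hasder_scale.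
  exact: hasder_id_fun.
- apply: cont_mul.
    apply: cont_mul; first exact: cont_cst.
    by apply: cont_comp cg; exact: hasder_continuous (hasder_cutoff1 _ _).
  apply: cont_mul => //; apply: cont_inv; first by rewrite mulf_neq0.
  by apply: cont_mul; [exact: cont_cst|exact: cont_q].
- apply: cont_mul; first exact: cont_cutoff.
  apply: cont_sub.
    apply: cont_mul; first exact: cont_pow.
    apply: cont_inv; first by rewrite mulf_neq0// expf_neq0.
    by apply: cont_mul; [exact: cont_cst|apply: cont_pow; exact: cont_q].
  apply: cont_inv; first by rewrite mulf_neq0.
  by apply: cont_mul; [exact: cont_cst|exact: cont_q].
Qed.

Lemma cont_Phi : cont_at (fun p => Phi p.1.1 p.1.2 p.2) p.
Proof.
apply: cont_mul; last by apply: cont_sub; exact: cont_HK.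
by apply: cont_mul; [apply: cont_cutoff; exact: cont_xid|exact: cont_cutoffs].
Qed.

Lemma cont_Phis : cont_at (fun p => Phis p.1.1 p.1.2 p.2) p.
Proof.
apply: cont_opp; apply: cont_mul.
  by apply: cont_mul; [apply: cont_cutoff; exact: cont_xid|exact: cont_cutoffs].
by apply: cont_sub; apply: cont_mul; (exact: cont_HK || exact: cont_hkc).
Qed.

Lemma cont_Phixx : cont_at (fun p => Phixx p.1.1 p.1.2 p.2) p.
Proof.
apply: cont_mul; first exact: cont_cutoffs.
by apply: cont_sub; apply: cont_mul; (exact: cont_HK ||
  apply: cont_lapc; exact: cont_xid).
Qed.

Lemma cont_Phiyy i : cont_at (fun p => Phiyy i p.1.1 p.1.2 p.2) p.
Proof.
apply: cont_mul; last by apply: cont_sub; exact: cont_HK.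
apply: cont_mul; last by apply: cont_lapc; exact: cont_y.
by apply: cont_mul; [apply: cont_cutoff; exact: cont_xid|exact: cont_cutoffs'].
Qed.

Lemma cont_Err : cont_at (fun p => Err p.1.1 p.1.2 p.2) p.
Proof.
rewrite (_ : (fun _ => _) = fun p => Phis p.1.1 p.1.2 p.2 + Phixx p.1.1 p.1.2 p.2 +
    \sum_i Phiyy i p.1.1 p.1.2 p.2); last by apply/funext => r; rewrite ErrE.
apply: cont_add; last by apply: cont_sum => i _; exact: cont_Phiyy.
by apply: cont_add; [exact: cont_Phis|exact: cont_Phixx].
Qed.

End continuity.

End test_function.

(** * Testing the heat equation on a box *)

Section slices.
Context {R : realType} (m : nat).
Local Notation leb := (@lebesgue_measure R).
Local Notation lebt m := (@lebesgue_tuple R m).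
Notation tR := (m.-tuple (measurableTypeR R)).

Section fixed.
Variables (f : measurableTypeR R * tR -> R) (C : R).
Hypothesis mf : measurable_fun setT f.
Hypothesis C0 : 0 <= C.
Hypothesis fC : forall p, `|f p| <= C * gaussT 1 p.

Lemma measurable_slice1 z : measurable_fun setT (fun w => f (z, w)).
Proof. by apply: measurableT_comp mf _; exact: measurable_fun_pair. Qed.

Lemma measurable_slice2 w : measurable_fun setT (fun z => f (z, w)).
Proof. by apply: measurableT_comp mf _; exact: measurable_fun_pair. Qed.

Lemma slice1_gauss z w : `|f (z, w)| <= C * gausst 1 w.
Proof.
apply: (le_trans (fC _)); rewrite ler_wpM2l// gaussTE -[leRHS]mul1r.
by rewrite ler_wpM2r ?gauss1_le1// expR_ge0.
Qed.

Lemma summable_slice1 z : summable_fun (lebt m) (fun w => f (z, w)).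
Proof.
apply: (summable_le (measurable_slice1 z) (summable_scale C (summable_gausst m ltr01))).
exact: slice1_gauss.
Qed.

Lemma summable_slice2 w : summable_fun leb (fun z => f (z, w)).
Proof.
apply: (summable_le (measurable_slice2 w) (summable_scale (C * gausst 1 w) (summable_gauss1 ltr01))).
by move=> z; rewrite -mulrA [X in _ <= _ * X]mulrC; have := fC (z, w); rewrite gaussTE.
Qed.

Lemma summable_gdom : summable_fun (@lebT R m) f.
Proof. exact: (summable_le mf (summable_scale C (summable_gaussT m ltr01))). Qed.

End fixed.

Lemma Rintegral_if_itv (f : R -> R) a b :
  \int[leb]_z (if a <= z <= b then f z else 0) = \int[leb]_(z in `[a, b]) f z.
Proof.
rewrite [RHS]Rintegral_mkcond; apply: eq_Rintegral => z _.
by rewrite patchE mem_setE in_itv.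
Qed.

Lemma Rintegral0 d (T : measurableType d) (mu : {measure set T -> \bar R}) :
  \int[mu]_z (0 : R) = 0.
Proof. by rewrite /Rintegral integral0. Qed.

End slices.

Lemma cont_near {R : realType} {m : nat} (g f : R * 'rV[R]_m * R -> R) p :
  (\forall q \near p, g q = f q) -> cont_at g p -> cont_at f p.
Proof.
move=> gf cg; have e := nbhs_singleton gf.
suff : f q @[q --> p] --> f p by [].
by rewrite -e; apply: cvg_trans cg; exact: near_eq_cvg.
Qed.

Lemma near_gt {R : realType} {m : nat} (g : R * 'rV[R]_m * R -> R) p (c : R) :
  cont_at g p -> c < g p -> \forall q \near p, c < g q.
Proof.
move=> cg cp; have h : g q @[q --> p] --> g p by [].
exact: (cvgr_gt _ h _ cp).
Qed.

Section core_identity.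
Context {R : realType} {m : nat}.
Local Notation leb := (@lebesgue_measure R).
Local Notation lebt m := (@lebesgue_tuple R m).
Notation tR := (m.-tuple (measurableTypeR R)).
Local Notation pt := (R * 'rV[R]_m * R)%type.
Variables (u : R -> 'rV[R]_m -> R -> R) (f : 'rV[R]_m -> R -> R).
Hypothesis ureg : classical_regularity u.
Hypothesis ueq : forall xi eta s, 0 < xi -> 0 < s ->
  dt u xi eta s - laplacian u xi eta s = - f eta s.

Variables (x : R) (y : 'rV[R]_m) (t beta delta s1 s2 : R).
Hypotheses (beta0 : 0 < beta) (delta0 : 0 < delta) (s10 : 0 < s1)
  (s12 : s1 < s2) (s2t : s2 < t).

Let L := beta^-1.
Let b := delta + L.
Let L0 : 0 < L. Proof. by rewrite invr_gt0. Qed.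
Let betaL : beta * L = 1. Proof. by rewrite divff// gt_eqF. Qed.

Local Notation Phi := (Phi x y t beta delta).
Local Notation Phis := (Phis x y t beta delta).
Local Notation Phixx := (Phixx x y t beta delta).
Local Notation Phiyy := (Phiyy x y t beta delta).
Local Notation Phix0 := (Phix0 x y t beta).
Local Notation Err := (Err x y t beta delta).

Lemma sourceE xi eta s : 0 < xi -> 0 < s ->
  f eta s = dx (dx u) xi eta s + \sum_i dy i (dy i u) xi eta s - dt u xi eta s.
Proof.
move=> xi0 s0; have := ueq eta xi0 s0; rewrite /laplacian => /(congr1 -%R).
by rewrite opprK opprB.
Qed.

(** The equation expresses the source through continuous derivatives of [u]. *)
Lemma cont_source p : 0 < p.1.1 -> 0 < p.2 ->
  cont_at (fun p : pt => f p.1.2 p.2) p.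
Proof.
case: p => [[xi eta] s] /= xi0 s0.
have [_ [_ ct] [_ _ cxx] cyy] := ureg eta xi0 s0.
have h : cont_at (fun p : pt => dx (dx u) p.1.1 p.1.2 p.2 +
    \sum_i dy i (dy i u) p.1.1 p.1.2 p.2 - dt u p.1.1 p.1.2 p.2) (xi, eta, s).
  apply: cont_sub => //; apply: cont_add => //; apply: cont_sum => i _.
  by have [_ _] := cyy i.
apply: (cont_near _ h).
have hx := near_gt (cont_x (p := (xi, eta, s))) xi0.
have ht := near_gt (cont_t (p := (xi, eta, s))) s0.
by apply: filterS2 hx ht => p p0 q0; rewrite (sourceE p.1.2 p0 q0).
Qed.

(** The time derivative of the product of the test function and [u] is split
    by the equation into a part without derivatives of [u] and one Green
    integrand for each space variable. *)
Definition dt_Phi_u (p : pt) : R := Phis p.1.1 p.1.2 p.2 * u p.1.1 p.1.2 p.2 +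
  Phi p.1.1 p.1.2 p.2 * dt u p.1.1 p.1.2 p.2.
Definition bulk (p : pt) : R := Err p.1.1 p.1.2 p.2 * u p.1.1 p.1.2 p.2 -
  Phi p.1.1 p.1.2 p.2 * f p.1.2 p.2.
Definition green_x (p : pt) : R := Phi p.1.1 p.1.2 p.2 * dx (dx u) p.1.1 p.1.2 p.2 -
  Phixx p.1.1 p.1.2 p.2 * u p.1.1 p.1.2 p.2.
Definition green_y i (p : pt) : R := Phi p.1.1 p.1.2 p.2 * dy i (dy i u) p.1.1 p.1.2 p.2 -
  Phiyy i p.1.1 p.1.2 p.2 * u p.1.1 p.1.2 p.2.
Definition Phi_u (p : pt) : R := Phi p.1.1 p.1.2 p.2 * u p.1.1 p.1.2 p.2.

Lemma dt_Phi_uE p : 0 < p.1.1 -> 0 < p.2 -> dt_Phi_u p = bulk p + green_x p + \sum_i green_y i p.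
Proof.
move=> p0 q0; have e := ueq p.1.2 p0 q0; rewrite /laplacian in e.
rewrite /dt_Phi_u /bulk /green_x sumrB -mulr_sumr -mulr_suml -ErrE.
have -> : dt u p.1.1 p.1.2 p.2 = dx (dx u) p.1.1 p.1.2 p.2 +
   \sum_i dy i (dy i u) p.1.1 p.1.2 p.2 - f p.1.2 p.2.
  by rewrite -e; ring.
ring.
Qed.

Local Notation conton g := (@cont_on_box R m delta b L s1 s2 g).
Local Notation cut := (@cutbox R m delta b L).

Let box_pos (z : R) (w : tR) s : box delta b L (z, w) -> s1 <= s <= s2 ->
  [/\ 0 < z, 0 < s & s < t].
Proof.
move=> /andP[/= /andP[dz _] _] /andP[s1s ss2].
by split; [exact: lt_le_trans dz|exact: lt_le_trans s1s|exact: le_lt_trans s2t].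
Qed.

Lemma cb_u : conton (fun p => u p.1.1 p.1.2 p.2).
Proof. by move=> z w s bz hs; have [z0 s0 st] := box_pos bz hs; have [] := ureg (vec w) z0 s0. Qed.

Lemma cb_Phi : conton (fun p => Phi p.1.1 p.1.2 p.2).
Proof. by move=> z w s bz hs; have [z0 s0 st] := box_pos bz hs; exact: cont_Phi. Qed.

Lemma cb_mul g h : conton g -> conton h -> conton (fun p => g p * h p).
Proof. by move=> cg ch z w s bz hs; apply: cont_mul; [exact: cg|exact: ch]. Qed.

Lemma cb_Phi_u : conton Phi_u.
Proof. by apply: cb_mul; [exact: cb_Phi|exact: cb_u]. Qed.

Lemma cb_dt_Phi_u : conton dt_Phi_u.
Proof.
move=> z w s bz hs; have [z0 s0 st] := box_pos bz hs.
have [cu [_ ct] _ _] := ureg (vec w) z0 s0.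
apply: cont_add; apply: cont_mul => //; first exact: cont_Phis.
exact: cont_Phi.
Qed.

Lemma cb_bulk : conton bulk.
Proof.
move=> z w s bz hs; have [z0 s0 st] := box_pos bz hs.
have [cu [_ ct] _ _] := ureg (vec w) z0 s0.
apply: cont_sub; apply: cont_mul => //; first exact: cont_Err.
  exact: cont_Phi.
exact: cont_source.
Qed.

Lemma cb_green_x : conton green_x.
Proof.
move=> z w s bz hs; have [z0 s0 st] := box_pos bz hs.
have [cu _ [_ _ cxx] _] := ureg (vec w) z0 s0.
apply: cont_sub; apply: cont_mul => //; first exact: cont_Phi.
exact: cont_Phixx.
Qed.

Lemma cb_green_y i : conton (green_y i).
Proof.
move=> z w s bz hs; have [z0 s0 st] := box_pos bz hs.
have [cu _ _ /(_ i)[_ _ cyy]] := ureg (vec w) z0 s0.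
apply: cont_sub; apply: cont_mul => //; first exact: cont_Phi.
exact: cont_Phiyy.
Qed.

Lemma cutoff_end : cutoff beta L = 0 /\ cutoff1 beta L = 0.
Proof. by rewrite /cutoff /cutoff1 betaL expr1n subrr expr0n/= mulr0. Qed.

Lemma cutoff_endN : cutoff beta (- L) = 0 /\ cutoff1 beta (- L) = 0.
Proof. by rewrite /cutoff /cutoff1 mulrN betaL sqrrN expr1n subrr expr0n/= mulr0. Qed.

Section fixed_time.
Variable s : R.
Hypothesis hs : s1 <= s <= s2.
Let s0 : 0 < s. Proof. by case/andP: hs => h _; exact: lt_le_trans h. Qed.
Let st : s < t. Proof. by case/andP: hs => _ h; exact: le_lt_trans s2t. Qed.
Let q0 : t - s != 0. Proof. by rewrite subr_eq0 gt_eqF. Qed.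

Lemma cube_set_tnth (w : tR) i z : cube L (set_tnth w i z) =
  (- L <= z <= L) && [forall j, (j != i) ==> (- L <= tnth w j <= L)].
Proof.
apply/forallP/andP => [h|[hz /forallP h] j].
  split; first by have := h i; rewrite tnth_mktuple eqxx.
  apply/forallP => j; apply/implyP => ji; have := h j.
  by rewrite tnth_mktuple (negbTE ji).
rewrite tnth_mktuple; case: eqP => [//|/eqP ji].
by move/implyP : (h j); apply.
Qed.

(** Green's identity on the line through the [i]-th axis: the cutoff and its
    derivative vanish at both ends. *)
Lemma Rintegral_green_y i : \int[@lebT R m]_p cut (green_y i) s p = 0.
Proof.
have [C C0 hC] := cutbox_gauss (@cb_green_y i).
have mF := measurable_cutbox (@cb_green_y i) hs.
have FC p : `|cut (green_y i) s p| <= C * gaussT 1 p by exact: hC.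
have [|_ <-] := Rfubini1 (summable_gdom mF FC).
  by move=> z; exact: summable_slice1 FC z.
under eq_Rintegral => z _.
  rewrite (Rintegral_line_eq0 (i := i)); first over.
    split; first exact: measurable_slice1.
    by exists C => w; exact: slice1_gauss.
  move=> w; rewrite /cutbox.
  pose rb := (delta <= z <= b) && [forall j, (j != i) ==> (- L <= tnth w j <= L)].
  have bE r : box delta b L (z, set_tnth w i r) = rb && (- L <= r <= L).
    by rewrite /box/= cube_set_tnth /rb; case: (_ <= z <= _) => //=; rewrite andbC.
  have [rbT|rbF] := boolP rb; last first.
    under eq_Rintegral => r _ do rewrite bE (negbTE rbF)/=.
    exact: Rintegral0.
  under eq_Rintegral => r _ do rewrite bE rbT/= vec_set_tnth.
  rewrite (Rintegral_if_itv (fun r => green_y i (z, upd (vec w) i r, s))).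
  pose k := kapy x y t beta delta i z (vec w) s.
  have hb r : - L <= r <= L -> box delta b L (z, set_tnth w i r).
    by move=> h; rewrite bE rbT.
  have z0 : 0 < z by case/andP: rbT => /andP[h _] _; exact: lt_le_trans h.
  have := @Green_identity _
    (fun r => k * (cutoff beta r * bell (y 0 i) (t - s) r))
    (fun r => k * cutoffbell1 beta (y 0 i) (t - s) r)
    (fun r => k * cutoffbell2 beta (y 0 i) (t - s) r)
    (fun r => u z (upd (vec w) i r) s)
    (fun r => dy i u z (upd (vec w) i r) s)
    (fun r => dy i (dy i u) z (upd (vec w) i r) s) (- L) L.
  rewrite /cutoffbell1 !cutoff_end.1 !cutoff_end.2 !cutoff_endN.1 !cutoff_endN.2.
  rewrite !(mul0r, mulr0, addr0, subr0) => <-.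
  - apply: eq_Rintegral => r _; rewrite /green_y/= Phi_yline Phiyy_yline -/k; ring.
  - by rewrite ltrNl (lt_trans _ L0)// oppr_lt0.
  - by move=> r _; apply: hasder_scale; exact: hasder_cutoffbell.
  - by move=> r _; apply: hasder_scale; exact: hasder_cutoffbell1.
  - move=> r _; have [_ _ _ /(_ i)[h _ _]] := ureg (upd (vec w) i r) z0 s0.
    exact: (@hasder_yline _ _ (fun v => u z v s)).
  - move=> r _; have [_ _ _ /(_ i)[_ h _]] := ureg (upd (vec w) i r) z0 s0.
    exact: (@hasder_yline _ _ (fun v => dy i u z v s)).
  - move=> r _; apply: continuousM; first exact: cst_continuous.
    exact: continuous_cutoffbell2.
  - move=> r _; have [_ _ _ /(_ i)[_ _ h]] := ureg (upd (vec w) i r) z0 s0.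
    exact: (cont_yline h).
exact: Rintegral0.
Qed.

(** Here the test function vanishes on the face xi = delta but its normal
    derivative does not, which leaves one boundary term. *)
Lemma Rintegral_green_x : \int[@lebT R m]_p cut green_x s p =
  \int[lebt m]_w cutcube L (fun eta => Phix0 eta s * u delta eta s) w.
Proof.
have [C C0 hC] := cutbox_gauss cb_green_x.
have mF := measurable_cutbox cb_green_x hs.
have FC p : `|cut green_x s p| <= C * gaussT 1 p by exact: hC.
have [|_ <-] := Rfubini2 (summable_gdom mF FC).
  by move=> z; exact: summable_slice2 FC z.
apply: eq_Rintegral => w _; rewrite /cutcube /cutbox /box /=.
case: ifPn => wL; last first.
  by under eq_Rintegral => z _ do rewrite andbF; exact: Rintegral0.
under eq_Rintegral => z _ do rewrite andbT.
rewrite (Rintegral_if_itv (fun z => green_x (z, vec w, s))).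
set eta := vec w; pose k := kapx y t beta eta s.
have := @Green_identity _
    (fun z => k * (cutoff beta (z - delta) * bell x (t - s) (z - delta)
       - cutoff beta (z - delta) * bell (- x) (t - s) (z - delta)))
    (fun z => k * (cutoffbell1 beta x (t - s) (z - delta)
       - cutoffbell1 beta (- x) (t - s) (z - delta)))
    (fun z => k * (cutoffbell2 beta x (t - s) (z - delta)
       - cutoffbell2 beta (- x) (t - s) (z - delta)))
    (fun z => u z eta s) (fun z => dx u z eta s) (fun z => dx (dx u) z eta s)
    delta b.
have zp z : delta <= z <= b -> 0 < z.
  by move=> /andP[h _]; exact: lt_le_trans h.
move=> Gr.
(* The first zero is the boundary term at xi = b, where the cutoff vanishes to
   second order; the second is [Phi] at xi = delta. *)
have -> : \int[leb]_(z in `[delta, b]) green_x (z, eta, s) =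
   0 - (0 - Phix0 eta s * u delta eta s).
  rewrite -(@Phix_delta R m x y t beta delta eta s st) /Phix -/k.
  rewrite (_ : 0 - (0 - _) = (k * (cutoff beta (b - delta) * bell x (t - s) (b - delta)
       - cutoff beta (b - delta) * bell (- x) (t - s) (b - delta)) * dx u b eta s -
       k * (cutoffbell1 beta x (t - s) (b - delta)
       - cutoffbell1 beta (- x) (t - s) (b - delta)) * u b eta s) -
     (k * (cutoff beta (delta - delta) * bell x (t - s) (delta - delta)
       - cutoff beta (delta - delta) * bell (- x) (t - s) (delta - delta)) * dx u delta eta s -
      k * (cutoffbell1 beta x (t - s) (delta - delta)
       - cutoffbell1 beta (- x) (t - s) (delta - delta)) * u delta eta s)); last first.
    rewrite (_ : b - delta = L); last by rewrite /b addrC addKr.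
    have e1 a : cutoffbell1 beta a (t - s) L = 0.
      by rewrite /cutoffbell1 cutoff_end.1 cutoff_end.2 mul0r addr0 mul0r.
    have e2 : bell x (t - s) (delta - delta) = bell (- x) (t - s) (delta - delta).
      by rewrite /bell subrr !subr0 sqrrN.
    by rewrite !e1 e2 cutoff_end.1; ring.
  rewrite -Gr.
  - apply: eq_Rintegral => z _; rewrite /green_x/= Phi_xline Phixx_xline -/k; ring.
  - by rewrite ltrDl.
  - move=> z _; apply: hasder_scale; apply: hasder_sub;
      exact: (@hasder_comp_shift _ (fun z => cutoff beta z * bell _ (t - s) z) _ _ _
        (hasder_cutoffbell _ _ _ q0)).
  - move=> z _; apply: hasder_scale; apply: hasder_sub;
      exact: (@hasder_comp_shift _ _ _ _ _ (hasder_cutoffbell1 _ _ _ q0)).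
  - move=> z /zp z0; have [_ _ [h _ _] _] := ureg eta z0 s0.
    exact: (hasder_derive1 h).
  - move=> z /zp z0; have [_ _ [_ h _] _] := ureg eta z0 s0.
    exact: (hasder_derive1 h).
  - move=> z _; apply: continuousM; first exact: cst_continuous.
    apply: continuousB; apply: (continuous_comp (f := fun z => z - delta));
     by [apply: continuousB; [exact: cvg_id|exact: cst_continuous]
        |exact: continuous_cutoffbell2].
  - move=> z /zp z0; have [_ _ [_ _ h] _] := ureg eta z0 s0.
    exact: (cont_xline h).
by rewrite !sub0r opprK.
Qed.

Lemma Rintegral_dt_Phi_u : \int[@lebT R m]_p cut dt_Phi_u s p =
  \int[@lebT R m]_p cut bulk s p +
  \int[lebt m]_w cutcube L (fun eta => Phix0 eta s * u delta eta s) w.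
Proof.
have sF0 := summable_cutbox cb_bulk hs.
have sFx := summable_cutbox cb_green_x hs.
have sFy i := summable_cutbox (@cb_green_y i) hs.
transitivity (\int[@lebT R m]_p (cut bulk s p + cut green_x s p + \sum_i cut (green_y i) s p)).
  apply: eq_Rintegral => -[z w] _; rewrite /cutbox; case: ifPn => bz.
    by have [z0 _ _] := box_pos bz hs; rewrite dt_Phi_uE.
  by rewrite !add0r big1.
have sS := summable_bigsum (index_enum 'I_m) (P := xpredT) (fun i _ => sFy i).
rewrite (Rintegral_add (summable_add sF0 sFx) sS) (Rintegral_add sF0 sFx).
rewrite (Rintegral_sum _ (fun i _ => sFy i)).
under [X in _ + X]eq_bigr => i _ do rewrite Rintegral_green_y.
by rewrite big1// addr0 Rintegral_green_x.
Qed.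

End fixed_time.

Definition Gtime s : R := if s1 <= s <= s2 then \int[@lebT R m]_p cut dt_Phi_u s p else 0.

(** The fundamental theorem of calculus in time at each point of the box,
    integrated over the box, with the two integrations exchanged. *)
Lemma core_time : summable_fun leb Gtime /\
  \int[@lebT R m]_p cut Phi_u s2 p - \int[@lebT R m]_p cut Phi_u s1 p =
  \int[leb]_s Gtime s.
Proof.
pose H (q : measurableTypeR R * (measurableTypeR R * tR)) :=
  if s1 <= q.1 <= s2 then cut dt_Phi_u q.1 q.2 else 0.
have mH : measurable_fun setT H := measurable_cutbox2 cb_dt_Phi_u.
have [C C0 hC] := cutbox_gauss cb_dt_Phi_u.
(* The factor exp(-s^2) provides an integrable majorant in time as well. *)
pose C' := C / expR (- (s2 ^+ 2)).
have C'0 : 0 <= C' by rewrite divr_ge0// expR_ge0.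
have hH q : `|H q| <= C' * (gauss1 1 q.1 * gaussT 1 q.2).
  rewrite /H; case: ifPn => hs; last by rewrite normr0 !mulr_ge0// expR_ge0.
  apply: (le_trans (hC _ _ hs)).
  rewrite mulrA ler_wpM2r ?expR_ge0// /C' -mulrA ler_peMr// mulrC ler_pdivlMr ?expR_gt0//.
  rewrite mul1r /gauss1 mul1r ler_expR lerN2.
  by move: hs s10 => /andP[]; nra.
have sg : summable_fun (prod_sf leb (@lebT R m)) (fun q => C' * (gauss1 1 q.1 * gaussT 1 q.2)).
  apply: summable_scale; apply: summable_prod; first exact: summable_gauss1.
  exact: summable_gaussT.
have sH : summable_fun (prod_sf leb (@lebT R m)) H by exact: summable_le hH.
have mH1 s : measurable_fun setT (fun p => H (s, p)).
  by apply: measurableT_comp mH _; exact: measurable_fun_pair.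
have mH2 p : measurable_fun setT (fun s => H (s, p)).
  by apply: measurableT_comp mH _; exact: measurable_fun_pair.
have [|sG e1] := Rfubini1 sH.
  move=> s; apply: (summable_le (mH1 s) (summable_scale (C' * gauss1 1 s) (summable_gaussT m ltr01))).
  by move=> p; rewrite -mulrA; exact: hH.
have [|_ e2] := Rfubini2 sH.
  move=> p; apply: (summable_le (mH2 p) (summable_scale (C' * gaussT 1 p) (summable_gauss1 ltr01))).
  by move=> s; rewrite -mulrA [X in _ <= _ * X]mulrC; exact: hH.
have GE : Gtime = fun s => \int[@lebT R m]_p H (s, p).
  apply/funext => s; rewrite /Gtime /H/=; case: ifP => _ //.
  by rewrite Rintegral0.
rewrite GE; split=> //; rewrite e1 -e2.
have s1s2 : s1 <= s1 <= s2 by rewrite lexx ltW.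
have s2s2 : s1 <= s2 <= s2 by rewrite lexx ltW.
rewrite -(Rintegral_subr (summable_cutbox cb_Phi_u s2s2) (summable_cutbox cb_Phi_u s1s2)).
apply: eq_Rintegral => -[z w] _; rewrite /H /cutbox /=.
case: ifPn => bz; last first.
  under [RHS]eq_Rintegral => s _ do rewrite if_same.
  by rewrite Rintegral0 subr0.
rewrite (Rintegral_if_itv (fun s => dt_Phi_u (z, vec w, s))).
have hd s : s1 <= s <= s2 -> hasder s (fun s => Phi_u (z, vec w, s)) (dt_Phi_u (z, vec w, s)).
  move=> hs; have [z0 s0 st] := box_pos bz hs.
  apply: hasder_mul; first exact: hasder_Phis.
  have [_ [h _] _ _] := ureg (vec w) z0 s0.
  exact: (hasder_derive1 h).
have hc s : s1 <= s <= s2 -> {for s, continuous (fun s => dt_Phi_u (z, vec w, s))}.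
  by move=> hs; exact: (cont_tline (cb_dt_Phi_u bz hs)).
by rewrite (Rintegral_derive s12 hd hc).
Qed.

End core_identity.

(** * Gaussian bounds for the test function *)

Section bounds.
Context {R : realType} {m : nat}.
Notation tR := (m.-tuple (measurableTypeR R)).
Implicit Types (r q a z w s : R).

Lemma X_le_expR r c : 0 < c -> 0 <= r -> r <= c * expR (r / c).
Proof.
move=> c0 r0; rewrite -[leLHS](divfK (lt0r_neq0 c0)) mulrC ler_wpM2l ?(ltW c0)//.
apply: le_trans (expR_ge1Dx _); last by rewrite lerDr.
Qed.

Lemma hk_ge0 N r q : 0 <= hk N r q.
Proof.
by rewrite divr_ge0 ?expR_ge0// exprn_ge0// mulr_ge0// sqrtr_ge0.
Qed.

(** Half of the Gaussian exponent absorbs the linear factor 1 + |w|, through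
    r <= c exp(r/c) with c = 8 T; the constant is uniform over the times q in
    [theta, T]. *)
Lemma hk_bound N r q w theta T : 0 < theta -> theta <= q -> q <= T ->
  w ^+ 2 <= r ->
  (1 + `|w|) * hk N r q <=
    (2 + 8 * T) / (2 * Num.sqrt (pi * theta)) ^+ N * expR (- (r / (8 * T))).
Proof.
move=> th0 thq qT wr.
have q0 : 0 < q by exact: lt_le_trans thq.
have T0 : 0 < T by exact: lt_le_trans qT.
have r0 : 0 <= r by apply: le_trans wr; exact: sqr_ge0.
have pth : 0 < pi * theta by rewrite mulr_gt0// pi_gt0.
have sth : 0 < Num.sqrt (pi * theta) by rewrite sqrtr_gt0.
have w1 : 1 + `|w| <= 2 + r.
  have : `|w| <= 1 + w ^+ 2 by case: (ger0P w) => ?; nra.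
  by lra.
have e1 : expR (- (r / (4 * q))) <= expR (- (r / (4 * T))).
  rewrite ler_expR lerN2 ler_wpM2l// lef_pV2 ?posrE ?mulr_gt0// ler_wpM2l//.
have e2 : ((2 * Num.sqrt (pi * q)) ^+ N)^-1 <= ((2 * Num.sqrt (pi * theta)) ^+ N)^-1.
  rewrite lef_pV2 ?posrE ?exprn_gt0 ?mulr_gt0 ?sqrtr_gt0 ?mulr_gt0 ?pi_gt0//.
  rewrite lerXn2r ?nnegrE ?mulr_ge0 ?sqrtr_ge0// ler_wpM2l// ler_wsqrtr//.
  by rewrite ler_wpM2l// pi_ge0.
have h1 : hk N r q <= expR (- (r / (4 * T))) / (2 * Num.sqrt (pi * theta)) ^+ N.
  by rewrite /hk; apply: ler_pM.
have h2 : (2 + r) * expR (- (r / (4 * T))) <= (2 + 8 * T) * expR (- (r / (8 * T))).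
  have -> : - (r / (4 * T)) = - (r / (8 * T)) + - (r / (8 * T)).
    by field; rewrite gt_eqF.
  rewrite expRD mulrA ler_wpM2r ?expR_ge0// mulrDl lerD//.
    by rewrite ger_pMr// -expR0 ler_expR oppr_le0 divr_ge0// mulr_ge0// ltW.
  have := @X_le_expR r (8 * T); rewrite mulr_gt0// => /(_ isT r0) h.
  apply: (le_trans (ler_wpM2r (expR_ge0 _) h)).
  by rewrite -[leLHS]mulrA -expRD subrr expR0 mulr1.
apply: (le_trans (ler_pM _ (hk_ge0 _ _ _) w1 h1)); first by rewrite addr_ge0.
rewrite mulrA [leRHS]mulrAC ler_wpM2r// invr_ge0 exprn_ge0// mulr_ge0// ltW.
Qed.

Lemma sqnorm_sub_ge (y eta : 'rV[R]_m) :
  sqnorm eta / 2 - sqnorm y <= sqnorm (y - eta).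
Proof.
rewrite /sqnorm mulr_suml -sumrB; apply: ler_sum => i _; rewrite rV_subE.
(* (y - e)^2 - (e^2 / 2 - y^2) = (2 y - e)^2 / 2. *)
by have := sqr_ge0 (2 * y 0 i - eta 0 i); nra.
Qed.

(** A quadratic lower bound centred at the origin, at the price of halving the
    coefficient, so that kernels with different poles share one Gaussian
    majorant. *)
Lemma dist_lower (x a delta xi : R) (y eta : 'rV[R]_m) : `|a| = x ->
  0 <= delta <= 1 ->
  (xi ^+ 2 + sqnorm eta) / 2 - (2 * x ^+ 2 + 2 + sqnorm y) <=
  (a - (xi - delta)) ^+ 2 + sqnorm (y - eta).
Proof.
move=> ax /andP[d0 d1]; have := sqnorm_sub_ge y eta.
have -> : x ^+ 2 = a ^+ 2 by rewrite -ax real_normK ?num_real.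
have : xi ^+ 2 / 2 - 2 * a ^+ 2 - 2 <= (a - (xi - delta)) ^+ 2.
  (* With c = a + delta, (c - xi)^2 - xi^2 / 2 + c^2 = (xi - 2 c)^2 / 2, and
     c^2 <= 2 a^2 + 2 delta^2. *)
  have h1 := sqr_ge0 (a - delta).
  have h2 := sqr_ge0 (xi - 2 * (a + delta)).
  nra.
lra.
Qed.

Variables (x : R) (y : 'rV[R]_m) (t theta : R).
Hypotheses (x0 : 0 < x) (th0 : 0 < theta).

(** The exponent of the common Gaussian majorant of all kernels up to time
    [t]: 1/(4 t) halved once to absorb linear factors and once more to move the
    centre to the origin. *)
Definition rate : R := (16 * t)^-1.
Definition HKcst : R := (2 + 8 * t) / (2 * Num.sqrt (pi * theta)) ^+ m.+1 *
  expR ((2 * x ^+ 2 + 2 + sqnorm y) / (8 * t)).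

Lemma HKcst_ge0 : 0 < t -> 0 <= HKcst.
Proof.
move=> t0; rewrite mulr_ge0 ?expR_ge0// divr_ge0//.
by rewrite addr_ge0// mulr_ge0// ltW.
Qed.

(** The factor 1 + |w| is for the linear factors produced by derivatives of
    the kernel: [w] is any coordinate of the distance to the pole. *)
Lemma HK_bound a delta s w (p : measurableTypeR R * tR) : `|a| = x ->
  0 <= delta <= 1 -> 0 <= s -> theta <= t - s ->
  w ^+ 2 <= (a - (p.1 - delta)) ^+ 2 + sqnorm (y - vec p.2) ->
  (1 + `|w|) * HK y t a (p.1 - delta) (vec p.2) s <= HKcst * gaussT rate p.
Proof.
move=> ax d01 s0 ths wr.
have t0 : 0 < t by rewrite (lt_le_trans th0)// (le_trans ths)// gerBl.
have tst : t - s <= t by rewrite gerBl.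
apply: (le_trans (hk_bound m.+1 th0 ths tst wr)).
rewrite /HKcst -[leRHS]mulrA ler_wpM2l//.
  by rewrite divr_ge0// addr_ge0// mulr_ge0// ltW.
rewrite /gaussT -expRD ler_expR /rate.
have := dist_lower (p.1 : R) y (vec p.2) ax d01.
set r := _ + sqnorm (y - _) => rl.
rewrite -[leRHS](_ : - (((p.1 ^+ 2 + sqnorm (vec p.2)) / 2 -
   (2 * x ^+ 2 + 2 + sqnorm y)) / (8 * t)) = _); last by field; rewrite gt_eqF.
by rewrite lerN2 ler_wpM2r// invr_ge0 mulr_ge0// ltW.
Qed.

Lemma HK_bound0 a delta s (p : measurableTypeR R * tR) : `|a| = x ->
  0 <= delta <= 1 -> 0 <= s -> theta <= t - s ->
  HK y t a (p.1 - delta) (vec p.2) s <= HKcst * gaussT rate p.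
Proof.
move=> ax d01 s0 ths; have := @HK_bound a delta s 0 p ax d01 s0 ths.
by rewrite normr0 addr0 mul1r; apply; rewrite expr0n addr_ge0 ?sqr_ge0 ?sqnorm_ge0.
Qed.

Lemma HK_ge0 a xi eta s : 0 <= HK y t a xi eta s.
Proof. exact: hk_ge0. Qed.

End bounds.

Section cutoff_bounds.
Context {R : realType} {m : nat}.
Variable beta : R.
Hypothesis beta01 : 0 < beta <= 1.
Notation tR := (m.-tuple (measurableTypeR R)).

Lemma cutoff_itv (z : R) : (beta * z) ^+ 2 <= 1 -> 0 <= cutoff beta z <= 1.
Proof.
move=> h; rewrite sqr_ge0/= /cutoff; have := sqr_ge0 (beta * z).
by move: h; set v := (beta * z) ^+ 2 => ? ?; nra.
Qed.

Lemma cutoff1_le (z : R) : (beta * z) ^+ 2 <= 1 -> `|cutoff1 beta z| <= 4 * beta.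
Proof.
case/andP: beta01 => b0 b1 h.
have -> : cutoff1 beta z = - (4 * beta * ((beta * z) * (1 - (beta * z) ^+ 2))).
  by rewrite /cutoff1; ring.
rewrite normrN normrM ger0_norm ?mulr_ge0 ?(ltW b0)// ler_piMr ?mulr_ge0 ?(ltW b0)//.
rewrite normrM mulr_ile1//.
  by rewrite -(@ler_pXn2r _ 2)// ?nnegrE// expr1n real_normK ?num_real.
by rewrite ger0_norm ?subr_ge0// gerBl sqr_ge0.
Qed.

(** Every derivative of the cutoff gains a factor [beta]; the second one gains
    two, of which one suffices as beta <= 1. *)
Lemma cutoff2_le (z : R) : (beta * z) ^+ 2 <= 1 -> `|cutoff2 beta z| <= 16 * beta.
Proof.
case/andP: beta01 => b0 b1 h; rewrite /cutoff2.
have v0 := sqr_ge0 (beta * z); set v := (beta * z) ^+ 2 in h v0 *.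
have bb : beta ^+ 2 <= beta by rewrite expr2 ler_piMr// (ltW b0).
have b20 := sqr_ge0 beta.
by rewrite ler_norml; apply/andP; split; nra.
Qed.

Lemma errc_le a q theta (z : R) : 0 < theta -> theta <= q -> (beta * z) ^+ 2 <= 1 ->
  `|errc beta a q z| <= beta * (16 + 4 / theta) * (1 + `|a - z|).
Proof.
move=> th0 thq h; have q0 : 0 < q by exact: lt_le_trans thq.
case/andP: (beta01) => b0 b1.
apply: (le_trans (ler_normD _ _)); rewrite normrM.
have h1 := cutoff1_le h; have h2 := cutoff2_le h.
have h3 : `|(a - z) / q| <= `|a - z| / theta.
  rewrite normrM ler_wpM2l// ger0_norm ?invr_ge0 ?(ltW q0)//.
  by rewrite lef_pV2 ?posrE.
have h4 := ler_pM (normr_ge0 _) (normr_ge0 _) h1 h3.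
apply: (le_trans (lerD h2 h4)).
rewrite -subr_ge0; set A := `|a - z|.
rewrite (_ : _ - _ = beta * (4 / theta + 16 * A)); last by ring.
have th4 : 0 <= 4 / theta by rewrite divr_ge0 ?(ltW th0).
have A0 : 0 <= A := normr_ge0 _.
apply: mulr_ge0; first exact: ltW.
by lra.
Qed.

Lemma prod_itv01 I (r : seq I) (P : pred I) (F : I -> R) :
  (forall i, P i -> 0 <= F i <= 1) -> 0 <= \prod_(i <- r | P i) F i <= 1.
Proof.
move=> h; elim/big_ind : _ => //; first by rewrite ler01 lexx.
by move=> a b /andP[a0 a1] /andP[b0 b1]; rewrite mulr_ge0// mulr_ile1.
Qed.

End cutoff_bounds.

Section test_bounds.
Context {R : realType} {m : nat}.
Notation tR := (m.-tuple (measurableTypeR R)).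
Variables (x : R) (y : 'rV[R]_m) (t theta beta delta : R).
Hypotheses (x0 : 0 < x) (th0 : 0 < theta) (beta01 : 0 < beta <= 1)
  (delta01 : 0 < delta <= 1).
Let b0 : 0 < beta. Proof. by case/andP: beta01. Qed.
Let d01 : 0 <= delta <= 1. Proof. by case/andP: delta01 => d0 ->; rewrite ltW. Qed.
Let ax : `|x| = x. Proof. by rewrite gtr0_norm. Qed.
Let axN : `|- x| = x. Proof. by rewrite normrN gtr0_norm. Qed.

Variables (s : R) (p : measurableTypeR R * tR).
Hypotheses (s0 : 0 <= s) (ths : theta <= t - s)
  (bp : box delta (delta + beta^-1) beta^-1 p).

Let C := HKcst x y t theta.
Let W := gaussT (rate t) p.

Let zitv : (beta * (p.1 - delta)) ^+ 2 <= 1.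
Proof.
have /andP[/andP[d1 d2] _] := bp.
have z0 : 0 <= beta * (p.1 - delta) by rewrite mulr_ge0 ?(ltW b0)// subr_ge0.
rewrite expr_le1//.
by rewrite -ler_pdivlMl// mulr1 lerBlDl.
Qed.

Lemma cube_itv i : (beta * vec p.2 0 i) ^+ 2 <= 1.
Proof.
have /andP[_ /forallP/(_ i)] := bp; rewrite mxE => h.
rewrite exprMn -(@ler_pdivlMl _ (beta ^+ 2)) ?exprn_gt0// mulr1 -exprVn.
exact: sqr_between1.
Qed.

Let cz : 0 <= cutoff beta (p.1 - delta) <= 1.
Proof. exact: (cutoff_itv zitv). Qed.
Let cs : 0 <= cutoffs beta (vec p.2) <= 1.
Proof. by apply: prod_itv01 => i _; apply: cutoff_itv; exact: cube_itv. Qed.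
Let cs' i : 0 <= cutoffs' beta i (vec p.2) <= 1.
Proof. by apply: prod_itv01 => j _; apply: cutoff_itv; exact: cube_itv. Qed.

Let mul01 a b : 0 <= a <= 1 -> `|a * b| <= `|b| :> R.
Proof. by move=> /andP[a0 a1]; rewrite normrM ger0_norm// ler_piMl. Qed.

Let nHK c a xi eta : `|c * HK y t a xi eta s| = `|c| * HK y t a xi eta s.
Proof. by rewrite normrM [X in _ * X]ger0_norm// HK_ge0. Qed.

Lemma Phi_bound : `|Phi x y t beta delta p.1 (vec p.2) s| <= 2 * C * W.
Proof.
have h1 := HK_bound0 y th0 p ax d01 s0 ths.
have h2 := HK_bound0 y th0 p axN d01 s0 ths.
rewrite /Phi -mulrA; apply: (le_trans (mul01 _ cz)); apply: (le_trans (mul01 _ cs)).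
apply: (le_trans (ler_normB _ _)); rewrite !ger0_norm ?HK_ge0//.
by rewrite -/C -/W in h1 h2 *; lra.
Qed.

(** Each of the 1 + m terms of [Err] contains a derivative of a cutoff, hence a
    factor [beta], times one linear factor, which the Gaussian absorbs. *)
Lemma Err_bound : `|Err x y t beta delta p.1 (vec p.2) s| <=
  beta * ((16 + 4 / theta) * (2 + 2 * m%:R) * C) * W.
Proof.
have key a i w : `|a| = x -> `|errc beta i (t - s) w| <= beta * (16 + 4 / theta) * (1 + `|i - w|) ->
   (i - w) ^+ 2 <= (a - (p.1 - delta)) ^+ 2 + sqnorm (y - vec p.2) ->
   `|errc beta i (t - s) w| * HK y t a (p.1 - delta) (vec p.2) s <=
    beta * (16 + 4 / theta) * (C * W).
  move=> aa he hw; apply: (le_trans (ler_wpM2r (HK_ge0 _ _ _ _ _ _) he)).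
  rewrite -[leLHS]mulrA ler_wpM2l//; last exact: (HK_bound th0 aa d01 s0 ths hw).
  apply: mulr_ge0; first exact: ltW.
  by apply: addr_ge0 => //; apply: divr_ge0 => //; exact: ltW.
have kx a : `|a| = x -> `|errc beta a (t - s) (p.1 - delta)| * HK y t a (p.1 - delta) (vec p.2) s <=
    beta * (16 + 4 / theta) * (C * W).
  move=> aa; apply: key => //; first exact: errc_le.
  by rewrite lerDl sqnorm_ge0.
have ky a i : `|a| = x -> `|errc beta (y 0 i) (t - s) (vec p.2 0 i)| * HK y t a (p.1 - delta) (vec p.2) s <=
    beta * (16 + 4 / theta) * (C * W).
  move=> aa; apply: key => //; first by apply: errc_le => //; exact: cube_itv.
  rewrite ler_wpDl ?sqr_ge0// /sqnorm (bigD1 i)//= rV_subE lerDl.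
  by apply: sumr_ge0 => j _; exact: sqr_ge0.
rewrite /Err; apply: (le_trans (ler_normD _ _)).
have -> : beta * ((16 + 4 / theta) * (2 + 2 * m%:R) * C) * W =
  2 * (beta * (16 + 4 / theta) * (C * W)) +
  \sum_(i < m) 2 * (beta * (16 + 4 / theta) * (C * W)).
  by rewrite sumr_const card_ord -[RHS]/(_ + _ *+ m) -mulr_natl; ring.
apply: lerD.
  apply: (le_trans (mul01 _ cs)); apply: (le_trans (ler_normB _ _)).
  rewrite !nHK.
  have := kx _ ax; have := kx _ axN; lra.
apply: (le_trans (ler_norm_sum _ _ _)); apply: ler_sum => i _.
rewrite -[X in `|X|]mulrA -[X in `|X|]mulrA.
apply: (le_trans (mul01 _ cz)); apply: (le_trans (mul01 _ (cs' i))).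
rewrite mulrBr; apply: (le_trans (ler_normB _ _)).
rewrite !nHK.
have := ky _ i ax; have := ky _ i axN; lra.
Qed.

End test_bounds.

(** * Duality with the Green function of the half-space *)

Section gauss_products.
Context {R : realType} {m : nat}.
Notation tR := (m.-tuple (measurableTypeR R)).

Lemma gaussT_expR c e (p : measurableTypeR R * tR) :
  gaussT c p * expR (e * (p.1 ^+ 2 + sqnorm (vec p.2))) = gaussT (c - e) p.
Proof. by rewrite /gaussT -expRD mulrBl opprB addrC. Qed.

Lemma gaussT_expR_y c e (p : measurableTypeR R * tR) : 0 <= e ->
  gaussT c p * expR (e * sqnorm (vec p.2)) <= gaussT (c - e) p.
Proof.
move=> e0; rewrite -gaussT_expR ler_wpM2l ?expR_ge0// ler_expR ler_wpM2l//.
by rewrite lerDr sqr_ge0.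
Qed.

Lemma gausst_expR c e (w : tR) :
  gausst c w * expR (e * sqnorm (vec w)) = gausst (c - e) w.
Proof. by rewrite /gausst -expRD mulrBl opprB addrC. Qed.

Lemma gaussT0 c (w : tR) : gaussT c ((0 : measurableTypeR R), w) = gausst c w.
Proof. by rewrite /gaussT /gausst /= expr0n add0r. Qed.

(** Integrals over D are integrals over the whole space of functions extended
    by zero, which have a fixed domain under limits. *)
Definition onhalf (g : R -> 'rV[R]_m -> R) (p : measurableTypeR R * tR) : R :=
  if 0 < p.1 then g p.1 (vec p.2) else 0.

End gauss_products.

Section sequences.
Context {R : realType}.

(** The common value of the parameters [beta] and [delta], and later of [x], in
    the limits below. *)
Definition eps_ (k : nat) : R := k.+1%:R^-1.

Lemma eps_gt0 k : 0 < eps_ k. Proof. by rewrite invr_gt0. Qed.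
Lemma eps_le1 k : eps_ k <= 1. Proof. by rewrite invf_le1// ler1n. Qed.
Lemma cvg_eps : eps_ k @[k --> \oo] --> (0 : R). Proof. exact: cvg_harmonic. Qed.

Lemma near_natr (M : R) : \forall k \near \oo, M <= k.+1%:R.
Proof.
by near=> k; rewrite (@le_trans _ _ k%:R) ?ler_nat//; near: k; exact: nbhs_infty_ger.
Unshelve. all: by end_near. Qed.

Lemma eps_bound k : 0 < eps_ k <= 1.
Proof. by rewrite eps_gt0 eps_le1. Qed.

End sequences.

Section duality.
Context {R : realType} {m : nat}.
Local Notation leb := (@lebesgue_measure R).
Local Notation lebt m := (@lebesgue_tuple R m).
Notation tR := (m.-tuple (measurableTypeR R)).
Variables (u : R -> 'rV[R]_m -> R -> R) (f : 'rV[R]_m -> R -> R).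
Hypothesis ureg : classical_regularity u.
Hypothesis ueq : forall xi eta s, 0 < xi -> 0 < s ->
  dt u xi eta s - laplacian u xi eta s = - f eta s.
Hypothesis ugrowth : subgaussian_solution u.
Hypothesis fgrowth : subgaussian_source f.
Hypothesis ubdry : forall eta s, 0 < s -> u (eps_ k) eta s @[k --> \oo] --> (0 : R).

Variables (x : R) (y : 'rV[R]_m) (t : R).
Hypotheses (x0 : 0 < x) (t0 : 0 < t).

(** The Green function of the half-space, by the method of images. *)
Definition Gk xi eta s : R := HK y t x xi eta s - HK y t (- x) xi eta s.
Definition Gint_u s : R := \int[@lebT R m]_p onhalf (fun xi eta => Gk xi eta s * u xi eta s) p.
Definition Gint_f s : R := \int[@lebT R m]_p onhalf (fun xi eta => Gk xi eta s * f eta s) p.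

Let rate_gt0 : 0 < rate t. Proof. by rewrite invr_gt0 mulr_gt0. Qed.
Let e := rate t / 2.
Let e0 : 0 < e. Proof. by rewrite divr_gt0. Qed.
Let ee : rate t - e = e. Proof. by rewrite /e; field. Qed.

(** Growth at half the rate of the Gaussian majorant of the kernel, so that
    kernel times [u] keeps the other half and remains integrable. *)
Definition ugrowth_at A := forall xi eta s, 0 < xi -> 0 < s <= t ->
  `|u xi eta s| <= A * expR (e * (xi ^+ 2 + sqnorm eta)).

Definition fgrowth_at A := forall eta s, 0 < s <= t ->
  `|f eta s| <= A * expR (e * sqnorm eta).

Lemma ugrowth_rate : exists2 A, 0 <= A & ugrowth_at A.
Proof.
have [A hA] := ugrowth t0 e0; exists `|A| => // xi eta s xi0 st.
by apply: (le_trans (hA _ _ _ xi0 st)); rewrite ler_wpM2r ?expR_ge0// ler_norm.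
Qed.

Lemma fgrowth_rate : exists2 A, 0 <= A & fgrowth_at A.
Proof.
have [A hA] := fgrowth t0 e0; exists `|A| => // eta s st.
by apply: (le_trans (hA _ _ st)); rewrite ler_wpM2r ?expR_ge0// ler_norm.
Qed.

Local Notation kbox k := (box (eps_ k) (eps_ k + (eps_ k)^-1) (eps_ k)^-1).

(** The boxes exhaust the open half-space. *)
Lemma box_ev (p : measurableTypeR R * tR) : 0 < p.1 -> \forall k \near \oo, kbox k p.
Proof.
move=> p0.
have h1 : \forall k \near \oo, eps_ k <= p.1.
  exact: (cvgr_le _ (@cvg_eps R) _ p0).
have h2 := near_natr (p.1 : R).
have h3 : \forall k \near \oo, forall i : 'I_m, `|tnth p.2 i : R| <= k.+1%:R.
  by apply: filter_forall => i; exact: near_natr.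
apply: filterS3 h1 h2 h3 => k h1 h2 h3.
rewrite /box h1 /eps_ invrK (le_trans h2) ?lerDr ?invr_ge0//=.
by apply/forallP => i; rewrite -ler_norml.
Qed.

Lemma cutoff_cvg (z : nat -> R) (l : R) : z k @[k --> \oo] --> l ->
  cutoff (eps_ k) (z k) @[k --> \oo] --> (1 : R).
Proof.
move=> zl; rewrite [X in _ --> X](_ : 1 = (1 - (0 * l) * (0 * l)) * (1 - (0 * l) * (0 * l))); last by ring.
have h : eps_ k * z k @[k --> \oo] --> 0 * l by apply: cvgM => //; exact: cvg_eps.
under eq_fun do rewrite /cutoff !expr2.
have h2 : 1 - eps_ k * z k * (eps_ k * z k) @[k --> \oo] --> 1 - (0 * l) * (0 * l).
  by apply: cvgB; [exact: cvg_cst|exact: cvgM].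
exact: cvgM.
Qed.

Lemma HK_cvg a (p : measurableTypeR R * tR) s (d : nat -> R) : s < t ->
  d k @[k --> \oo] --> (0 : R) ->
  HK y t a (p.1 - d k) (vec p.2) s @[k --> \oo] --> HK y t a p.1 (vec p.2) s.
Proof.
move=> st d0; have q0 : t - s != 0 by rewrite subr_eq0 gt_eqF.
rewrite HK_x; under eq_fun do rewrite HK_x.
apply: cvgM; first exact: cvg_cst.
have c : p.1 - d k @[k --> \oo] --> (p.1 : R).
  by rewrite -[X in _ --> X]subr0; apply: cvgB => //; exact: cvg_cst.
exact: (cvg_comp _ _ c (hasder_continuous (hasder_bell a _ q0))).
Qed.

Lemma Phi_cvg (p : measurableTypeR R * tR) s : s < t ->
  Phi x y t (eps_ k) (eps_ k) p.1 (vec p.2) s @[k --> \oo] --> Gk p.1 (vec p.2) s.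
Proof.
move=> st; rewrite -[X in _ --> X]mul1r; apply: cvgM; last first.
  by apply: cvgB; apply: HK_cvg => //; exact: cvg_eps.
rewrite -[X in _ --> X]mulr1; apply: cvgM.
  apply: (@cutoff_cvg _ (p.1 - 0)); apply: cvgB; [exact: cvg_cst|exact: cvg_eps].
rewrite -[X in _ --> X](@big1 _ 1 *%R _ (index_enum 'I_m) xpredT (fun=> 1))//.
apply: cvg_big => [|i _]; first exact: mul_continuous.
exact: (cutoff_cvg (cvg_cst _)).
Qed.

Section interval.
Variables (s1 s2 : R).
Hypotheses (s10 : 0 < s1) (s12 : s1 < s2) (s2t : s2 < t).
Let theta := t - s2.
Let th0 : 0 < theta. Proof. by rewrite subr_gt0. Qed.
Let C := HKcst x y t theta.
Let C0 : 0 <= C. Proof. exact: HKcst_ge0. Qed.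

Let cutbulk k := cutbox (eps_ k) (eps_ k + (eps_ k)^-1) (eps_ k)^-1
  (bulk u f x y t (eps_ k) (eps_ k)).
Let cutPhi_u k := cutbox (eps_ k) (eps_ k + (eps_ k)^-1) (eps_ k)^-1
  (Phi_u u x y t (eps_ k) (eps_ k)).
Let bdry k s (w : tR) := cutcube (eps_ k)^-1
  (fun eta => Phix0 x y t (eps_ k) eta s * u (eps_ k) eta s) w.

Section fixed_time.
Variable s : R.
Hypothesis hs : s1 <= s <= s2.
Let s0 : 0 < s. Proof. by case/andP: hs => h _; exact: lt_le_trans h. Qed.
Let st : s < t. Proof. by case/andP: hs => _ h; exact: le_lt_trans s2t. Qed.
Let s0t : 0 < s <= t. Proof. by rewrite s0 ltW. Qed.
Let ths : theta <= t - s. Proof. by rewrite lerB//; case/andP: hs. Qed.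
Let s0' : 0 <= s. Proof. exact: ltW. Qed.

Lemma cutPhi_u_bound : exists2 D, 0 <= D & forall k p, `|cutPhi_u k s p| <= D * gaussT e p.
Proof.
have [A A0 hA] := ugrowth_rate; have CA0 : 0 <= 2 * C * A.
  by apply: mulr_ge0 => //; apply: mulr_ge0.
exists (2 * C * A) => // k p.
rewrite /cutPhi_u /cutbox; case: ifPn => bp; last first.
  by rewrite normr0; apply: mulr_ge0 => //; exact: expR_ge0.
have p0 : 0 < p.1 by case/andP: bp => /andP[h _] _; exact: lt_le_trans (eps_gt0 k) h.
rewrite /Phi_u/= normrM -ee -gaussT_expR mulrACA.
apply: ler_pM => //; last exact: hA.
exact: (Phi_bound y x0 th0 (eps_bound k) (eps_bound k) s0' ths bp).
Qed.

Lemma cutPhi_u_cvg p : cutPhi_u k s p @[k --> \oo] -->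
  onhalf (fun xi eta => Gk xi eta s * u xi eta s) p.
Proof.
rewrite /onhalf; case: ifPn => p0; last first.
  apply: cvg_near_cst; near=> k; rewrite /cutPhi_u /cutbox ifF//.
  apply/negP => /andP[/andP[h _] _]; move/negP: p0; apply.
  exact: lt_le_trans (eps_gt0 k) h.
have c : Phi x y t (eps_ k) (eps_ k) p.1 (vec p.2) s * u p.1 (vec p.2) s
   @[k --> \oo] --> Gk p.1 (vec p.2) s * u p.1 (vec p.2) s.
  by apply: cvgM; [exact: Phi_cvg|exact: cvg_cst].
apply: cvg_trans c; apply: near_eq_cvg.
have := box_ev p0; apply: filterS => k bk.
by rewrite /cutPhi_u /cutbox bk.
Unshelve. all: by end_near. Qed.

Lemma measurable_cutPhi_u k : measurable_fun setT (cutPhi_u k s).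
Proof.
apply: (measurable_cutbox (s1 := s1) (s2 := s2)) => //.
exact: (cb_Phi_u ureg (eps_gt0 k) s10 s2t).
Qed.

Lemma Rintegral_cutPhi_u_cvg : summable_fun (@lebT R m)
    (onhalf (fun xi eta => Gk xi eta s * u xi eta s)) /\
  \int[@lebT R m]_p cutPhi_u k s p @[k --> \oo] --> Gint_u s.
Proof.
have [D D0 hD] := cutPhi_u_bound.
apply: (@cvg_Rintegral _ _ _ (@lebT R m) (fun k => cutPhi_u k s) _ (fun p => D * gaussT e p)).
- exact: measurable_cutPhi_u.
- exact: cutPhi_u_cvg.
- by apply: summable_scale; exact: summable_gaussT.
- exact: hD.
Qed.

Lemma Gint_u_summable : summable_fun (@lebT R m)
  (onhalf (fun xi eta => Gk xi eta s * u xi eta s)).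
Proof. exact: Rintegral_cutPhi_u_cvg.1. Qed.

Lemma cutbulk_cvg p : cutbulk k s p @[k --> \oo] -->
  - onhalf (fun xi eta => Gk xi eta s * f eta s) p.
Proof.
rewrite /onhalf; case: ifPn => p0; last first.
  rewrite oppr0; apply: cvg_near_cst; near=> k; rewrite /cutbulk /cutbox ifF//.
  apply/negP => /andP[/andP[h _] _]; move/negP: p0; apply.
  exact: lt_le_trans (eps_gt0 k) h.
have c : Phi x y t (eps_ k) (eps_ k) p.1 (vec p.2) s * f (vec p.2) s
   @[k --> \oo] --> Gk p.1 (vec p.2) s * f (vec p.2) s.
  by apply: cvgM; [exact: Phi_cvg|exact: cvg_cst].
have c2 : Err x y t (eps_ k) (eps_ k) p.1 (vec p.2) s * u p.1 (vec p.2) s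
   @[k --> \oo] --> (0 : R).
  rewrite -[X in _ --> X](mul0r (u p.1 (vec p.2) s)); apply: cvgM; last exact: cvg_cst.
  pose M := (16 + 4 / theta) * (2 + 2 * m%:R) * C * gaussT (rate t) p.
  apply/norm_cvg0P.
  have cM : eps_ k * M @[k --> \oo] --> 0 * M.
    by apply: cvgM; [exact: cvg_eps|exact: cvg_cst].
  rewrite mul0r in cM.
  have sq : \forall k \near \oo,
      (cst 0 : nat -> R) k <= `|Err x y t (eps_ k) (eps_ k) p.1 (vec p.2) s| <= eps_ k * M.
    have := box_ev p0; apply: filterS => k bk; rewrite normr_ge0/=.
    have := Err_bound y x0 th0 (eps_bound k) (eps_bound k) s0' ths bk.
    by rewrite -mulrA.
  exact: (squeeze_cvgr sq (cvg_cst 0) cM).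
have c3 : Err x y t (eps_ k) (eps_ k) p.1 (vec p.2) s * u p.1 (vec p.2) s -
    Phi x y t (eps_ k) (eps_ k) p.1 (vec p.2) s * f (vec p.2) s
    @[k --> \oo] --> - (Gk p.1 (vec p.2) s * f (vec p.2) s).
  by rewrite -[X in _ --> X]sub0r; exact: cvgB.
apply: cvg_trans c3; apply: near_eq_cvg.
have := box_ev p0; apply: filterS => k bk.
by rewrite /cutbulk /cutbox bk.
Unshelve. all: by end_near. Qed.

Let M := (16 + 4 / theta) * (2 + 2 * m%:R) * C.
Lemma cutbulk_bound A B : 0 <= A -> 0 <= B -> ugrowth_at A -> fgrowth_at B ->
  forall k p, `|cutbulk k s p| <= (M * A + 2 * C * B) * gaussT e p.
Proof.
move=> A0 B0 hA hB.
have M0 : 0 <= M.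
  apply: mulr_ge0 => //; apply: mulr_ge0; last by rewrite addr_ge0// mulr_ge0.
  by rewrite addr_ge0// divr_ge0// ltW.
have D0 : 0 <= M * A + 2 * C * B.
  by apply: addr_ge0; apply: mulr_ge0 => //; apply: mulr_ge0.
move=> k p.
rewrite /cutbulk /cutbox; case: ifPn => bp; last first.
  by rewrite normr0; apply: mulr_ge0 => //; exact: expR_ge0.
have p0 : 0 < p.1 by case/andP: bp => /andP[h _] _; exact: lt_le_trans (eps_gt0 k) h.
rewrite /bulk/=; apply: (le_trans (ler_normB _ _)); rewrite [leRHS]mulrDl; apply: lerD.
  rewrite normrM -ee -gaussT_expR mulrACA.
  apply: ler_pM => //; last exact: hA.
  apply: (le_trans (Err_bound y x0 th0 (eps_bound k) (eps_bound k) s0' ths bp)).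
  rewrite ler_wpM2r ?expR_ge0// -/C -/M ler_piMl// eps_le1//.
rewrite normrM.
have h1 := Phi_bound y x0 th0 (eps_bound k) (eps_bound k) s0' ths bp.
have h2 := hB (vec p.2) s s0t.
apply: (le_trans (ler_pM (normr_ge0 _) (normr_ge0 _) h1 h2)).
rewrite -/C mulrACA ler_wpM2l//; first by apply: mulr_ge0 => //; apply: mulr_ge0.
by rewrite -[X in _ <= gaussT X _]ee; apply: gaussT_expR_y; exact: ltW.
Qed.

Lemma measurable_cutbulk k : measurable_fun setT (cutbulk k s).
Proof.
apply: (measurable_cutbox (s1 := s1) (s2 := s2)) => //.
exact: (cb_bulk ureg ueq (eps_gt0 k) s10 s2t).
Qed.

Lemma Rintegral_cutbulk_cvg :
  summable_fun (@lebT R m) (fun p => - onhalf (fun xi eta => Gk xi eta s * f eta s) p) /\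
  \int[@lebT R m]_p cutbulk k s p @[k --> \oo] -->
  \int[@lebT R m]_p - onhalf (fun xi eta => Gk xi eta s * f eta s) p.
Proof.
have [A A0 hA] := ugrowth_rate; have [B B0 hB] := fgrowth_rate.
have hD := cutbulk_bound A0 B0 hA hB; set D := (_ + _) in hD.
apply: (@cvg_Rintegral _ _ _ (@lebT R m) (fun k => cutbulk k s) _ (fun p => D * gaussT e p)).
- exact: measurable_cutbulk.
- exact: cutbulk_cvg.
- by apply: summable_scale; exact: summable_gaussT.
- exact: hD.
Qed.

Lemma Gint_f_summable : summable_fun (@lebT R m) (onhalf (fun xi eta => Gk xi eta s * f eta s)).
Proof.
have [h _] := Rintegral_cutbulk_cvg.
have := summable_scale (-1) h; congr (is_true (summable_fun _ _)).
by apply/funext => p; rewrite mulN1r opprK.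
Qed.

Lemma Rintegral_cutbulk : \int[@lebT R m]_p cutbulk k s p @[k --> \oo] --> - Gint_f s.
Proof.
have [_] := Rintegral_cutbulk_cvg.
rewrite [X in _ --> X -> _](_ : _ = - Gint_f s)//.
rewrite /Gint_f -mulN1r -(Rintegral_scale _ Gint_f_summable).
by apply: eq_Rintegral => p _; rewrite mulN1r.
Qed.

(** The integrand is the slice at xi = delta of a function that is continuous
    on the box. *)
Lemma measurable_bdry k : measurable_fun setT (bdry k s).
Proof.
rewrite /bdry; set d := eps_ k; have d0 : 0 < d := eps_gt0 k.
pose g (p : R * 'rV[R]_m * R) := cutoffs d p.1.2 * (x / (t - p.2)) *
  HK y t x (p.1.1 - d) p.1.2 p.2 * u p.1.1 p.1.2 p.2.
have cg : cont_on_box d (d + d^-1) d^-1 s1 s2 g.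
  move=> z w r bz hr.
  have rt : r < t by case/andP: hr => _; move/le_lt_trans; apply.
  have z0 : 0 < z by case/andP: bz => /andP[h _] _; exact: lt_le_trans h.
  have r0 : 0 < r by case/andP: hr => h _; exact: lt_le_trans h.
  have q0 : t - r != 0 by rewrite subr_eq0 gt_eqF.
  have [cu _ _ _] := ureg (vec w) z0 r0.
  apply: cont_mul => //; apply: cont_mul; last exact: cont_HK.
  apply: cont_mul; first exact: cont_cutoffs.
  by apply: cont_mul; [exact: cont_cst|apply: cont_inv => //; exact: cont_q].
have := measurable_slice1 (measurable_cutbox cg hs) d.
congr measurable_fun; apply/funext => w.
rewrite /cutcube /cutbox /box/= lexx lerDl invr_ge0 (ltW d0)/=.
by case: ifP => // _; rewrite /g/= /Phix0 /HK subrr subr0.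
Qed.

Lemma bdry_bound A : 0 <= A -> ugrowth_at A ->
  forall k w, `|bdry k s w| <= x / theta * C * (A * expR e) * gausst e w.
Proof.
move=> A0 hA.
have D0 : 0 <= x / theta * C * (A * expR e).
  by apply: mulr_ge0; apply: mulr_ge0 => //; rewrite ?expR_ge0// divr_ge0// ltW.
move=> k w.
rewrite /bdry /cutcube; case: ifPn => cw; last first.
  by rewrite normr0; apply: mulr_ge0 => //; exact: expR_ge0.
have bw : kbox k ((eps_ k : measurableTypeR R), w).
  by rewrite /box/= lexx lerDl invr_ge0 (ltW (eps_gt0 k)).
have c01 : 0 <= cutoffs (eps_ k) (vec w) <= 1.
  apply: prod_itv01 => i _; apply: cutoff_itv.
  exact: (cube_itv (eps_bound k) bw).
rewrite normrM -[X in gausst X _]ee -gausst_expR mulrACA -[A * _ * _]mulrA.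
have h1 : `|Phix0 x y t (eps_ k) (vec w) s| <= x / theta * C * gausst (rate t) w.
  have h := @HK_bound0 _ _ x y t theta th0 x 0 s ((0 : measurableTypeR R), w).
  rewrite gtr0_norm// lexx ler01 in h; have {}h := h erefl isT s0' ths.
  rewrite gaussT0 /= subr0 /HK subr0 in h.
  have q0 : 0 < t - s by exact: lt_le_trans ths.
  have c0 : 0 <= cutoffs (eps_ k) (vec w) by case/andP: c01.
  have xq : 0 <= x / (t - s) by rewrite divr_ge0// ltW.
  rewrite /Phix0 ger0_norm; last first.
    by apply: mulr_ge0; [exact: mulr_ge0|exact: hk_ge0].
  rewrite -[leRHS]mulrA; have hk0 := hk_ge0 m.+1 (x ^+ 2 + sqnorm (y - vec w)) (t - s).
  set H := hk _ _ _ in h hk0 *.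
  apply: (@le_trans _ _ (x / (t - s) * H)).
    rewrite -mulrA -[leRHS]mul1r ler_wpM2r//; first exact: mulr_ge0.
    by case/andP: c01.
  apply: ler_pM => //.
  by rewrite ler_wpM2l ?(ltW x0)// lef_pV2 ?posrE.
apply: ler_pM => //.
apply: (le_trans (hA _ _ _ (eps_gt0 k) s0t)); rewrite ler_wpM2l// mulrDr expRD.
rewrite ler_wpM2r ?expR_ge0// ler_expR ger_pMr// expr_le1// ?eps_le1//.
exact/ltW/eps_gt0.
Qed.

Lemma bdry_cvg w : bdry k s w @[k --> \oo] --> (0 : R).
Proof.
pose P := x / (t - s) * hk m.+1 (x ^+ 2 + sqnorm (y - vec w)) (t - s).
have c : cutoffs (eps_ k) (vec w) * P * u (eps_ k) (vec w) s @[k --> \oo] -->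
    1 * P * 0.
  apply: cvgM; last exact: ubdry.
  apply: cvgM; last exact: cvg_cst.
  rewrite -[X in _ --> X](@big1 _ 1 *%R _ (index_enum 'I_m) xpredT (fun=> 1))//.
  apply: cvg_big => [|i _]; first exact: mul_continuous.
  exact: (cutoff_cvg (cvg_cst _)).
rewrite mulr0 in c; apply: cvg_trans c; apply: near_eq_cvg.
have := box_ev (p := ((1 : measurableTypeR R), w)) ltr01.
apply: filterS => k /andP[_ ck].
by rewrite /bdry /cutcube ck /Phix0 /P mulrA.
Qed.

Lemma Rintegral_bdry : \int[lebt m]_w bdry k s w @[k --> \oo] --> (0 : R).
Proof.
have [A A0 hA] := ugrowth_rate.
have hD := bdry_bound A0 hA; set D := _ * (_ * _) in hD.
have [||||_] := @cvg_Rintegral _ _ _ (lebt m) (fun k => bdry k s) (fun=> 0) (fun p => D * gausst e p).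
- exact: measurable_bdry.
- exact: bdry_cvg.
- by apply: summable_scale; exact: summable_gausst.
- exact: hD.
by rewrite Rintegral0.
Qed.

End fixed_time.

(** The bounds at a fixed time depend on [s] only through s2 < t, so one
    constant serves the whole interval [s1, s2]. *)
Lemma Gtime_bound : exists K, forall k s,
  `|Gtime u x y t (eps_ k) (eps_ k) s1 s2 s| <= K * (if s1 <= s <= s2 then 1 else 0).
Proof.
have [A A0 hA] := ugrowth_rate; have [B B0 hB] := fgrowth_rate.
eexists => k s; rewrite /Gtime; case: ifPn => hs; last by rewrite normr0 mulr0.
rewrite mulr1 (Rintegral_dt_Phi_u ureg ueq x y (eps_gt0 k) (eps_gt0 k) s10 s2t hs).
apply: (le_trans (ler_normD _ _)); apply: lerD.
  apply: (Rintegral_le_norm _ _ (cutbulk_bound hs A0 B0 hA hB k)).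
    apply: (summable_cutbox (s1 := s1) (s2 := s2)) => //.
    exact: (cb_bulk ureg ueq (eps_gt0 k) s10 s2t).
  by apply: summable_scale; exact: summable_gaussT.
have sg : summable_fun (lebt m) (fun w => x / theta * C * (A * expR e) * gausst e w).
  by apply: summable_scale; exact: summable_gausst.
apply: (Rintegral_le_norm _ sg (bdry_bound hs A0 hA k)).
exact: (summable_le (measurable_bdry hs k) sg (bdry_bound hs A0 hA k)).
Qed.

(** The limit k to infinity of [core_time] for beta = delta = 1/(k+1): the error
    and the boundary term disappear and the test function becomes the Green
    function. *)
Lemma duality :
  summable_fun leb (fun s => if s1 <= s <= s2 then Gint_f s else 0) /\
  Gint_u s2 - Gint_u s1 = - \int[leb]_s (if s1 <= s <= s2 then Gint_f s else 0).
Proof.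
have [K hK] := Gtime_bound.
have ct k := core_time ureg x y (eps_ k) (eps_gt0 k) s10 s12 s2t.
have s1s : s1 <= s1 <= s2 by rewrite lexx ltW.
have s2s : s1 <= s2 <= s2 by rewrite lexx ltW.
pose J s : R := if s1 <= s <= s2 then 1 else 0.
have sJ : summable_fun leb J.
  have := @integrable_indic_itv R s1 s2 true false.
  apply: eq_integrable => // s _ /=.
  by rewrite indicE mem_setE in_itv /J /=; case: ifP.
have [||||sg cg] := @cvg_Rintegral _ _ _ leb
  (fun k => Gtime u x y t (eps_ k) (eps_ k) s1 s2)
  (fun s => if s1 <= s <= s2 then - Gint_f s else 0) (fun s => K * J s).
- by move=> k; apply: summable_measurable; exact: (ct k).1.
- move=> s; rewrite /Gtime; case: ifPn => hs; last exact: cvg_cst.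
  have c : \int[@lebT R m]_p cutbulk k s p + \int[lebt m]_w bdry k s w @[k --> \oo] --> - Gint_f s + 0.
    by apply: cvgD; [exact: Rintegral_cutbulk|exact: Rintegral_bdry].
  rewrite addr0 in c; apply: cvg_trans c; apply: near_eq_cvg; apply: nearW => k.
  by rewrite (Rintegral_dt_Phi_u ureg ueq x y (eps_gt0 k) (eps_gt0 k) s10 s2t hs).
- exact: summable_scale.
- exact: hK.
have E : (fun s => if s1 <= s <= s2 then Gint_f s else 0) =
    fun s => -1 * (if s1 <= s <= s2 then - Gint_f s else 0).
  by apply/funext => s; case: ifP => _; rewrite ?mulr0// mulN1r opprK.
split; first by rewrite E; exact: summable_scale.
have cI : \int[@lebT R m]_p cutPhi_u k s2 p - \int[@lebT R m]_p cutPhi_u k s1 p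
    @[k --> \oo] --> Gint_u s2 - Gint_u s1.
  have [_ l1] := Rintegral_cutPhi_u_cvg s1s; have [_ l2] := Rintegral_cutPhi_u_cvg s2s.
  exact: cvgB.
have cI' : \int[leb]_s Gtime u x y t (eps_ k) (eps_ k) s1 s2 s @[k --> \oo] --> Gint_u s2 - Gint_u s1.
  apply: cvg_trans cI; apply: near_eq_cvg; apply: nearW => k.
  exact: (ct k).2.
rewrite E (Rintegral_scale (-1) sg) mulN1r opprK.
exact: (cvg_unique _ cI' cg).
Qed.

End interval.
End duality.

(** * Rescaled Gaussian averages and the error function *)

Section reflection.
Context {R : realType}.
Local Notation leb := (@lebesgue_measure R).

Lemma scales_opp : scales leb (fun z : measurableTypeR R => - z) 1.
Proof.
have mopp : measurable_fun setT (fun z : measurableTypeR R => (- z : measurableTypeR R)).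
  exact: measurableT_comp.
split=> // f mf f0; rewrite mul1e.
pose pf : {measure set (measurableTypeR R) -> \bar R} :=
  measure_function_pushforward__canonical__measure_function_Measure leb mopp.
rewrite (eq_measure_integral pf); first by rewrite ge0_integral_pushforward.
by move=> A mA _; exact/esym/lebesgue_measureN.
Qed.

End reflection.

Section gaussian_averages.
Context {R : realType} {m : nat}.
Local Notation leb := (@lebesgue_measure R).
Local Notation lebt m := (@lebesgue_tuple R m).
Notation tR := (m.-tuple (measurableTypeR R)).
Variables (y : 'rV[R]_m) (q : R).
Hypothesis q0 : 0 < q.

(** The dilation z |-> sigma z + a turns the heat kernel at time [q] with pole
    [a] into a fixed Gaussian: (sigma z)^2 / (4 q) = z^2. *)
Definition sigma : R := 2 * Num.sqrt q.
Lemma sigma_gt0 : 0 < sigma. Proof. by rewrite mulr_gt0// sqrtr_gt0. Qed.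
Lemma sigma_sq : sigma ^+ 2 = 4 * q.
Proof. by rewrite exprMn sqr_sqrtr ?ltW//; congr (_ * _); rewrite -natrX. Qed.

Lemma hk_sigma N r :
  sigma ^+ N * hk N (sigma ^+ 2 * r) q = Num.sqrt pi ^- N * expR (- r).
Proof.
rewrite /hk sigma_sq mulrAC divff ?mul1r; last by rewrite mulf_neq0// gt_eqF.
rewrite sqrtrM ?pi_ge0// (_ : 2 * (_ * _) = Num.sqrt pi * sigma); last first.
  by rewrite /sigma; ring.
rewrite [X in _ / X]exprMn.
have A0 : Num.sqrt pi ^+ N != 0 :> R by rewrite expf_neq0// gt_eqF// sqrtr_gt0 pi_gt0.
have B0 : sigma ^+ N != 0 by rewrite expf_neq0// gt_eqF// sigma_gt0.
by move: A0 B0; set A := _ ^+ N; set B := _ ^+ N => A0 B0; field; rewrite A0 B0.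
Qed.

Definition phi1 (a : R) (z : measurableTypeR R) : measurableTypeR R := sigma * z + a.
Definition phit (w : tR) : tR := [tuple (sigma * tnth w i + y 0 i) | i < m].
Definition phiT (a : R) (p : measurableTypeR R * tR) : measurableTypeR R * tR :=
  (phi1 a p.1, phit p.2).

Lemma scales_phi1 a : scales leb (phi1 a) sigma.
Proof. exact: scales_affine sigma_gt0. Qed.

Lemma scales_phit : scales (lebt m) phit (sigma ^+ m).
Proof. exact: scales_tuple sigma_gt0. Qed.

Lemma scales_phiT a : scales (@lebT R m) (phiT a) (sigma ^+ m.+1).
Proof. by rewrite exprS; exact: scales_prod (scales_phi1 a) scales_phit. Qed.

Lemma vec_phit w : vec (phit w) = sigma *: vec w + y.
Proof. by apply/rowP => i; rewrite !mxE tnth_mktuple. Qed.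

Lemma sqnorm_phit w : sqnorm (y - vec (phit w)) = sigma ^+ 2 * sqnorm (vec w).
Proof.
rewrite vec_phit /sqnorm mulr_sumr; apply: eq_bigr => i _.
by rewrite !mxE; ring.
Qed.

Lemma sqnorm_phit_le w :
  sqnorm (vec (phit w)) <= 2 * sqnorm y + 8 * q * sqnorm (vec w).
Proof.
rewrite vec_phit (_ : 8 * q = 2 * sigma ^+ 2); last by rewrite sigma_sq; ring.
rewrite /sqnorm !mulr_sumr -big_split/=; apply: ler_sum => i _.
by rewrite !mxE; have := sqr_ge0 (sigma * tnth w i - y 0 i); nra.
Qed.

Lemma phi1_dist (a z : R) : (a - phi1 a z) ^+ 2 = sigma ^+ 2 * z ^+ 2.
Proof.
suff : (a - (sigma * z + a)) ^+ 2 = sigma ^+ 2 * z ^+ 2 by [].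
by ring.
Qed.

Lemma phi1_sq_le a z : phi1 a z ^+ 2 <= 2 * a ^+ 2 + 8 * q * z ^+ 2.
Proof.
rewrite (_ : 8 * q = 2 * sigma ^+ 2); last by rewrite sigma_sq; ring.
by rewrite /phi1; have := sqr_ge0 (sigma * z - a); nra.
Qed.

Let sN N : 0 < sigma ^+ N. Proof. by rewrite exprn_gt0// sigma_gt0. Qed.

Lemma hk_average1 a (g : measurableTypeR R -> R) : measurable_fun setT g ->
  summable_fun leb (fun z => gauss1 1 z * g (phi1 a z)) ->
  summable_fun leb (fun z => hk 1 ((a - z) ^+ 2) q * g z) /\
  \int[leb]_z (hk 1 ((a - z) ^+ 2) q * g z) =
    (Num.sqrt pi)^-1 * \int[leb]_z (gauss1 1 z * g (phi1 a z)).
Proof.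
move=> mg sg.
have E : (fun z => hk 1 ((a - z) ^+ 2) q * g z) \o phi1 a =
    fun z => (sigma^-1 * (Num.sqrt pi)^-1) * (gauss1 1 z * g (phi1 a z)).
  apply/funext => z /=; rewrite mulrA; congr (_ * _).
  have := hk_sigma 1 (z ^+ 2); rewrite !expr1 => h.
  rewrite -mulrA /gauss1 mul1r -h mulrA mulVf ?mul1r; last by rewrite gt_eqF// sigma_gt0.
  by rewrite phi1_dist.
have mh : measurable_fun setT (fun z : measurableTypeR R => hk 1 ((a - z) ^+ 2) q * g z).
  apply: measurable_funM => //; apply: measurable_funM => //.
  apply: measurableT_comp => //; apply: measurableT_comp => //.
  apply: measurable_funM => //; apply: measurable_funX.
  exact: measurable_funB.
have sE : summable_fun leb ((fun z => hk 1 ((a - z) ^+ 2) q * g z) \o phi1 a).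
  by rewrite E; exact: summable_scale.
split; first exact: (scales_summable (scales_phi1 a) sigma_gt0).
rewrite (scales_Rintegral (scales_phi1 a) sigma_gt0 mh sE).
rewrite [X in _ * X](_ : _ = \int[leb]_z ((sigma^-1 * (Num.sqrt pi)^-1) * (gauss1 1 z * g (phi1 a z)))).
  by rewrite Rintegral_scale// !mulrA divff ?mul1r// gt_eqF// sigma_gt0.
by apply: eq_Rintegral => z _; exact: (congr1 (fun h => h z) E).
Qed.

Lemma measurable_hk_t N : measurable_fun setT (fun w : tR => hk N (sqnorm (y - vec w)) q).
Proof.
apply: measurable_funM => //; apply: measurableT_comp => //; apply: measurableT_comp => //.
apply: measurable_funM => //.
rewrite (_ : (fun _ => _) = fun w : tR => \sum_(i < m) (y 0 i - tnth w i) ^+ 2).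
  apply: measurable_sum => i; apply: measurable_funX; apply: measurable_funB => //.
  exact: measurable_tnth.
by apply/funext => w; apply: eq_bigr => i _; rewrite !mxE.
Qed.

Lemma hk_averaget (g : tR -> R) : measurable_fun setT g ->
  summable_fun (lebt m) (fun w => gausst 1 w * g (phit w)) ->
  summable_fun (lebt m) (fun w => hk m (sqnorm (y - vec w)) q * g w) /\
  \int[lebt m]_w (hk m (sqnorm (y - vec w)) q * g w) =
    Num.sqrt pi ^- m * \int[lebt m]_w (gausst 1 w * g (phit w)).
Proof.
move=> mg sg.
have E : (fun w => hk m (sqnorm (y - vec w)) q * g w) \o phit =
    fun w => (sigma ^- m * Num.sqrt pi ^- m) * (gausst 1 w * g (phit w)).
  apply/funext => w /=; rewrite mulrA; congr (_ * _).
  have h := hk_sigma m (sqnorm (vec w)).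
  rewrite -mulrA /gausst mul1r -h mulrA mulVf ?mul1r; last by rewrite gt_eqF.
  by rewrite sqnorm_phit.
have mh : measurable_fun setT (fun w : tR => hk m (sqnorm (y - vec w)) q * g w).
  by apply: measurable_funM => //; exact: measurable_hk_t.
have sE : summable_fun (lebt m) ((fun w => hk m (sqnorm (y - vec w)) q * g w) \o phit).
  by rewrite E; exact: summable_scale.
split; first exact: (scales_summable scales_phit (sN m)).
rewrite (scales_Rintegral scales_phit (sN m) mh sE).
rewrite [X in _ * X](_ : _ = \int[lebt m]_w ((sigma ^- m * Num.sqrt pi ^- m) * (gausst 1 w * g (phit w)))).
  by rewrite Rintegral_scale// !mulrA divff ?mul1r// gt_eqF.
by apply: eq_Rintegral => z _; exact: (congr1 (fun h => h z) E).
Qed.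

(** In the rescaled form the weight no longer depends on [q], so limits q to 0
    are handled by dominated convergence. *)
Lemma hk_averageT a (g : measurableTypeR R * tR -> R) : measurable_fun setT g ->
  summable_fun (@lebT R m) (fun p => gaussT 1 p * g (phiT a p)) ->
  summable_fun (@lebT R m) (fun p => hk m.+1 ((a - p.1) ^+ 2 + sqnorm (y - vec p.2)) q * g p) /\
  \int[@lebT R m]_p (hk m.+1 ((a - p.1) ^+ 2 + sqnorm (y - vec p.2)) q * g p) =
    Num.sqrt pi ^- m.+1 * \int[@lebT R m]_p (gaussT 1 p * g (phiT a p)).
Proof.
move=> mg sg; set H := fun p : measurableTypeR R * tR => hk m.+1 _ q * g p.
have E : H \o phiT a =
    fun p => (sigma ^- m.+1 * Num.sqrt pi ^- m.+1) * (gaussT 1 p * g (phiT a p)).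
  apply/funext => p; rewrite /H /= mulrA; congr (_ * _).
  have h := hk_sigma m.+1 (p.1 ^+ 2 + sqnorm (vec p.2)).
  rewrite -mulrA /gaussT mul1r -h mulrA mulVf ?mul1r; last by rewrite gt_eqF.
  by rewrite phi1_dist sqnorm_phit mulrDr.
have mh : measurable_fun setT H.
  apply: measurable_funM => //.
  rewrite (_ : (fun _ => _) = fun p : measurableTypeR R * tR =>
     expR (- ((a - p.1) ^+ 2 / (4 * q))) * hk m.+1 (sqnorm (y - vec p.2)) q).
    apply: measurable_funM.
      apply: measurableT_comp => //; apply: measurableT_comp => //.
      apply: measurable_funM => //; apply: measurable_funX.
      by apply: measurable_funB => //; exact: measurable_fst.
    exact: measurableT_comp (measurable_hk_t m.+1) _.
  by apply/funext => p; rewrite addrC hkD mulrC.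
have sE : summable_fun (@lebT R m) (H \o phiT a).
  by rewrite E; exact: summable_scale.
split; first exact: (scales_summable (scales_phiT a) (sN m.+1)).
rewrite (scales_Rintegral (scales_phiT a) (sN m.+1) mh sE).
rewrite [X in _ * X](_ : _ = \int[@lebT R m]_p ((sigma ^- m.+1 * Num.sqrt pi ^- m.+1) * (gaussT 1 p * g (phiT a p)))).
  by rewrite Rintegral_scale// !mulrA divff ?mul1r// gt_eqF.
by apply: eq_Rintegral => z _; exact: (congr1 (fun h => h z) E).
Qed.

End gaussian_averages.

Section erf.
Context {R : realType}.
Local Notation leb := (@lebesgue_measure R).
Variables (x q : R).
Hypotheses (x0 : 0 < x) (q0 : 0 < q).

(** The one-dimensional factor of the Green function of the half-space. *)
Definition hk_half (z : measurableTypeR R) : R :=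
  if 0 < z then hk 1 ((x - z) ^+ 2) q - hk 1 ((- x - z) ^+ 2) q else 0.

Let pos (z : measurableTypeR R) : R := if 0 < z then 1 else 0.

Lemma measurable_if_itv (i : interval R) (g : measurableTypeR R -> R) :
  measurable_fun setT g ->
  measurable_fun setT (fun z : measurableTypeR R => if z \in i then g z else 0).
Proof.
move=> mg.
have := (measurable_restrictT g (measurable_itv i)).1 (measurable_funTS mg).
by congr measurable_fun; apply/funext => z; rewrite patchE mem_setE.
Qed.

Let mpos : measurable_fun setT pos.
Proof.
have := @measurable_if_itv `]0, +oo[ (cst 1) (measurable_cst _).
by congr measurable_fun; apply/funext => z; rewrite in_itv/= andbT.
Qed.

Lemma summable_gauss1_bounded (g : measurableTypeR R -> R) (K c : R) : 0 < c ->
  measurable_fun setT g -> (forall z, `|g z| <= K) ->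
  summable_fun leb (fun z => gauss1 c z * g z).
Proof.
move=> c0 mg gK.
apply: (@summable_le _ _ _ leb _ (fun z => K * gauss1 c z)).
- by apply: measurable_funM => //; exact: measurable_gauss1.
- by apply: summable_scale; exact: summable_gauss1.
- move=> z; rewrite normrM mulrC [X in _ * X]ger0_norm ?expR_ge0//.
  by rewrite ler_wpM2r// expR_ge0.
Qed.

Let pos1 z : `|pos z| <= 1.
Proof. by rewrite /pos; case: ifP; rewrite ?normr0 ?normr1. Qed.

(** After rescaling, the two half-lines become z > -zeta and z > zeta; their
    difference is ]-zeta, zeta], and the Gaussian is even. *)
Lemma summable_hk_half_erf : summable_fun leb hk_half /\
  \int[leb]_z hk_half z = erf (x / (2 * Num.sqrt q)).
Proof.
set zeta := x / _.
have z0 : 0 < zeta by rewrite divr_gt0// mulr_gt0// sqrtr_gt0.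
have s0 := sigma_gt0 q0.
have sp a : summable_fun leb (fun z => gauss1 1 z * pos (phi1 q a z)).
  apply: (@summable_gauss1_bounded _ 1) => //.
  have [mphi _ _] := scales_phi1 q0 a.
  exact: measurableT_comp mpos mphi.
have h a := hk_average1 q0 mpos (sp a).
have E : hk_half = fun z => hk 1 ((x - z) ^+ 2) q * pos z - hk 1 ((- x - z) ^+ 2) q * pos z.
  apply/funext => z; rewrite /hk_half /pos; case: ifP => _; first by rewrite !mulr1.
  by rewrite !mulr0 subrr.
rewrite E; split; first exact: (summable_subr (h x).1 (h (- x)).1).
rewrite (Rintegral_subr (h x).1 (h (- x)).1) (h x).2 (h (- x)).2 -mulrBr.
rewrite -(Rintegral_subr (sp x) (sp (- x))).
pose g1 (z : measurableTypeR R) : R := if z \in `]- zeta, 0] then gauss1 1 z else 0.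
pose g2 (z : measurableTypeR R) : R := if z \in `]0, zeta] then gauss1 1 z else 0.
have mg1 : measurable_fun setT g1 by apply: measurable_if_itv; exact: measurable_gauss1.
have mg2 : measurable_fun setT g2 by apply: measurable_if_itv; exact: measurable_gauss1.
have ifle (b : bool) z : `|if b then gauss1 1 z else 0 : R| <= gauss1 1 z.
  by case: b; rewrite ?normr0 ?expR_ge0// ger0_norm// expR_ge0.
have sg : summable_fun leb (gauss1 1 : R -> R) by exact: summable_gauss1.
have sg1 : summable_fun leb g1 by apply: (summable_le mg1 sg) => z; exact: ifle.
have sg2 : summable_fun leb g2 by apply: (summable_le mg2 sg) => z; exact: ifle.
have -> : \int[leb]_z (gauss1 1 z * pos (phi1 q x z) - gauss1 1 z * pos (phi1 q (- x) z)) =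
    \int[leb]_z (g1 z + g2 z).
  apply: eq_Rintegral => z _; rewrite /pos /phi1 /g1 /g2 !in_itv/=.
  have -> : (0 < sigma q * z + x) = (- zeta < z).
    by rewrite /zeta -mulNr ltr_pdivrMr// -/(sigma q) (mulrC z) -[RHS]subr_gt0 opprK.
  have -> : (0 < sigma q * z - x) = (zeta < z).
    by rewrite subr_gt0 /zeta ltr_pdivrMr// -/(sigma q) (mulrC z).
  have [zz|zz] := ltP zeta z.
    have -> : - zeta < z by rewrite (lt_trans _ zz)// (lt_trans _ z0)// oppr_lt0.
    have z1 := lt_trans z0 zz.
    by rewrite (leNgt z 0) z1 /= !mulr1 subrr addr0.
  rewrite mulr0 subr0; case: (ltP 0 z) => z1.
    have -> : - zeta < z by rewrite (lt_trans _ z1)// oppr_lt0.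
    by rewrite andbF mulr1 add0r.
  by rewrite andbT/= addr0; case: ifP; rewrite ?mulr1 ?mulr0.
rewrite (Rintegral_add sg1 sg2).
have -> : \int[leb]_z g1 z = \int[leb]_z (if z \in `[0, zeta[ then gauss1 1 z else 0).
  rewrite (@scales_Rintegral _ _ _ _ _ _ _ scales_opp ltr01 mg1); last first.
    apply: (@summable_le _ _ _ leb _ (gauss1 1 : R -> R)) => //.
      have [mo _ _] := @scales_opp R.
      exact: measurableT_comp mg1 mo.
    by move=> z; rewrite /g1/= (le_trans (ifle _ _))// /gauss1 sqrrN.
  rewrite mul1r; apply: eq_Rintegral => z _; rewrite /g1 !in_itv/= /gauss1 sqrrN.
  by rewrite ltrN2 oppr_le0 andbC.
have e1 : \int[leb]_z (if z \in `[0, zeta[ then gauss1 1 z else 0) =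
    \int[leb]_(z in `[0, zeta]) gauss1 1 z.
  rewrite -Rintegral_itv_bndo_bndc; last first.
    by apply: (integrableS _ _ _ sg).
  rewrite [RHS]Rintegral_mkcond; apply: eq_Rintegral => z _.
  by rewrite patchE mem_setE.
have e2 : \int[leb]_z g2 z = \int[leb]_(z in `[0, zeta]) gauss1 1 z.
  rewrite -Rintegral_itv_obnd_cbnd; last first.
    by apply: (integrableS _ _ _ sg).
  rewrite [RHS]Rintegral_mkcond; apply: eq_Rintegral => z _.
  by rewrite patchE mem_setE.
rewrite e1 e2 /erf.
have -> : \int[leb]_(X in `[zeta, 0]) expR (- X ^+ 2) = 0.
  rewrite set_itv_ge ?Rintegral_set0// bnd_simp -ltNge//.
rewrite subr0.
have -> : \int[leb]_(X in `[0, zeta]) expR (- X ^+ 2) = \int[leb]_(X in `[0, zeta]) gauss1 1 X.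
  by apply: eq_Rintegral => z _; rewrite /gauss1 mul1r.
ring.
Qed.

End erf.

(** * The integral representation of the solution *)

Lemma limr_le_cst {R : realType} (a : nat -> R) (l K : R) :
  a k @[k --> \oo] --> l -> (forall k, a k <= K) -> l <= K.
Proof.
move=> al aK; rewrite -(cvg_lim _ al)//.
apply: limr_le; first by apply/cvg_ex; exists l.
exact: nearW.
Qed.

Section erf_bounds.
Context {R : realType}.
Local Notation leb := (@lebesgue_measure R).
Variable z : R.
Hypothesis z0 : 0 < z.

Let sg : summable_fun leb (gauss1 1 : R -> R). Proof. exact: summable_gauss1. Qed.
Let sgz : leb.-integrable `[0, z] (EFin \o (gauss1 1 : R -> R)).
Proof. exact: (integrableS _ _ _ sg). Qed.

Lemma erf_posE : erf z = 2 / Num.sqrt pi * \int[leb]_(X in `[0, z]) gauss1 1 X.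
Proof.
rewrite /erf (_ : \int[leb]_(X in `[z, 0]) expR (- X ^+ 2) = 0); last first.
  by rewrite set_itv_ge ?Rintegral_set0// bnd_simp -ltNge.
rewrite subr0; congr (_ * _).
by apply: eq_Rintegral => X _; rewrite /gauss1 mul1r.
Qed.

Let c0 : 0 <= 2 / Num.sqrt pi :> R.
Proof. by rewrite divr_ge0// sqrtr_ge0. Qed.

Let scst (c : R) : leb.-integrable `[0, z] (EFin \o (fun=> c)).
Proof.
apply: continuous_compact_integrable; first exact: segment_compact.
by apply: continuous_subspaceT => X; exact: cst_continuous.
Qed.

Let Icst (c : R) : \int[leb]_(X in `[0, z]) c = c * z.
Proof.
have lz : leb `[0, z]%classic = z%:E.
  by rewrite [LHS]lebesgue_measure_itv/= lte_fin z0 -EFinB subr0.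
by rewrite Rintegral_cst//= [X in fine X]lz.
Qed.

Lemma erf_ge0 : 0 <= erf z.
Proof.
by rewrite erf_posE mulr_ge0//; apply: Rintegral_ge0 => X _; exact: expR_ge0.
Qed.

Lemma erf_le : erf z <= 2 / Num.sqrt pi * z.
Proof.
rewrite erf_posE ler_wpM2l// -[leRHS]mul1r -Icst.
apply: (le_Rintegral _ sgz (scst 1)) => // X _; exact: gauss1_le1.
Qed.

(** The integrand decreases on [0, z]. *)
Lemma erf_ge : 2 / Num.sqrt pi * (gauss1 1 z * z) <= erf z.
Proof.
rewrite erf_posE ler_wpM2l// -Icst.
apply: (le_Rintegral _ (scst _) sgz) => // X; rewrite /= in_itv/= => /andP[X0 Xz].
by rewrite ler_expR !mul1r lerN2 lerXn2r ?nnegrE ?(ltW z0).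
Qed.

Lemma erf_le2 : erf z <= 2.
Proof.
rewrite erf_posE; apply: (@le_trans _ _ (2 / Num.sqrt pi * Num.sqrt pi)); last first.
  by rewrite divfK// gt_eqF// sqrtr_gt0 pi_gt0.
rewrite ler_wpM2l// -Rintegral_gauss1 Rintegral_mkcond.
have sr : summable_fun leb ((gauss1 1 : R -> R) \_ `[0, z]).
  apply: (summable_le _ sg) => [|X].
    apply/(measurable_restrictT _ (measurable_itv _)).
    by apply: measurable_funTS; exact: measurable_gauss1.
  by rewrite patchE; case: ifP => _; rewrite ?normr0 ?ger0_norm ?expR_ge0.
apply: (le_Rintegral _ sr sg) => // X _.
by rewrite patchE; case: ifP => // _; exact: expR_ge0.
Qed.

End erf_bounds.

Section measurable_half.
Context {R : realType} {m : nat}.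
Notation tR := (m.-tuple (measurableTypeR R)).

(** [measurable_of_continuous] on the slice of the half-space at time [s]. *)
Lemma measurable_half (g : R * 'rV[R]_m * R -> R) s :
  (forall xi eta, 0 < xi -> cont_at g (xi, eta, s)) ->
  measurable_fun setT (onhalf (fun xi eta => g (xi, eta, s))).
Proof.
move=> cg.
pose A := [set p : (measurableTypeR R * tR) * measurableTypeR R | 0 < p.1.1 /\ p.2 = s].
have mA : measurable A.
  rewrite (_ : A = (`]0, +oo[ `*` setT) `*` [set s]).
    apply: measurableX; last exact: measurable_set1.
    by apply: measurableX.
  apply/seteqP; split=> -[[z w] r] /=; rewrite /A/= in_itv/= andbT.
    by move=> [].
  by move=> [[]].
have mgA : measurable_fun A (fun p => g (p.1.1, vec p.1.2, p.2)).
  by apply: measurable_of_continuous => -[[z w] r] [/= z0 ->]; exact: cg.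
move/(measurable_restrictT _ mA) : mgA => mgA.
have mp : measurable_fun setT (fun p : measurableTypeR R * tR => (p, s : measurableTypeR R)).
  exact: measurable_fun_pair.
have := measurableT_comp mgA mp.
congr measurable_fun; apply/funext => -[z w]; rewrite /= patchE /onhalf/=.
have -> : ((z, w, s) \in A) = (0 < z).
  by apply/idP/idP; rewrite inE; [case|].
by case: ifP.
Qed.

(** The Gaussian factors, so integrals of the kernel against functions of
    [eta] alone separate. *)
Lemma hk_split (S r q : R) : hk m.+1 (r + S) q = hk 1 r q * hk m S q.
Proof.
rewrite /hk mulrDl opprD expRD expr1 exprS; set a := 2 * Num.sqrt _.
by rewrite [(a * _)^-1]invfM; ring.
Qed.

End measurable_half.

Section representation.
Context {R : realType} {m : nat}.
Local Notation leb := (@lebesgue_measure R).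
Local Notation lebt m := (@lebesgue_tuple R m).
Notation tR := (m.-tuple (measurableTypeR R)).
Variables (u : R -> 'rV[R]_m -> R -> R) (f : 'rV[R]_m -> R -> R)
  (h : R -> 'rV[R]_m -> R).
Hypothesis ureg : classical_regularity u.
Hypothesis ueq : forall xi eta s, 0 < xi -> 0 < s ->
  dt u xi eta s - laplacian u xi eta s = - f eta s.
Hypothesis ugrowth : subgaussian_solution u.
Hypothesis fgrowth : subgaussian_source f.
Hypothesis ubdry : forall eta s, 0 < s -> u (eps_ k) eta s @[k --> \oo] --> (0 : R).
Hypothesis uinit : forall (xi : R) (eta : 'rV[R]_m), 0 < xi ->
  u xi eta s @[s --> (0 : R)^'+] --> (h xi eta : R).

Lemma measurable_half_u s : 0 < s -> measurable_fun setT (onhalf (fun xi eta => u xi eta s)).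
Proof.
move=> s0.
apply: (@measurable_half _ _ (fun p => u p.1.1 p.1.2 p.2)) => xi eta xi0.
by have [] := ureg eta xi0 s0.
Qed.

Lemma measurable_f s : 0 < s -> measurable_fun setT (fun w : tR => f (vec w) s).
Proof.
move=> s0.
have mh : measurable_fun setT (onhalf (fun (xi : R) eta => f eta s)).
  apply: (@measurable_half _ _ (fun p => f p.1.2 p.2)) => xi eta xi0.
  exact: (cont_source ureg ueq (p := (xi, eta, s))).
have := measurable_slice1 mh 1.
by congr measurable_fun; apply/funext => w; rewrite /onhalf/= ltr01.
Qed.

Section time_t.
Variables (t : R) (y : 'rV[R]_m).
Hypothesis t0 : 0 < t.
Let e := rate t / 2.
Let e0 : 0 < e. Proof. by rewrite divr_gt0// invr_gt0 mulr_gt0. Qed.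
(** The dilation by sigma, of square 4 q, multiplies the rate of growth [e] by
    at most 8 q, which leaves three quarters of the standard Gaussian. *)
Let e8 q : 0 < q -> q <= t -> e * (8 * q) <= 4^-1.
Proof.
move=> q0 qt; have -> : 4^-1 = e * (8 * t) :> R.
  by rewrite /e /rate; field; rewrite gt_eqF.
by rewrite ler_wpM2l ?(ltW e0)// ler_wpM2l.
Qed.

(** The heat semigroup of R^m at time [t - s] applied to the source at time
    [s]. *)
Definition avg s : R := \int[lebt m]_w (hk m (sqnorm (y - vec w)) (t - s) * f (vec w) s).

Lemma avg_bound : exists KA, forall s, 0 < s < t ->
  summable_fun (lebt m) (fun w => hk m (sqnorm (y - vec w)) (t - s) * f (vec w) s) /\
  `|avg s| <= KA.
Proof.
have [B B0 hB] := fgrowth_rate fgrowth t0.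
eexists => s /andP[s0 st].
have q0 : 0 < t - s by rewrite subr_gt0.
have qt : t - s <= t by rewrite gerBl ltW.
have s0t : 0 < s <= t by rewrite s0 ltW.
pose g w := f (vec w) s.
have mg : measurable_fun setT g := measurable_f s0.
have [mphi _ _] := scales_phit y q0.
have mG : measurable_fun setT (fun w : tR => gausst 1 w * g (phit y (t - s) w)).
  by apply: measurable_funM; [exact: measurable_gausst|exact: measurableT_comp mg mphi].
have sD : summable_fun (lebt m) (fun w => B * expR (e * (2 * sqnorm y)) * gausst (1 - 4^-1) w).
  by apply: summable_scale; apply: summable_gausst; lra.
have bG w : `|gausst 1 w * g (phit y (t - s) w)| <=
    B * expR (e * (2 * sqnorm y)) * gausst (1 - 4^-1) w.
  rewrite normrM ger0_norm ?expR_ge0// -gausst_expR mulrC -mulrA.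
  have hg := hB (vec (phit y (t - s) w)) s s0t.
  have h1 : expR (e * sqnorm (vec (phit y (t - s) w))) <=
      expR (e * (2 * sqnorm y)) * expR (4^-1 * sqnorm (vec w)).
    rewrite -expRD ler_expR.
    apply: (le_trans (ler_wpM2l (ltW e0) (sqnorm_phit_le y q0 w))).
    by rewrite mulrDr lerD2l mulrA ler_wpM2r ?sqnorm_ge0// e8.
  have h2 : `|g (phit y (t - s) w)| <= B * (expR (e * (2 * sqnorm y)) * expR (4^-1 * sqnorm (vec w))).
    by apply: (le_trans hg); rewrite ler_wpM2l.
  have g0 : 0 <= gausst 1 w by exact: expR_ge0.
  apply: (le_trans (ler_wpM2r g0 h2)).
  by rewrite le_eqVlt; apply/orP; left; apply/eqP; ring.
have [sA eA] := hk_averaget q0 mg (summable_le mG sD bG).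
split; first exact: sA.
rewrite /avg eA normrM.
have p0 : 0 <= Num.sqrt pi ^- m :> R by rewrite invr_ge0 exprn_ge0// sqrtr_ge0.
rewrite ger0_norm//; apply: (ler_wpM2l p0).
exact: (Rintegral_le_norm (summable_le mG sD bG) sD bG).
Qed.

Variable x : R.
Hypothesis x0 : 0 < x.

(** The source does not depend on xi: Fubini's theorem splits off the integral
    of the Green function in xi. *)
Lemma Gint_f_erf s : 0 < s < t -> Gint_f f x y t s = erf (x / (2 * Num.sqrt (t - s))) * avg s.
Proof.
move=> hs; have [KA hKA] := avg_bound; have [sA _] := hKA s hs.
have q0 : 0 < t - s by rewrite subr_gt0; case/andP: hs.
have [sh <-] := summable_hk_half_erf x0 q0.
rewrite /avg -(Rintegral_prod sh sA) /Gint_f; apply: eq_Rintegral => p _.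
rewrite /onhalf /hk_half; case: ifP => _; last by rewrite mul0r.
by rewrite /Gk /HK !hk_split; ring.
Qed.

Lemma Gint_f_bound : exists KI, forall s, 0 < s < t -> `|Gint_f f x y t s| <= KI.
Proof.
have [KA hKA] := avg_bound; exists (2 * KA) => s hs.
have q0 : 0 < t - s by rewrite subr_gt0; case/andP: hs.
have z0 : 0 < x / (2 * Num.sqrt (t - s)) by rewrite divr_gt0// mulr_gt0// sqrtr_gt0.
rewrite Gint_f_erf// normrM; apply: ler_pM => //; last exact: (hKA s hs).2.
by rewrite ger0_norm ?erf_le2// erf_ge0.
Qed.

Let half_phi_bound A a s q p : 0 <= A -> ugrowth_at u t A -> 0 < s <= t ->
  `|a| = x -> 0 < q -> q <= t ->
  `|gaussT 1 p * onhalf (fun xi eta => u xi eta s) (phiT y q a p)| <=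
   A * expR (e * (2 * x ^+ 2 + 2 * sqnorm y)) * gaussT (1 - 4^-1) p.
Proof.
move=> A0 hA s0t ax q0 qt; rewrite normrM ger0_norm ?expR_ge0//.
rewrite /onhalf; case: ifPn => p0; last first.
  by rewrite normr0 mulr0 !mulr_ge0// expR_ge0.
have hg := hA (phiT y q a p).1 (vec (phiT y q a p).2) s p0 s0t.
rewrite -gaussT_expR mulrC -mulrA.
have h1 : expR (e * ((phiT y q a p).1 ^+ 2 + sqnorm (vec (phiT y q a p).2))) <=
    expR (e * (2 * x ^+ 2 + 2 * sqnorm y)) * expR (4^-1 * (p.1 ^+ 2 + sqnorm (vec p.2))).
  rewrite -expRD ler_expR.
  have l1 := phi1_sq_le q0 a p.1; have l2 := sqnorm_phit_le y q0 p.2.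
  have xa : x ^+ 2 = a ^+ 2 by rewrite -ax real_normK ?num_real.
  apply: (le_trans (ler_wpM2l (ltW e0) (lerD l1 l2))).
  rewrite xa; set Z := p.1 ^+ 2; set W := sqnorm (vec p.2).
  have S0 : 0 <= Z + W by rewrite addr_ge0 ?sqr_ge0 ?sqnorm_ge0.
  have := ler_wpM2r S0 (e8 q0 qt); lra.
have g0 : 0 <= gaussT 1 p by exact: expR_ge0.
apply: (le_trans (ler_wpM2r g0 (le_trans hg (ler_wpM2l A0 h1)))).
by rewrite le_eqVlt; apply/orP; left; apply/eqP; ring.
Qed.

Section final_time.
Variable s_ : nat -> R.
Hypothesis s_itv : forall k, 0 < s_ k < t.

(** The two poles x and -x of the Green function, each rescaled to a fixed
    Gaussian. *)
Lemma Gint_u_average k : Gint_u u x y t (s_ k) = Num.sqrt pi ^- m.+1 *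
  (\int[@lebT R m]_p (gaussT 1 p * onhalf (fun xi eta => u xi eta (s_ k)) (phiT y (t - s_ k) x p))
   - \int[@lebT R m]_p (gaussT 1 p * onhalf (fun xi eta => u xi eta (s_ k)) (phiT y (t - s_ k) (- x) p))).
Proof.
have /andP[s0 st] := s_itv k.
have [A A0 hA] := ugrowth_rate ugrowth t0.
have q0 : 0 < t - s_ k by rewrite subr_gt0.
have qt : t - s_ k <= t by rewrite gerBl ltW.
have s0t : 0 < s_ k <= t by rewrite s0 ltW.
have mg := measurable_half_u s0.
have sG a : `|a| = x -> summable_fun (@lebT R m) (fun p => gaussT 1 p * onhalf (fun xi eta => u xi eta (s_ k)) (phiT y (t - s_ k) a p)).
  move=> ax; have [mphi _ _] := scales_phiT y q0 a.
  apply: (@summable_le _ _ _ _ _ (fun p => A * expR (e * (2 * x ^+ 2 + 2 * sqnorm y)) * gaussT (1 - 4^-1) p)).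
  - by apply: measurable_funM; [exact: measurable_gaussT|exact: measurableT_comp mg mphi].
  - by apply: summable_scale; apply: summable_gaussT; lra.
  - by move=> p; exact: half_phi_bound.
have ax : `|x| = x by rewrite gtr0_norm.
have axN : `|- x| = x by rewrite normrN gtr0_norm.
have [s1 e1] := hk_averageT q0 mg (sG x ax).
have [s2 e2] := hk_averageT q0 mg (sG (- x) axN).
rewrite mulrBr -e1 -e2 -(Rintegral_subr s1 s2); apply: eq_Rintegral => p _.
by rewrite /onhalf; case: ifP => _; rewrite ?mulr0 ?subrr// /Gk /HK mulrBl.
Qed.

Hypothesis s_cvg : s_ k @[k --> \oo] --> t.

Let sig_cvg : sigma (t - s_ k) @[k --> \oo] --> (0 : R).
Proof.
rewrite -[X in _ --> X](mulr0 2) -(@sqrtr0 R) -(subrr t).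
apply: cvgM; first exact: cvg_cst.
have c : t - s_ k @[k --> \oo] --> t - t by apply: cvgB => //; exact: cvg_cst.
exact: (cvg_comp _ _ c (@sqrt_continuous R (t - t))).
Qed.

Let phi1_cvg a z : phi1 (t - s_ k) a z @[k --> \oo] --> a.
Proof.
rewrite -[X in _ --> X]add0r -[X in _ --> X + _](mul0r (z : R)).
by apply: cvgD; [apply: cvgM => //; exact: cvg_cst|exact: cvg_cst].
Qed.

Let phit_cvg w : vec (phit y (t - s_ k) w) @[k --> \oo] --> y.
Proof.
apply: cvg_rV => i.
rewrite -[X in _ --> X]add0r -[X in _ --> X + _](mul0r (tnth w i : R)).
under eq_fun do rewrite mxE tnth_mktuple.
by apply: cvgD; [apply: cvgM => //; exact: cvg_cst|exact: cvg_cst].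
Qed.

(** The rescaled average with pole x samples [u] near (x, y, t) and tends to
    its value there; the one with pole -x < 0 samples outside the half-space,
    where the integrand is zero. *)
Lemma Gint_u_final : Gint_u u x y t (s_ k) @[k --> \oo] --> u x y t.
Proof.
have [A A0 hA] := ugrowth_rate ugrowth t0.
have ax : `|x| = x by rewrite gtr0_norm.
have axN : `|- x| = x by rewrite normrN gtr0_norm.
pose D (p : measurableTypeR R * tR) : R := A * expR (e * (2 * x ^+ 2 + 2 * sqnorm y)) * gaussT (1 - 4^-1) p.
have sD : summable_fun (@lebT R m) D.
  by apply: summable_scale; apply: summable_gaussT; lra.
pose F a k (p : measurableTypeR R * tR) : R := gaussT 1 p * onhalf (fun xi eta => u xi eta (s_ k)) (phiT y (t - s_ k) a p).
have mF a k : measurable_fun setT (F a k).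
  have /andP[s0 st] := s_itv k.
  have q0 : 0 < t - s_ k by rewrite subr_gt0.
  have [mphi _ _] := scales_phiT y q0 a.
  by apply: measurable_funM; [exact: measurable_gaussT|exact: measurableT_comp (measurable_half_u s0) mphi].
have bF a : `|a| = x -> forall k p, `|F a k p| <= D p.
  move=> aa k p; have /andP[s0 st] := s_itv k.
  by apply: half_phi_bound => //; rewrite ?s0 ?subr_gt0 ?gerBl ?(ltW st) ?(ltW s0).
have c1 p : F x k p @[k --> \oo] --> gaussT 1 p * u x y t.
  apply: cvgM; first exact: cvg_cst.
  have cp : (phi1 (t - s_ k) x p.1 : R, vec (phit y (t - s_ k) p.2), s_ k) @[k --> \oo] --> (x, y, t).
    have a1 : (phi1 (t - s_ k) x p.1 : R) @[k --> \oo] --> x by exact: phi1_cvg.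
    have a2 : vec (phit y (t - s_ k) p.2) @[k --> \oo] --> y by exact: phit_cvg.
    exact: (cvg_pair (cvg_pair a1 a2) s_cvg).
  have [cu _ _ _] := ureg y x0 t0.
  have c := cvg_comp _ _ cp cu.
  apply: cvg_trans c; apply: near_eq_cvg.
  have a1 : (phi1 (t - s_ k) x p.1 : R) @[k --> \oo] --> x by exact: phi1_cvg.
  have hev : \forall k \near \oo, 0 < (phi1 (t - s_ k) x p.1 : R).
    exact: (cvgr_gt _ a1 _ x0).
  apply: filterS hev => k hk.
  by rewrite /onhalf /phiT/= hk.
have c2 p : F (- x) k p @[k --> \oo] --> (0 : R).
  apply: cvg_near_cst.
  have xN : - x < 0 by rewrite oppr_lt0.
  have a1 : (phi1 (t - s_ k) (- x) p.1 : R) @[k --> \oo] --> - x by exact: phi1_cvg.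
  have hev : \forall k \near \oo, (phi1 (t - s_ k) (- x) p.1 : R) < 0.
    exact: (cvgr_lt _ a1 _ xN).
  apply: filterS hev => k hk.
  by rewrite /F /onhalf /phiT/= ltNge (ltW hk)/= mulr0.
have [_ l1] := cvg_Rintegral (mF x) c1 sD (bF x ax).
have [_ l2] := cvg_Rintegral (mF (- x)) c2 sD (bF (- x) axN).
have c : Num.sqrt pi ^- m.+1 * (\int[@lebT R m]_p F x k p - \int[@lebT R m]_p F (- x) k p)
    @[k --> \oo] --> Num.sqrt pi ^- m.+1 * (\int[@lebT R m]_p (gaussT 1 p * u x y t) - \int[@lebT R m]_p 0).
  by apply: cvgM; [exact: cvg_cst|exact: cvgB].
have E : Num.sqrt pi ^- m.+1 * (\int[@lebT R m]_p (gaussT 1 p * u x y t) - \int[@lebT R m]_p 0) = u x y t.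
  rewrite Rintegral0 subr0; under eq_Rintegral do rewrite mulrC.
  rewrite Rintegral_scale ?Rintegral_gaussT; last exact: summable_gaussT.
  by rewrite mulrCA mulVf ?mulr1// expf_neq0// gt_eqF// sqrtr_gt0 pi_gt0.
rewrite E in c; apply: cvg_trans c; apply: near_eq_cvg; apply: nearW => k.
by rewrite Gint_u_average.
Qed.

End final_time.

Lemma HK_time_cvg a xi eta (s_ : nat -> R) (s : R) : s < t ->
  s_ k @[k --> \oo] --> s ->
  HK y t a xi eta (s_ k) @[k --> \oo] --> HK y t a xi eta s.
Proof.
move=> st c; have hc := hasder_continuous (hasder_hk m.+1 ((a - xi) ^+ 2 + sqnorm (y - eta)) st).
exact: (cvg_comp _ _ c hc).
Qed.

(** The growth of [u] passes to the initial datum in the limit s to 0. *)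
Lemma h_growth A : ugrowth_at u t A -> forall xi eta, 0 < xi ->
  `|h xi eta| <= A * expR (e * (xi ^+ 2 + sqnorm eta)).
Proof.
move=> hA xi eta xi0; pose s_ k : R := t * eps_ k.
have s0 k : 0 < s_ k by rewrite mulr_gt0// eps_gt0.
have s_c : s_ k @[k --> \oo] --> (0 : R).
  by rewrite -[X in _ --> X](mulr0 t); apply: cvgM; [exact: cvg_cst|exact: cvg_eps].
have c : u xi eta (s_ k) @[k --> \oo] --> h xi eta.
  by have := (cvg_at_rightP (u xi eta) 0 (h xi eta)).1 (@uinit xi eta xi0) s_; apply; split.
have c' : `|u xi eta (s_ k)| @[k --> \oo] --> `|h xi eta| by exact: cvg_norm.
apply: (limr_le_cst c') => k; apply: hA => //.
by rewrite s0 /s_ ler_piMr ?(ltW t0) ?eps_le1.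
Qed.

Section initial_time.
Variable s_ : nat -> R.
Hypothesis s_itv : forall k, 0 < s_ k <= t / 2.
Hypothesis s_cvg : s_ k @[k --> \oo] --> (0 : R).

Lemma Gint_u_initial :
  summable_fun (@lebT R m) (onhalf (fun xi eta => Gk x y t xi eta 0 * h xi eta)) /\
  Gint_u u x y t (s_ k) @[k --> \oo] -->
  \int[@lebT R m]_p onhalf (fun xi eta => Gk x y t xi eta 0 * h xi eta) p.
Proof.
have [A A0 hA] := ugrowth_rate ugrowth t0.
pose C := HKcst x y t (t / 2).
have C0 : 0 <= C by exact: HKcst_ge0.
have th0 : 0 < t / 2 by rewrite divr_gt0.
have d01 : 0 <= (0 : R) <= 1.
  by rewrite lexx ler01.
apply: (@cvg_Rintegral _ _ _ (@lebT R m) (fun k => onhalf (fun xi eta => Gk x y t xi eta (s_ k) * u xi eta (s_ k)))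
   _ (fun p => 2 * C * A * gaussT e p)).
- move=> k; apply: summable_measurable.
  have /andP[s0 s2] := s_itv k.
  have st : s_ k < t by rewrite (le_lt_trans s2)// ltr_pdivrMr// ltr_pMr// ltr1n.
  have ss : s_ k <= s_ k <= (s_ k + t) / 2 by rewrite lexx/=; lra.
  apply: (Gint_u_summable ureg ugrowth y x0 t0 s0 _ ss); lra.
- move=> p; rewrite /onhalf; case: ifPn => p0; last exact: cvg_cst.
  apply: cvgM; first by apply: cvgB; exact: HK_time_cvg.
  have s0 k : 0 < s_ k by case/andP: (s_itv k).
  by apply: ((cvg_at_rightP (u p.1 (vec p.2)) 0 (h p.1 (vec p.2))).1 (@uinit p.1 (vec p.2) p0)); split.
- by apply: summable_scale; exact: summable_gaussT.
- move=> k p; have /andP[s0 s2] := s_itv k.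
  have st : s_ k <= t by apply: (le_trans s2); rewrite ler_pdivrMr// ler_pMr// ler1n.
  have CA0 : 0 <= 2 * C * A by apply: mulr_ge0 => //; exact: mulr_ge0.
  rewrite /onhalf; case: ifPn => p0; last first.
    by rewrite normr0; apply: mulr_ge0 => //; exact: expR_ge0.
  have ths : t / 2 <= t - s_ k by lra.
  have ax : `|x| = x by rewrite gtr0_norm.
  have axN : `|- x| = x by rewrite normrN gtr0_norm.
  have h1 := HK_bound0 y th0 p ax d01 (ltW s0) ths.
  have h2 := HK_bound0 y th0 p axN d01 (ltW s0) ths.
  rewrite -/C !subr0 in h1 h2.
  have hG : `|Gk x y t p.1 (vec p.2) (s_ k)| <= 2 * C * gaussT (rate t) p.
    apply: (le_trans (ler_normB _ _)); rewrite !ger0_norm ?HK_ge0//.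
    by rewrite mulrAC -mulrA (_ : 2 = 1 + 1)// mulrDl mul1r; apply: lerD; rewrite mulrC in h1 h2 *.
  have hu := hA p.1 (vec p.2) (s_ k) p0.
  rewrite s0 st in hu; have {}hu := hu isT.
  rewrite normrM; apply: (le_trans (ler_pM (normr_ge0 _) (normr_ge0 _) hG hu)).
  rewrite mulrACA gaussT_expR (_ : rate t - e = e)//.
  by rewrite /e; field.
Qed.

End initial_time.

(** [duality] on [s1, s2] with s1 tending to 0 and s2 to [t].  The factors 1/3
    keep s1 < s2 along the two sequences. *)
Lemma representation_u :
  [/\ summable_fun (@lebT R m) (onhalf (fun xi eta => Gk x y t xi eta 0 * h xi eta)),
   summable_fun leb (fun s => if 0 < s < t then erf (x / (2 * Num.sqrt (t - s))) * avg s else 0) &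
   u x y t = \int[@lebT R m]_p onhalf (fun xi eta => Gk x y t xi eta 0 * h xi eta) p -
    \int[leb]_s (if 0 < s < t then erf (x / (2 * Num.sqrt (t - s))) * avg s else 0)].
Proof.
pose s1 k : R := t / 3 * eps_ k; pose s2 k : R := t - t / 3 * eps_ k.
have s10 k : 0 < s1 k by rewrite mulr_gt0 ?eps_gt0 ?divr_gt0.
have s1le k : s1 k <= t / 3 by rewrite ler_piMr ?eps_le1// divr_ge0 ?ltW.
have s12 k : s1 k < s2 k.
  by have := s1le k; rewrite /s2 -/(s1 k); move: t0; lra.
have s2t k : s2 k < t by rewrite ltrBlDr ltrDl; exact: s10.
have c1 : s1 k @[k --> \oo] --> (0 : R).
  by rewrite -[X in _ --> X](mulr0 (t / 3)); apply: cvgM; [exact: cvg_cst|exact: cvg_eps].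
have c2 : s2 k @[k --> \oo] --> t.
  by rewrite -[X in _ --> X]subr0; apply: cvgB; [exact: cvg_cst|exact: c1].
have [//|sU l1] := @Gint_u_initial s1 _ c1.
  by move=> k; rewrite s10/= (le_trans (s1le k))//; move: t0; lra.
have l2 : Gint_u u x y t (s2 k) @[k --> \oo] --> u x y t.
  by apply: Gint_u_final => // k; rewrite s2t (lt_trans (s10 k) (s12 k)).
have du k := duality ureg ueq ugrowth fgrowth ubdry y x0 t0 (s10 k) (s12 k) (s2t k).
have [KI hKI] := Gint_f_bound.
pose J s : R := if 0 < s < t then 1 else 0.
have sJ : summable_fun leb J.
  have := @integrable_indic_itv R 0 t false true.
  apply: eq_integrable => // s _ /=.
  by rewrite indicE mem_setE in_itv /J /=; case: ifP.
have [||||sI l3] := @cvg_Rintegral _ _ _ leb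
  (fun k s => if s1 k <= s <= s2 k then Gint_f f x y t s else 0)
  (fun s => if 0 < s < t then Gint_f f x y t s else 0) (fun s => KI * J s).
- by move=> k; apply: summable_measurable; exact: (du k).1.
- move=> s; case: ifPn => hs.
    have /andP[s0 st] := hs.
    apply: cvg_near_cst.
    have e1 : \forall k \near \oo, s1 k <= s by exact: (cvgr_le _ c1 _ s0).
    have e2 : \forall k \near \oo, s <= s2 k by exact: (cvgr_ge _ c2 _ st).
    by apply: filterS2 e1 e2 => k -> ->.
  apply: cvg_near_cst; apply: nearW => k; rewrite ifF//; apply/negP => /andP[a b].
  by move/negP: hs; apply; rewrite (lt_le_trans (s10 k) a) (le_lt_trans b (s2t k)).
- exact: summable_scale.
- move=> k s; rewrite /J; case: ifPn => [/andP[a b]|hs].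
    have hs : 0 < s < t by rewrite (lt_le_trans (s10 k) a) (le_lt_trans b (s2t k)).
    by rewrite hs mulr1; exact: hKI.
  rewrite normr0; case: ifPn => hs2; last by rewrite mulr0.
  by rewrite mulr1 (le_trans _ (hKI s hs2)).
have E : (fun s => if 0 < s < t then Gint_f f x y t s else 0) =
    (fun s => if 0 < s < t then erf (x / (2 * Num.sqrt (t - s))) * avg s else 0).
  by apply/funext => s; case: ifPn => // hs; rewrite Gint_f_erf.
rewrite E in sI l3; split=> //.
set U := (X in _ = X - _); set W := (X in _ = _ - X).
have l4 : (Gint_u u x y t (s2 k) - Gint_u u x y t (s1 k) : R) @[k --> \oo] --> (u x y t - U : R).
  exact: cvgB.
have l5 : (Gint_u u x y t (s2 k) - Gint_u u x y t (s1 k) : R) @[k --> \oo] --> (- W : R).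
  have l6 : (- \int[leb]_s (if s1 k <= s <= s2 k then Gint_f f x y t s else 0) : R) @[k --> \oo] --> (- W : R).
    exact: cvgN.
  apply: cvg_trans l6; apply: near_eq_cvg; apply: nearW => k.
  by rewrite (du k).2.
have e3 : u x y t - U = - W by exact: (cvg_unique (@Rhausdorff R) l4 l5).
by rewrite -[LHS](subrK U) e3 addrC.
Qed.

End time_t.
End representation.

(** * The flux through the boundary *)

Section monotone_summable.
Context {d : measure_display} {T : measurableType d} {R : realType}.
Variable mu : {measure set T -> \bar R}.

(** Monotone convergence. *)
Lemma summable_monotone (f_ : nat -> T -> R) f (C : R) :
  (forall k, summable_fun mu (f_ k)) -> (forall k x, 0 <= f_ k x) ->
  (forall x, {homo f_^~ x : k l / (k <= l)%N >-> k <= l}) ->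
  (forall x, f_ k x @[k --> \oo] --> f x) ->
  (forall k, \int[mu]_x f_ k x <= C) -> summable_fun mu f.
Proof.
move=> sf f0 nf cf bC.
have mf k := summable_measurable (sf k).
have mfl : measurable_fun setT f by exact: (measurable_fun_cvg mf).
have fl0 x : 0 <= f x by apply: (cvgr_to_ge (cf x)); exact: nearW.
have cE x : (f_ k x)%:E @[k --> \oo] --> (f x)%:E.
  by apply/cvg_EFin; [exact: nearW|exact: cf].
have := @cvg_monotone_convergence _ _ _ mu setT measurableT (fun k => EFin \o f_ k).
have mE k : measurable_fun setT (EFin \o f_ k) by exact/measurable_EFinP.
move=> /(_ mE) h.
have {}h := h (fun k x _ => f0 k x).
have {}h := h (fun x _ k l kl => nf x k l kl).
apply/integrableP; split; first exact/measurable_EFinP.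
apply: (@le_lt_trans _ _ C%:E); last exact: ltry.
have -> : (\int[mu]_x `|(EFin \o f) x| = \int[mu]_x limn (fun k => (f_ k x)%:E))%E.
  apply: eq_integral => x _; rewrite /= ger0_norm//.
  by apply/esym; apply: cvg_lim => //; exact: cE.
have := cvg_lim _ h => /= <- //.
apply: lime_le; first by apply/cvg_ex; eexists; exact: h.
by apply: nearW => k; rewrite -EFin_Rintegral// lee_fin.
Qed.

End monotone_summable.

Section inverse_sqrt.
Context {R : realType}.
Local Notation leb := (@lebesgue_measure R).
Variable t : R.
Hypothesis t0 : 0 < t.

Let g (s : R) : R := (Num.sqrt (t - s))^-1.
Let hasder_g s : s < t -> hasder s (fun s => - 2 * Num.sqrt (t - s)) (g s).
Proof.
move=> st; have q0 : 0 < t - s by rewrite subr_gt0.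
have h := hasder_sub (hasder_cst_fun t s) (hasder_id_fun s).
have hc := @hasder_comp _ _ (fun z => t - z) _ _ _ (hasder_sqrt q0) h.
apply: hasder_eq; first exact: (hasder_scale (- 2) hc).
by rewrite /g; field; rewrite gt_eqF// sqrtr_gt0.
Qed.
Let cont_g s : s < t -> {for s, continuous g}.
Proof.
move=> st; have q0 : 0 < t - s by rewrite subr_gt0.
have h := hasder_sub (hasder_cst_fun t s) (hasder_id_fun s).
have hc := @hasder_comp _ _ (fun z => t - z) _ _ _ (hasder_sqrt q0) h.
apply: (hasder_continuous (hasder_inv _ hc)).
by rewrite gt_eqF// sqrtr_gt0.
Qed.

(** The primitive -2 sqrt(t - s) is bounded up to s = t, so the integrals over
    [0, t - t/(2(k+1))] stay bounded while their domains exhaust [0, t[. *)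
Lemma summable_inverse_sqrt :
  summable_fun leb (fun s => if 0 <= s < t then (Num.sqrt (t - s))^-1 else 0).
Proof.
pose b k := t - t * (eps_ k / 2).
have ek k : 0 < t * (eps_ k / 2) by rewrite mulr_gt0// divr_gt0// eps_gt0.
have bt k : b k < t by rewrite ltrBlDr ltrDl.
have b0 k : 0 < b k.
  by have := eps_le1 (R := R) k; have := eps_gt0 (R := R) k; rewrite /b; move: t0 => ? ? ?; nra.
have bc : b k @[k --> \oo] --> t.
  rewrite -[X in _ --> X]subr0 -[X in _ - X](mulr0 t) -[X in t * X](mul0r 2^-1).
  apply: cvgB; first exact: cvg_cst.
  apply: cvgM; first exact: cvg_cst.
  by apply: cvgM; [exact: cvg_eps|exact: cvg_cst].
have bmono : {homo b : k l / (k <= l)%N >-> k <= l}.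
  move=> k l kl; rewrite lerB// ler_wpM2l ?(ltW t0)// ler_wpM2r//.
  by rewrite /eps_ lef_pV2 ?posrE// ler_nat.
have cw k : {within `[0, b k], continuous g}.
  apply: within_continuous_for => z /andP[_ zb]; apply: cont_g.
  exact: le_lt_trans zb (bt k).
have sk k : leb.-integrable `[0, b k] (EFin \o g).
  by apply: continuous_compact_integrable; [exact: segment_compact|exact: cw].
have sk' k : summable_fun leb (fun s => if 0 <= s <= b k then g s else 0).
  have := sk k; rewrite integrable_mkcond// => h.
  apply: eq_integrable h => // s _.
  by rewrite patchE /= mem_setE in_itv/=; case: ifP.
pose h k (s : measurableTypeR R) : R := if 0 <= s <= b k then g s else 0.
apply: (@summable_monotone _ _ _ leb h _ (2 * Num.sqrt t)).
- exact: sk'.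
- move=> k s; rewrite /h; case: ifP => // _; rewrite invr_ge0; exact: sqrtr_ge0.
- move=> s k l kl; rewrite /h; case: ifP => [/andP[s0 sb]|_].
      by rewrite s0 (le_trans sb (bmono _ _ kl)).
    by case: ifP => // _; rewrite invr_ge0; exact: sqrtr_ge0.
- move=> s; rewrite /h; case: ifPn => hs.
      have /andP[s0 st] := hs.
      apply: cvg_near_cst.
      have e2 : \forall k \near \oo, s <= b k by exact: (cvgr_ge _ bc _ st).
      by apply: filterS e2 => k ->; rewrite s0.
    apply: cvg_near_cst; apply: nearW => k; rewrite ifF//; apply/negP => /andP[a c].
    by move/negP: hs; apply; rewrite a (le_lt_trans c).
- move=> k; rewrite /h Rintegral_if_itv (@Rintegral_derive _ (fun s => - 2 * Num.sqrt (t - s)) g)//.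
  + by rewrite subr0 !mulNr opprK addrC gerBl mulr_ge0// sqrtr_ge0.
  + by move=> z /andP[_ zb]; apply: hasder_g; exact: le_lt_trans zb (bt k).
  + by move=> z /andP[_ zb]; apply: cont_g; exact: le_lt_trans zb (bt k).
Qed.

End inverse_sqrt.

Section kernel_quotient.
Context {R : realType} {m : nat}.
Implicit Types (x t xi : R) (y eta : 'rV[R]_m).

Lemma cvg_hasder_quotient (f : R -> R) (l : R) : hasder 0 f l -> f 0 = 0 ->
  f (eps_ k) / eps_ k @[k --> \oo] --> l.
Proof.
move=> [df dl] f0.
have c : h^-1 *: ((f \o shift 0) (h *: 1) - f 0) @[h --> 0^'] --> l.
  by rewrite -dl; exact: df.
have ce : eps_ k @[k --> \oo] --> (0 : R)^'.
  move=> A [e/= e0 hA]; have := @cvg_eps R; move=> /cvgrPdist_lt /(_ e e0).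
  apply: filterS => k hk; apply: hA => //=.
  by rewrite gt_eqF// eps_gt0.
have := cvg_comp _ _ ce c; apply: cvg_trans; apply: near_eq_cvg; apply: nearW => k.
by rewrite /= f0 subr0 addr0 /GRing.scale/= mulr1 mulrC.
Qed.

Lemma GkE x y t xi eta s : Gk x y t xi eta s =
  hk m.+1 (sqnorm (y - eta)) (t - s) * (bell x (t - s) xi - bell (- x) (t - s) xi).
Proof. by rewrite /Gk !HK_x mulrBr. Qed.

Lemma Gk0 y t xi eta s : Gk 0 y t xi eta s = 0.
Proof. by rewrite /Gk oppr0 subrr. Qed.

Lemma G1E x y t xi eta s : G1 x y t xi eta s = Gk x y t xi eta s.
Proof.
rewrite /G1 /gauss /G GkE /hk /bell -opprD sqrrN [in RHS]exprSr.
set E1 := expR _; set E2 := expR _; set E3 := expR _; set S := 2 * Num.sqrt _.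
by rewrite (invfM (S ^+ m) S); ring.
Qed.

(** At x = 0 the two poles merge, and the derivative of the Green function is
    twice that of the kernel with pole x. *)
Lemma hasder_Gk y t xi eta : 0 < t ->
  hasder 0 (fun x => Gk x y t xi eta 0)
    (hk m.+1 (sqnorm (y - eta)) t * (xi / t * bell 0 t xi)).
Proof.
move=> t0; have t0' : t != 0 by rewrite gt_eqF.
have b (x : R) : bell x t xi = bell xi t x by rewrite /bell -(opprB xi) sqrrN.
have b' (x : R) : bell (- x) t xi = bell (- xi) t x.
  by rewrite /bell -opprD -opprB opprK !sqrrN addrC.
have -> : (fun x => Gk x y t xi eta 0) =
    (fun x => hk m.+1 (sqnorm (y - eta)) t * (bell xi t x - bell (- xi) t x)).
  by apply/funext => x; rewrite GkE subr0 b b'.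
apply: hasder_eq.
  by apply: hasder_scale; apply: hasder_sub; exact: hasder_bell.
by rewrite !b -b' oppr0 !b; field.
Qed.

Lemma G1xE y t xi eta : 0 < t -> G1x 0 y t xi eta 0 =
  hk m.+1 (sqnorm (y - eta)) t * (xi / t * bell 0 t xi).
Proof.
move=> t0; have [_ dl] := hasder_Gk y xi eta t0.
have E : (fun x => G1 x y t xi eta 0) = (fun x => Gk x y t xi eta 0).
  by apply/funext => x; exact: G1E.
by rewrite /G1x E derive1E; exact: dl.
Qed.

Lemma cvg_Gk_quotient y t xi eta : 0 < t ->
  Gk (eps_ k) y t xi eta 0 / eps_ k @[k --> \oo] --> (G1x 0 y t xi eta 0 : R).
Proof.
move=> t0; rewrite G1xE//.
exact: (cvg_hasder_quotient (hasder_Gk y xi eta t0) (Gk0 _ _ _ _ _)).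
Qed.

(** The two kernels have the ratio exp(-x xi/t), and 1 - exp(-z) <= z; the
    remaining factor xi/t is absorbed by the Gaussian since
    xi <= 1 + |x - xi|. *)
Lemma Gk_quotient_bound x y t (p : measurableTypeR R * m.-tuple (measurableTypeR R)) :
  0 < x -> x <= 1 -> 0 < t -> 0 < p.1 ->
  `|Gk x y t p.1 (vec p.2) 0 / x| <= t^-1 * HKcst 1 y t t * gaussT (rate t) p.
Proof.
move=> x0 x1 t0 p0; have t0' : t != 0 by rewrite gt_eqF.
have xN0 : x != 0 by rewrite gt_eqF.
have hb : bell (- x) t p.1 = bell x t p.1 * expR (- (x * p.1 / t)).
  by rewrite /bell -expRD; congr expR; field.
have e1 : 1 - x * p.1 / t <= expR (- (x * p.1 / t)) by exact: expR_ge1Dx.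
have e2 : expR (- (x * p.1 / t)) <= 1.
  by rewrite -expR0 ler_expR oppr_le0 !mulr_ge0 ?invr_ge0// ltW.
have HKb : 0 <= HK y t x p.1 (vec p.2) 0 by exact: HK_ge0.
have E : Gk x y t p.1 (vec p.2) 0 / x =
    HK y t x p.1 (vec p.2) 0 * ((1 - expR (- (x * p.1 / t))) / x).
  by rewrite GkE HK_x subr0 hb; ring.
rewrite E normrM (ger0_norm HKb) ger0_norm; last by rewrite divr_ge0 ?subr_ge0// ltW.
have h1 : (1 - expR (- (x * p.1 / t))) / x <= p.1 / t.
  by rewrite ler_pdivrMr// (_ : p.1 / t * x = x * p.1 / t); [lra|ring].
have h2 : p.1 <= 1 + `|x - p.1|.
  by have := ler_norm (- (x - p.1)); rewrite normrN; lra.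
have ti : 0 <= t^-1 by rewrite invr_ge0 ltW.
have d01 : 0 <= (0 : R) <= 1 by rewrite lexx ler01.
have w : (x - p.1) ^+ 2 <= (x - (p.1 - 0)) ^+ 2 + sqnorm (y - vec p.2).
  by rewrite subr0 lerDl sqnorm_ge0.
have tt : t <= t - 0 by rewrite subr0.
have h3 := HK_bound t0 (gtr0_norm x0) d01 (lexx 0) tt w.
rewrite subr0 in h3.
have h4 : HKcst x y t t <= HKcst 1 y t t.
  rewrite /HKcst; apply: ler_wpM2l.
    apply: divr_ge0; first by rewrite addr_ge0// mulr_ge0// ltW.
    by rewrite exprn_ge0// mulr_ge0// sqrtr_ge0.
  rewrite ler_expR ler_wpM2r//; first by rewrite invr_ge0 mulr_ge0// ltW.
  by rewrite lerD2r lerD2r ler_wpM2l// lerXn2r ?nnegrE// ltW.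
have g0 : 0 <= gaussT (rate t) p by exact: expR_ge0.
apply: (le_trans (ler_wpM2l HKb h1)).
rewrite (_ : _ * (p.1 / t) = t^-1 * (p.1 * HK y t x p.1 (vec p.2) 0)); last by ring.
rewrite -[leRHS]mulrA; apply: ler_wpM2l => //.
have h5 := ler_wpM2r HKb h2.
exact: (le_trans h5 (le_trans h3 (ler_wpM2r g0 h4))).
Qed.

End kernel_quotient.

Section erf_slope.
Context {R : realType}.
Variable q : R.
Hypothesis q0 : 0 < q.

Let sq0 : 0 < Num.sqrt q. Proof. by rewrite sqrtr_gt0. Qed.
Let pi0 : 0 < Num.sqrt (pi : R). Proof. by rewrite sqrtr_gt0 pi_gt0. Qed.
Let pq : Num.sqrt (pi * q) = Num.sqrt pi * Num.sqrt q.
Proof. by rewrite sqrtrM// pi_ge0. Qed.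
Let pos x : 0 < x -> 0 < x / (2 * Num.sqrt q).
Proof. by move=> x0; rewrite divr_gt0// mulr_gt0. Qed.
Let slope x : 0 < x ->
  2 / Num.sqrt pi * (x / (2 * Num.sqrt q)) = (Num.sqrt (pi * q))^-1 * x.
Proof. by move=> x0; rewrite pq; field; rewrite !gt_eqF. Qed.

Lemma erf_slope_le x : 0 < x ->
  0 <= erf (x / (2 * Num.sqrt q)) / x <= (Num.sqrt (pi * q))^-1.
Proof.
move=> x0; have z0 := pos x0; apply/andP; split.
  by rewrite divr_ge0 ?erf_ge0// ltW.
by rewrite ler_pdivrMr// -slope//; exact: erf_le.
Qed.

(** The bounds [erf_ge] and [erf_le] pinch the quotient. *)
Lemma cvg_erf_slope :
  erf (eps_ k / (2 * Num.sqrt q)) / eps_ k @[k --> \oo] --> (Num.sqrt (pi * q))^-1.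
Proof.
pose z k : R := eps_ k / (2 * Num.sqrt q).
have zc : z k @[k --> \oo] --> (0 : R).
  rewrite -[X in _ --> X](mul0r (2 * Num.sqrt q)^-1).
  by apply: cvgM; [exact: cvg_eps|exact: cvg_cst].
have gc : (Num.sqrt (pi * q))^-1 * gauss1 1 (z k) @[k --> \oo] --> (Num.sqrt (pi * q))^-1.
  rewrite -[X in _ --> X]mulr1; apply: cvgM; first exact: cvg_cst.
  have e2 : - (1 * (z k * z k)) @[k --> \oo] --> (- (1 * (0 * 0)) : R).
    by apply: cvgN; apply: cvgM; [exact: cvg_cst|exact: cvgM].
  have e3 : expR (- (1 * (z k * z k))) @[k --> \oo] --> expR (- (1 * (0 * 0)) : R).
    exact: (cvg_comp _ _ e2 (@continuous_expR R _)).
  by rewrite !mulr0 oppr0 expR0 in e3; exact: e3.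
have uc : (Num.sqrt (pi * q))^-1 @[k --> \oo] --> (Num.sqrt (pi * q))^-1 by exact: cvg_cst.
apply: (squeeze_cvgr _ gc uc); apply: nearW => k.
have x0 := @eps_gt0 R k.
have /andP[_ ->] := erf_slope_le x0; rewrite andbT.
rewrite ler_pdivlMr//; apply: le_trans (erf_ge (pos x0)).
rewrite le_eqVlt; apply/orP; left; apply/eqP.
rewrite [RHS]mulrCA [RHS]mulrC slope// /z; ring.
Qed.

End erf_slope.

Section flux_equation.
Context {R : realType} {m : nat}.
Local Notation leb := (@lebesgue_measure R).
Variables (u : R -> 'rV[R]_m -> R -> R) (f : 'rV[R]_m -> R -> R)
  (h : R -> 'rV[R]_m -> R).
Hypothesis ureg : classical_regularity u.
Hypothesis ueq : forall xi eta s, 0 < xi -> 0 < s ->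
  dt u xi eta s - laplacian u xi eta s = - f eta s.
Hypothesis ugrowth : subgaussian_solution u.
Hypothesis fgrowth : subgaussian_source f.
Hypothesis ubdry : forall eta s, 0 < s -> u (eps_ k) eta s @[k --> \oo] --> (0 : R).
Hypothesis uinit : forall (xi : R) (eta : 'rV[R]_m), 0 < xi ->
  u xi eta s @[s --> (0 : R)^'+] --> (h xi eta : R).
Variables (t V : R) (y : 'rV[R]_m).
Hypothesis t0 : 0 < t.
Hypothesis Vlim : u (eps_ k) y t / eps_ k @[k --> \oo] --> V.

(** [representation_u] at x = 1/(k+1), divided by x.  The averages of the source
    are bounded uniformly in time, so the singularity (t - s)^(-1/2) is the
    only one and it is integrable. *)
Lemma representation_flux :
  [/\ summable_fun (@lebT R m) (onhalf (fun xi eta => G1x 0 y t xi eta 0 * h xi eta)),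
   summable_fun leb (fun s => if 0 < s < t then (Num.sqrt (pi * (t - s)))^-1 * avg f t y s else 0) &
   V = \int[@lebT R m]_p onhalf (fun xi eta => G1x 0 y t xi eta 0 * h xi eta) p -
    \int[leb]_s (if 0 < s < t then (Num.sqrt (pi * (t - s)))^-1 * avg f t y s else 0)].
Proof.
have rep k := representation_u ureg ueq ugrowth fgrowth ubdry uinit y t0 (eps_gt0 k).
have eN0 k : eps_ k != 0 :> R by rewrite gt_eqF// eps_gt0.
pose P k := onhalf (fun xi eta => Gk (eps_ k) y t xi eta 0 / eps_ k * h xi eta).
pose T_ k s : R := if 0 < s < t then
  erf (eps_ k / (2 * Num.sqrt (t - s))) / eps_ k * avg f t y s else 0.
have PE k p : P k p = (eps_ k)^-1 * onhalf (fun xi eta => Gk (eps_ k) y t xi eta 0 * h xi eta) p.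
  by rewrite /P /onhalf; case: ifP => _; [ring|rewrite mulr0].
have TE k s : T_ k s = (eps_ k)^-1 *
    (if 0 < s < t then erf (eps_ k / (2 * Num.sqrt (t - s))) * avg f t y s else 0).
  by rewrite /T_; case: ifP => _; [ring|rewrite mulr0].
have sP k : summable_fun (@lebT R m) (P k).
  by rewrite (funext (PE k)); apply: summable_scale; have [] := rep k.
have sT k : summable_fun leb (T_ k).
  by rewrite (funext (TE k)); apply: summable_scale; have [] := rep k.
have uE k : u (eps_ k) y t / eps_ k = \int[@lebT R m]_p P k p - \int[leb]_s T_ k s.
  have [r1 r2 r3] := rep k.
  rewrite (funext (PE k)) (funext (TE k)) !Rintegral_scale//.
  by rewrite -mulrBr -r3 mulrC.
have [A A0 hA] := ugrowth_rate ugrowth t0.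
have [KA hKA] := avg_bound ureg ueq fgrowth y t0.
have [||||sP' lP] := @cvg_Rintegral _ _ _ (@lebT R m) P
   (onhalf (fun xi eta => G1x 0 y t xi eta 0 * h xi eta))
   (fun p => t^-1 * HKcst 1 y t t * A * gaussT (rate t / 2) p).
- by move=> k; exact: summable_measurable.
- move=> p; rewrite /P /onhalf; case: ifPn => p0; last exact: cvg_cst.
  by apply: cvgM; [exact: cvg_Gk_quotient|exact: cvg_cst].
- apply: summable_scale; apply: summable_gaussT.
  by rewrite divr_gt0// invr_gt0 mulr_gt0.
- move=> k p; have cst0 : 0 <= t^-1 * HKcst 1 y t t.
    by rewrite mulr_ge0 ?invr_ge0 ?(ltW t0)//; exact: HKcst_ge0.
  rewrite /P /onhalf; case: ifPn => p0; last first.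
    by rewrite normr0; apply: mulr_ge0; [exact: mulr_ge0|exact: expR_ge0].
  have b1 := @Gk_quotient_bound R m (eps_ k) y t p (eps_gt0 k) (eps_le1 k) t0 p0.
  have b2 := h_growth uinit t0 hA (vec p.2) p0.
  rewrite normrM; apply: (le_trans (ler_pM (normr_ge0 _) (normr_ge0 _) b1 b2)).
  rewrite mulrACA gaussT_expR (_ : rate t - rate t / 2 = rate t / 2)//.
  by field.
have KA0 : 0 <= KA.
  by apply: (le_trans (normr_ge0 _) (hKA (t / 2) _).2); move: t0; lra.
have [||||sT' lT] := @cvg_Rintegral _ _ _ leb T_
   (fun s => if 0 < s < t then (Num.sqrt (pi * (t - s)))^-1 * avg f t y s else 0)
   (fun s => KA * (Num.sqrt pi)^-1 * (if 0 <= s < t then (Num.sqrt (t - s))^-1 else 0)).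
- by move=> k; exact: summable_measurable.
- move=> s; rewrite /T_; case: ifPn => hs; last exact: cvg_cst.
  apply: cvgM; last exact: cvg_cst.
  by apply: cvg_erf_slope; rewrite subr_gt0; case/andP: hs.
- by apply: summable_scale; exact: summable_inverse_sqrt.
- move=> k s; rewrite /T_; case: ifPn => hs; last first.
    rewrite normr0; apply: mulr_ge0; first by rewrite mulr_ge0// invr_ge0 sqrtr_ge0.
    by case: ifP => // _; rewrite invr_ge0 sqrtr_ge0.
  have /andP[s0 st] := hs; have q0 : 0 < t - s by rewrite subr_gt0.
  rewrite (ltW s0) st /=.
  have /andP[e0 e1] := erf_slope_le q0 (@eps_gt0 R k).
  rewrite normrM (ger0_norm e0).
  apply: (le_trans (ler_pM e0 (normr_ge0 _) e1 (hKA s hs).2)).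
  by rewrite sqrtrM ?pi_ge0// invfM mulrC mulrA.
split=> //.
have l : u (eps_ k) y t / eps_ k @[k --> \oo] -->
    (\int[@lebT R m]_p onhalf (fun xi eta => G1x 0 y t xi eta 0 * h xi eta) p -
    \int[leb]_s (if 0 < s < t then (Num.sqrt (pi * (t - s)))^-1 * avg f t y s else 0) : R).
  by under eq_fun do rewrite uE; exact: cvgB.
exact: (cvg_unique (@Rhausdorff R) Vlim l).
Qed.

End flux_equation.

Section ereal_forms.
Context {R : realType}.
Local Notation leb := (@lebesgue_measure R).

Lemma int_DE m (g : R -> 'rV[R]_m -> R) : summable_fun (@lebT R m) (onhalf g) ->
  int_D g = (\int[@lebT R m]_p onhalf g p)%:E.
Proof.
move=> sg; rewrite /int_D integral_mkcond (EFin_Rintegral sg).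
apply: eq_integral => p _; rewrite patchE /onhalf.
have -> : (p \in [set p : measurableTypeR R * m.-tuple (measurableTypeR R) | 0 < p.1]) = (0 < p.1).
  by apply/idP/idP; [move/set_mem|move=> h; exact/mem_set].
by case: ifP.
Qed.

Lemma integral_oo (t : R) (g : R -> \bar R) (k : R -> R) :
  (forall s, 0 < s < t -> g s = (k s)%:E) ->
  summable_fun leb (fun s => if 0 < s < t then k s else 0) ->
  (\int[leb]_(s in `]0%R, t[) g s = (\int[leb]_s (if (0 < s < t)%R then k s else 0)%R)%:E)%E.
Proof.
move=> gk sk; rewrite integral_mkcond (EFin_Rintegral sk).
apply: eq_integral => s _; rewrite patchE mem_setE in_itv/=.
by case: ifPn => // hs; rewrite gk.
Qed.

Lemma gauss_average m (f : 'rV[R]_m -> R -> R) y (t s : R) : s < t ->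
  summable_fun (@lebesgue_tuple R m) (fun w => hk m (sqnorm (y - vec w)) (t - s) * f (vec w) s) ->
  (\int[@lebesgue_tuple R m]_eta (gauss y (vec eta) t s * f (vec eta) s)%:E =
   ((2 * Num.sqrt (pi * (t - s))) ^+ m * avg f t y s)%:E)%E.
Proof.
move=> st sf; set c := _ ^+ m.
have c0 : c != 0.
  by rewrite expf_neq0// mulf_neq0// gt_eqF// sqrtr_gt0 mulr_gt0 ?pi_gt0 ?subr_gt0.
rewrite /avg -(Rintegral_scale _ sf) (EFin_Rintegral (summable_scale c sf)).
apply: eq_integral => w _; congr EFin; rewrite /hk /gauss -/c.
by field.
Qed.

Lemma cvg_flux m (u : R -> 'rV[R]_m -> R -> R) y t :
  cvg (flux_quotient u y t x @[x --> 0^'+]) -> u 0 y t = 0 ->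
  u (eps_ k) y t / eps_ k @[k --> \oo] --> (flux u y t : R).
Proof.
move=> c u00.
have c' : flux_quotient u y t x @[x --> (0 : R)^'+] --> (flux u y t : R) by exact: c.
have := (cvg_at_rightP (flux_quotient u y t) 0 (flux u y t)).1 c' eps_.
move=> /(_ (conj (@eps_gt0 R) (@cvg_eps R))).
apply: cvg_trans; apply: near_eq_cvg; apply: nearW => k.
by rewrite /flux_quotient u00 subr0 mulrC.
Qed.

(** The boundary condition is only assumed as the value of [u] at 0; that [u]
    tends to that value comes from the existence of the one-sided
    derivative. *)
Lemma cvg_boundary m (u : R -> 'rV[R]_m -> R -> R) y t (V : R) :
  u (eps_ k) y t / eps_ k @[k --> \oo] --> V -> u (eps_ k) y t @[k --> \oo] --> (0 : R).
Proof.
move=> c; have h : eps_ k * (u (eps_ k) y t / eps_ k) @[k --> \oo] --> (0 * V : R).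
  by apply: cvgM => //; exact: cvg_eps.
rewrite mul0r in h; apply: cvg_trans h; apply: near_eq_cvg; apply: nearW => k.
by rewrite mulrCA mulfV ?mulr1// gt_eqF// eps_gt0.
Qed.

End ereal_forms.

Theorem theorem2p1 (R : realType) (n : nat) (F : R -> R)
    (h : R -> 'rV[R]_n.-1 -> R) (u : R -> 'rV[R]_n.-1 -> R -> R)
    (hn : (1 <= n)%N)
    (hsol : is_solution F h u)
    (hgrowth : subgaussian_solution u)
    (hsource : subgaussian_source (calF F (flux u))) :
  let V := flux u in
  (forall (x : R) (y : 'rV[R]_n.-1) (t : R), 0 < x -> 0 < t ->
    (u x y t)%:E =
    (u0 h x y t -
     \int[lebesgue_measure]_(tau in `]0%R, t[)
       ((erf (x / (2 * Num.sqrt (t - tau)))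
           / (2 * Num.sqrt (pi * (t - tau))) ^+ n.-1)%:E *
        \int[@lebesgue_tuple R n.-1]_eta
          (gauss y (vec eta) t tau * calF F V (vec eta) tau)%:E))%E) /\
  (forall (y : 'rV[R]_n.-1) (t : R), 0 < t ->
    (V y t)%:E =
    (V0 h y t -
     2%:E * \int[lebesgue_measure]_(tau in `]0%R, t[)
       (((2 * Num.sqrt (pi * (t - tau))) ^+ n)^-1%:E *
        \int[@lebesgue_tuple R n.-1]_eta
          (gauss y (vec eta) t tau * calF F V (vec eta) tau)%:E))%E).
Proof.
(* With n = m.+1 the dimension of the boundary computes to m. *)
case: n h u hn hsol hgrowth hsource => // m h u _ /= [ureg uflux ueq ubd uin] ugrowth fgrowth.
set f := calF F (flux u) in ueq fgrowth *.
have fl y t : 0 < t -> u (eps_ k) y t / eps_ k @[k --> \oo] --> (flux u y t : R).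
  by move=> t0; apply: cvg_flux; [have [] := uflux y t t0|exact: ubd].
have ubdry eta s : 0 < s -> u (eps_ k) eta s @[k --> \oo] --> (0 : R).
  by move=> s0; exact: (cvg_boundary (fl eta s s0)).
have uinit (xi : R) (eta : 'rV[R]_m) : 0 < xi ->
    u xi eta s @[s --> (0 : R)^'+] --> (h xi eta : R).
  by move=> xi0; have [_] := uin xi eta xi0.
have q_gt0 (t s : R) : 0 < s < t -> 0 < 2 * Num.sqrt (pi * (t - s)).
  by move=> /andP[_ st]; rewrite mulr_gt0// sqrtr_gt0 mulr_gt0 ?pi_gt0 ?subr_gt0.
have avgE y t s : 0 < t -> 0 < s < t ->
    (\int[@lebesgue_tuple R m]_eta (gauss y (vec eta) t s * f (vec eta) s)%:E =
     ((2 * Num.sqrt (pi * (t - s))) ^+ m * avg f t y s)%:E)%E.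
  move=> t0 hs; have [KA hKA] := avg_bound ureg ueq fgrowth y t0.
  by apply: gauss_average; [case/andP: hs|exact: (hKA s hs).1].
split=> [x y t x0 t0|y t t0].
- have [r1 r2 r3] := representation_u ureg ueq ugrowth fgrowth ubdry uinit y t0 x0.
  rewrite /u0 (_ : (fun xi eta => _) = (fun xi eta => Gk x y t xi eta 0 * h xi eta)); last first.
    by apply/funext => xi; apply/funext => eta; rewrite G1E.
  rewrite (int_DE r1) (integral_oo _ r2); first by rewrite -EFinB -r3.
  move=> s hs; rewrite (avgE y t s t0 hs) -EFinM; congr EFin.
  by field; rewrite expf_neq0// gt_eqF//; exact: q_gt0.
have [r1 r2 r3] := representation_flux ureg ueq ugrowth fgrowth ubdry uinit t0 (fl y t t0).
(* Half of the kernel (pi q)^(-1/2): the factor 2 stands in front of the time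
   integral. *)
have r2' : summable_fun (@lebesgue_measure R) (fun s => if 0 < s < t then (2 * Num.sqrt (pi * (t - s)))^-1 * avg f t y s else 0).
  apply: eq_integrable (summable_scale 2^-1 r2) => // s _.
  by rewrite /=; case: ifP => _; rewrite ?mulr0// invfM mulrA.
rewrite /V0 (int_DE r1) (integral_oo _ r2').
  rewrite -EFinM -EFinB r3 -(Rintegral_scale _ r2'); congr (_ - _)%:E.
  apply: eq_Rintegral => s _; case: ifP => _; last by rewrite mulr0.
  by rewrite invfM !mulrA mulfV ?mul1r.
move=> s hs; rewrite (avgE y t s t0 hs) -EFinM; congr EFin.
rewrite exprS invfM -mulrA; congr (_ * _).
by rewrite mulrA mulVf ?mul1r// expf_neq0// gt_eqF//; exact: q_gt0.
Qed.
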